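(* Let $\Omega = \{z \in \mathbb{C} : f(z) + \overline{f(z)} - |z|^2 > 0\}$ be a smooth RL-domain (that is, a bounded RL-domain with smooth boundary) of order $n \geq 2$ and connectivity $k$, where $f$ is the function associated with the RL-domain, so that $f'$ is a rational function of degree $n$. If $\Omega$ is not an annulus, then the number $N$ of critical points in $\Omega$ of the landscape function $v$ of $\Omega$ satisfies $$N \leq 4n + k - 6.$$
   Context: All domains $\Omega\subset\mathbb{C}$ are bounded, open, connected and finitely connected. The connectivity $k$ of $\Omega$ is the number of connected components of $\partial\Omega$. The landscape function $v$ of $\Omega$ is the unique solution of $\Delta v = -2$ in $\Omega$, $v = 0$ on $\partial\Omega$. A critical point of $v$ is a point $z\in\Omega$ with $\nabla v(z) = 0$; $N$ counts distinct points. RL-domain (''rational landscape domain''): a domain $\Omega$ such that $\partial\Omega$ is a subset of $\{z : |z|^2 = f(z) + \overline{f(z)}\}$, where the derivative $f'$ is a rational function. Here $f$ itself may be multivalued (it may involve logarithms), but $f+\overline{f} = 2\operatorname{Re} f$ is single-valued, and $\operatorname{Re} f$ is the harmonic function on $\Omega$ with boundary values $|z|^2/2$, so that the landscape function is $v(z) = \operatorname{Re} f(z) - \frac{|z|^2}{2}$. The order of the RL-domain $\Omega$ is the degree of the rational function $f'$ (the maximum of the degrees of numerator and denominator in lowest terms). ''Annulus'' means a domain bounded by two concentric circles. *)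

(* Defs.v *)
From HB Require Import structures.
From mathcomp Require Import all_boot all_order all_algebra.
From mathcomp Require Import complex.
From mathcomp Require Import all_classical all_reals all_analysis.

Set Implicit Arguments.
Unset Strict Implicit.
Unset Printing Implicit Defensive.

Import Order.TTheory GRing.Theory Num.Theory.
Import numFieldNormedType.Exports.

Local Open Scope classical_set_scope.
Local Open Scope ring_scope.
Local Open Scope complex_scope.

(* The copy [(R[i])^o] carries the usual topology of the complex plane and the
   structure of a normed space over [R[i]]; derivatives of maps
   [cplane R -> cplane R] are therefore complex derivatives. *)
Notation cplane R := (complex R)^o.

Section Plane.
Variable R : realType.
Implicit Types (Omega D U : set (cplane R)) (h u v : cplane R -> R).

Definition modulus (z : cplane R) : R := Normc.normc z.

Definition boundary Omega := closure Omega `\` interior Omega.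

Definition domain Omega :=
  [/\ Omega !=set0, open Omega, connected Omega & bounded_set Omega].

Definition boundary_components Omega : set (set (cplane R)) :=
  [set connected_component (boundary Omega) z | z in boundary Omega].

Definition connectivity Omega (k : nat) := (boundary_components Omega #= `I_k)%card.

Definition hslice h (z : cplane R) (t : R) : R := h (z + (t +i* 0)).
Definition vslice h (z : cplane R) (t : R) : R := h (z + (0 +i* t)).

Definition partial_x h (z : cplane R) : R := derive1 (hslice h z) 0.
Definition partial_y h (z : cplane R) : R := derive1 (vslice h z) 0.

Definition laplacian h (z : cplane R) : R :=
  partial_x (partial_x h) z + partial_y (partial_y h) z.

(* [h] is of class C^m on [U], meaningful for open [U] only. *)
Fixpoint Cn (m : nat) U h : Prop :=
  (forall z, U z -> {for z, continuous h}) /\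
  match m with
  | 0 => True
  | m'.+1 =>
      [/\ forall z, U z -> derivable (hslice h z) 0 1,
          forall z, U z -> derivable (vslice h z) 0 1,
          Cn m' U (partial_x h) & Cn m' U (partial_y h)]
  end.

Definition grad_zero h (z : cplane R) := partial_x h z = 0 /\ partial_y h z = 0.

(* A C^oo defining function near each boundary point: the boundary is locally a
   smooth curve with [Omega] on exactly one side. *)
Definition smooth_boundary Omega :=
  forall p, boundary Omega p ->
  exists (U : set (cplane R)) (rho : cplane R -> R),
    [/\ open U, U p, forall m, Cn m U rho,
        forall z, U z -> ~ grad_zero rho z
      & Omega `&` U = [set z | U z /\ 0 < rho z]].

Definition landscape Omega v :=
  [/\ Cn 2 Omega v,
      forall z, Omega z -> laplacian v z = -2,
      {within closure Omega, continuous v}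
    & forall z, boundary Omega z -> v z = 0].

Definition critical_points Omega v : set (cplane R) :=
  [set z | Omega z /\ grad_zero v z].

Definition ratfun (P Q : {poly R[i]}) (z : cplane R) : cplane R :=
  P.[z] / Q.[z].

(* The degree of [P / Q], provided that [P] and [Q] are coprime. *)
Definition ratfun_degree (P Q : {poly R[i]}) : nat :=
  (maxn (size P) (size Q)).-1.

(* [u] is the real part of a possibly multivalued analytic function [f] on
   [D] with [f' = r]: the branches [g] of [f] may differ by periods, while
   their real part is the single-valued function [u]. *)
Definition Re_primitive D (r : cplane R -> cplane R) u :=
  forall z0, D z0 -> exists g : cplane R -> cplane R,
    \forall z \near z0, is_derive z (1 : cplane R) g (r z) /\ u z = complex.Re (g z).

(* [Omega] is an RL-domain with associated function [f], where [f' = P / Q] is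
   in lowest terms and [u = Re f]. The open set [D] is where the function
   [f + conj f = 2 u] is defined and single-valued. It contains no pole of
   [f'], and may be the whole plane minus the poles; in general [f] may have
   periods that are not purely imaginary around poles outside [Omega], and then
   [2 u] is single-valued only on a smaller set. *)
Definition RL_domain Omega D (P Q : {poly R[i]}) u :=
  [/\ domain Omega,
      Q != 0 /\ coprimep P Q,
      [/\ open D, closure Omega `<=` D & forall z, D z -> ~~ root Q z],
      Re_primitive D (ratfun P Q) u
    & boundary Omega `<=` [set z | modulus z ^+ 2 = 2 * u z]].

Definition annulus Omega :=
  exists (c : cplane R) (r1 r2 : R), [/\ 0 < r1, r1 < r2 &
    Omega = [set z | r1 < modulus (z - c) < r2]].

End Plane.

(* Main.v *)
(* By the maximum principle v = Re f - |z|^2 / 2 with f' = P / Q, so the critical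
   points of v are the fixed points of the anti-rational map g = conj (P / Q), and
   near such a point z the second-order part of v has eigenvalues
   (- 1 +- |f''(z)|) / 2.

   Points with |f''| <= 1 are non-repelling fixed points of g, and there are at most
   2n - 2 of them: each one attracts a critical point of g (Fatou). Discs inside its
   basin are shrunk by the iterates of g o g far more than they should be by the
   Schwarz-Ahlfors lemma if no critical orbit entered the basin. That lemma comes
   from maximizing a ratio of Hermitian forms over the homogeneous lift of the map,
   which makes the count independent of normal families and of uniformization.

   Points with |f''| > 1 are saddles. From each, two paths inside {v > v(s)} climb to
   local maxima, which are points of the first kind. If there were more than
   #maxima + k - 2 saddles, a nontrivial real combination of these arcs would be a
   cycle with winding number 0 around every boundary component (the outer one is
   automatic). The set K of points of the cycle or of nonzero winding number would
   then be a compact subset of the domain; near the lowest saddle of the cycle the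
   winding number jumps, so v takes on K a value below all its values on the cycle,
   and v would have an interior local minimum, contradicting its Laplacian -2.

   Altogether N <= 2 (2n - 2) + k - 2. *)
Require Import Defs.
From HB Require Import structures.
From mathcomp Require Import all_boot all_order all_algebra.
From mathcomp Require Import complex.
From mathcomp Require Import all_classical all_reals all_analysis.
From mathcomp Require Import ring lra zify.

Set Implicit Arguments.
Unset Strict Implicit.
Unset Printing Implicit Defensive.

Import Order.TTheory GRing.Theory Num.Theory.
Import numFieldNormedType.Exports.

Local Open Scope classical_set_scope.
Local Open Scope ring_scope.

(** * Binary forms and their Jacobians *)

(** The square of [g] is rational, and its multiplier at a fixed point of [g] is [|f''|^2], real and
    nonnegative. A non-repelling fixed point is therefore attracting or has multiplier exactly 1;
    irrational rotations cannot occur. Distinct points have disjoint basins, and [2n - 2] is the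
    degree of the Jacobian form of [(P, Q)], whose zeros are counted projectively because one of
    them may lie at infinity.

    The shrinking of discs has to be secured in the parabolic case too: along a suitable orbit the
    derivative of the iterates is at most a constant times the power 3/2 of the distance to the
    fixed point, while discs of radius proportional to that distance stay in the basin.

    The two savings behind [k - 2] come from linear algebra over the reals: closing a chain needs no
    equation at one chosen endpoint, and vanishing of the winding needs none at one boundary
    component. Real coefficients are allowed because only local constancy of winding numbers is
    used, never integrality. *)

Section Forms.
Variable n : nat.

(** The degree is the section variable [n], not the size of [p]: polynomials of different degrees
    become forms of the same degree, and infinity is the point [(1, 0)]. *)
Definition hom (A : comNzRingType) (p : {poly A}) (x y : A) : A :=
  \sum_(i < n.+1) p`_i * (x ^+ i * y ^+ (n - i)).

(** The Jacobian determinant of the two forms divided by [n]: the determinant has the coefficients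
    [i (n - j) - (n - i) j = n (i - j)]. A predecessor in an exponent is truncated only when
    [i = j], where the coefficient vanishes. *)
Definition jac (A : comNzRingType) (p q : {poly A}) (x y : A) : A :=
  \sum_(i < n.+1) \sum_(j < n.+1) (p`_i * q`_j) *
     ((i%:R - j%:R) * (x ^+ (i + j).-1 * y ^+ (n + n - (i + j)).-1)).

Definition step (A : comNzRingType) (P : {poly A} * {poly A}) (X : A * A) :=
  (hom P.1 X.1 X.2, hom P.2 X.1 X.2).

Fixpoint orb (A : comNzRingType) (L : seq ({poly A} * {poly A})) (X : A * A) :=
  if L is P :: L' then orb L' (step P X) else X.

(** Chain rule product: up to a power of [n], the Jacobian determinant of the composite [orb L]. *)
Fixpoint jacs (A : comNzRingType) (L : seq ({poly A} * {poly A})) (X : A * A) : A :=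
  if L is P :: L' then jac P.1 P.2 X.1 X.2 * jacs L' (step P X) else 1.

Definition scale (A : comNzRingType) (c : A) (X : A * A) := (c * X.1, c * X.2).

Lemma hom_scale (A : comNzRingType) (p : {poly A}) c x y :
  hom p (c * x) (c * y) = c ^+ n * hom p x y.
Proof.
rewrite /hom mulr_sumr; apply: eq_bigr => i _.
have <- : c ^+ i * c ^+ (n - i) = c ^+ n by rewrite -exprD subnKC // -ltnS.
by rewrite !exprMn; ring.
Qed.

Lemma step_scale (A : comNzRingType) (P : {poly A} * {poly A}) c X :
  step P (scale c X) = scale (c ^+ n) (step P X).
Proof. by rewrite /step /scale /= !hom_scale. Qed.

Lemma orb_scale (A : comNzRingType) (L : seq ({poly A} * {poly A})) c X :
  orb L (scale c X) = scale (c ^+ (n ^ size L)) (orb L X).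
Proof.
elim: L c X => [|P L IH] c X /=; first by rewrite expn0 expr1.
by rewrite step_scale IH -exprM expnS.
Qed.

Lemma jac_scale (A : comNzRingType) (p q : {poly A}) c x y :
  c ^+ 2 * jac p q (c * x) (c * y) = c ^+ (n + n) * jac p q x y.
Proof.
rewrite /jac !mulr_sumr; apply: eq_bigr => i _.
rewrite !mulr_sumr; apply: eq_bigr => j _.
have [->|neq] := eqVneq (i : nat) j; first by rewrite subrr; ring.
have <- : c ^+ 2 * (c ^+ (i + j).-1 * c ^+ (n + n - (i + j)).-1) = c ^+ (n + n).
  rewrite -!exprD; congr (_ ^+ _).
  by have := ltn_ord i; have := ltn_ord j; move/eqP: neq; lia.
by rewrite !exprMn; ring.
Qed.

Lemma jacs_scale (A : comNzRingType) (L : seq ({poly A} * {poly A})) c X :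
  c ^+ 2 * jacs L (scale c X) = (c ^+ (n ^ size L)) ^+ 2 * jacs L X.
Proof.
elim: L c X => [|P L IH] c X /=; first by rewrite expn0 expr1.
have := IH (c ^+ n) (step P X); rewrite -step_scale -!exprM mulnA -expnS => E.
have := jac_scale P.1 P.2 c X.1 X.2; rewrite addnn -muln2 => E2.
rewrite mulrA E2 mulrAC E; ring.
Qed.

Lemma orb_cat (A : comNzRingType) (L1 L2 : seq ({poly A} * {poly A})) X :
  orb (L1 ++ L2) X = orb L2 (orb L1 X).
Proof. by elim: L1 X => //= P L IH X. Qed.

Lemma jacs_cat (A : comNzRingType) (L1 L2 : seq ({poly A} * {poly A})) X :
  jacs (L1 ++ L2) X = jacs L1 X * jacs L2 (orb L1 X).
Proof. by elim: L1 X => [|P L IH] X /=; rewrite ?mul1r // IH mulrA. Qed.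

Section Map.
Variables (A B : comNzRingType) (f : {rmorphism A -> B}).

Lemma hom_map (p : {poly A}) x y : f (hom p x y) = hom (map_poly f p) (f x) (f y).
Proof.
rewrite /hom rmorph_sum; apply: eq_bigr => i _.
by rewrite coef_map !rmorphM !rmorphXn.
Qed.

Lemma jac_map (p q : {poly A}) x y :
  f (jac p q x y) = jac (map_poly f p) (map_poly f q) (f x) (f y).
Proof.
rewrite /jac rmorph_sum; apply: eq_bigr => i _.
rewrite rmorph_sum; apply: eq_bigr => j _.
by rewrite !coef_map !rmorphM !rmorphXn rmorphB !rmorph_nat.
Qed.

Definition map_pair (X : A * A) := (f X.1, f X.2).
Definition map_ppair (P : {poly A} * {poly A}) := (map_poly f P.1, map_poly f P.2).

Lemma step_map P X : map_pair (step P X) = step (map_ppair P) (map_pair X).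
Proof. by rewrite /step /map_pair /= !hom_map. Qed.

Lemma orb_map L X : map_pair (orb L X) = orb (map map_ppair L) (map_pair X).
Proof. by elim: L X => //= P L IH X; rewrite IH step_map. Qed.

Lemma jacs_map L X : f (jacs L X) = jacs (map map_ppair L) (map_pair X).
Proof.
elim: L X => [|P L IH] X /=; first by rewrite rmorph1.
by rewrite rmorphM IH jac_map step_map.
Qed.
End Map.

(** * Wronskians of polynomial curves under homogeneous maps *)

Section Wronskian.
Variable A : comNzRingType.
Implicit Types a b : {poly A}.

Definition wronskian a b := a^`() * b - a * b^`().

(** The derivative of [a] comes with the coefficient [i - j], that of [b] with [(n - i) - (n - j)];
    these are opposite, so the Wronskian of [a] and [b] factors out. This explains the normalization
    of [jac]. *)
Lemma wronskian_monomials a b i j : (i <= n)%N -> (j <= n)%N ->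
  wronskian (a ^+ i * b ^+ (n - i)) (a ^+ j * b ^+ (n - j)) =
  (i%:R - j%:R) * (a ^+ (i + j).-1 * b ^+ (n + n - (i + j)).-1) * wronskian a b.
Proof.
move=> ni nj; rewrite /wronskian !derivM.
have D (c : {poly A}) m : (c ^+ m)^`() = m%:R * c ^+ m.-1 * c^`().
  by rewrite deriv_exp -(mulr_natl _ m) mulrA mulrAC.
rewrite !D.
have [->|neq] := eqVneq i j; first by rewrite subrr; ring.
have [k [l [Ek El]]] : exists k l, (i + j = k.+1)%N /\ (n + n - (i + j) = l.+1)%N.
  by exists (i + j).-1, (n + n - (i + j)).-1; move/eqP: neq; lia.
rewrite El Ek /=.
have E1 m (c : {poly A}) : m%:R * c ^+ m.-1 * c = m%:R * c ^+ m.
  by case: m => [|m]; rewrite ?mul0r //= -mulrA -exprSr.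
have nij : (n - i)%:R - (n - j)%:R = - (i%:R - j%:R) :> {poly A}.
  by rewrite !natrB //; ring.
have Ea : a ^+ i * a ^+ j = a ^+ k.+1 by rewrite -exprD Ek.
have Eb : b ^+ (n - i) * b ^+ (n - j) = b ^+ l.+1.
  by rewrite -exprD; congr (_ ^+ _); lia.
have Ai : i%:R * a ^+ i.-1 * a ^+ j = i%:R * a ^+ k.
  by case: i ni neq Ek {El nij Ea Eb} => [|i] _ _ Ek; rewrite ?mul0r //= -mulrA -exprD; congr (_ * _ ^+ _); lia.
have Aj : j%:R * a ^+ j.-1 * a ^+ i = j%:R * a ^+ k.
  by case: j nj neq Ek {El nij Ea Eb Ai} => [|j] _ _ Ek; rewrite ?mul0r //= -mulrA -exprD; congr (_ * _ ^+ _); lia.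
have Bi : (n - i)%:R * b ^+ (n - i).-1 * b ^+ (n - j) = (n - i)%:R * b ^+ l.
  case E: (n - i)%N => [|m]; rewrite ?mul0r //= -mulrA -exprD.
  by congr (_ * _ ^+ _); lia.
have Bj : (n - j)%:R * b ^+ (n - j).-1 * b ^+ (n - i) = (n - j)%:R * b ^+ l.
  case E: (n - j)%N => [|m]; rewrite ?mul0r //= -mulrA -exprD.
  by congr (_ * _ ^+ _); lia.
transitivity ((i%:R * a ^+ i.-1 * a ^+ j - j%:R * a ^+ j.-1 * a ^+ i) * a^`()
    * (b ^+ (n - i) * b ^+ (n - j)) +
  ((n - i)%:R * b ^+ (n - i).-1 * b ^+ (n - j) -
   (n - j)%:R * b ^+ (n - j).-1 * b ^+ (n - i)) * b^`() * (a ^+ i * a ^+ j)).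
  by ring.
rewrite Ea Eb Ai Aj Bi Bj -!mulrBl nij [a ^+ k.+1]exprS [b ^+ l.+1]exprS.
by ring.
Qed.

Lemma wronskianC c d a b :
  wronskian (c%:P * a) (d%:P * b) = (c%:P * d%:P) * wronskian a b.
Proof. by rewrite /wronskian !derivM !derivC; ring. Qed.

Lemma wronskian_suml (I J : finType) (f : I -> {poly A}) (g : J -> {poly A}) :
  wronskian (\sum_i f i) (\sum_j g j) = \sum_i \sum_j wronskian (f i) (g j).
Proof.
have D (K : finType) (h : K -> {poly A}) : (\sum_i h i)^`() = \sum_i (h i)^`().
  exact: raddf_sum.
rewrite /wronskian !D !mulr_suml -sumrB; apply: eq_bigr => i _.
by rewrite !mulr_sumr -sumrB.
Qed.

(** The Wronskian is the area form on position and velocity of the curve [(a, b)]; by Euler's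
    identity a homogeneous map multiplies it by its Jacobian over [n]. Lifting the coefficients by
    [^:P] leaves only [a] and [b] to be differentiated. *)
Lemma wronskian_hom (p q : {poly A}) a b :
  wronskian (hom p^:P a b) (hom q^:P a b) = jac p^:P q^:P a b * wronskian a b.
Proof.
rewrite /hom wronskian_suml /jac mulr_suml; apply: eq_bigr => i _.
rewrite mulr_suml; apply: eq_bigr => j _.
rewrite !coef_map wronskianC wronskian_monomials ?leq_ord //.
by rewrite !mulrA.
Qed.

Lemma wronskian_orb (L : seq ({poly A} * {poly A})) (X : {poly A} * {poly A}) :
  let L' := map (map_ppair (@polyC A)) L in
  wronskian (orb L' X).1 (orb L' X).2 = jacs L' X * wronskian X.1 X.2.
Proof.
elim: L X => [|P L IH] X /=; first by rewrite mul1r.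
by rewrite IH /step /= wronskian_hom mulrA [jacs _ _ * _]mulrC.
Qed.

End Wronskian.

Lemma hom1r (A : comNzRingType) (p : {poly A}) x :
  (size p <= n.+1)%N -> hom p x 1 = p.[x].
Proof.
move=> sp; rewrite (horner_coef_wide _ sp) /hom; apply: eq_bigr => i _.
by rewrite expr1n mulr1.
Qed.

Lemma hom10 (A : comNzRingType) (p : {poly A}) : hom p 1 0 = p`_n.
Proof.
rewrite /hom big_ord_recr /= subnn expr0 expr1n !mulr1 big1 ?add0r // => i _.
by rewrite expr0n subn_eq0 leqNgt ltn_ord mulr0 mulr0.
Qed.

(** * Forms without a common zero on the projective line *)

Section NonVanishing.
Variable F : fieldType.
Implicit Types p q : {poly F}.

(** Coprimality excludes a common affine zero of the two forms, the exact degree a common zero at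
    [(1, 0)]. *)
Definition nondeg (P : {poly F} * {poly F}) :=
  coprimep P.1 P.2 && ((maxn (size P.1) (size P.2)).-1 == n).

Lemma nondeg_size P : nondeg P -> (size P.1 <= n.+1)%N /\ (size P.2 <= n.+1)%N.
Proof. by move=> /andP[_ /eqP <-]; split; lia. Qed.

Lemma nondeg_coef P : nondeg P -> P.1`_n = 0 -> P.2`_n = 0 -> False.
Proof.
case: P => p q /andP[/= cop /eqP en] pn qn.
suff [/eqP p0 /eqP q0] : p == 0 /\ q == 0.
  by move: cop; rewrite p0 q0 coprimep_def gcdp0 size_poly0.
case: (leqP (size p) (size q)) en => [pq|/ltnW pq]; rewrite ?(maxn_idPr pq) ?(maxn_idPl pq) => en.
  have q0 : q == 0 by rewrite -lead_coef_eq0 lead_coefE en; apply/eqP.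
  by split=> //; move: pq; rewrite (eqP q0) size_poly0 leqn0 size_poly_eq0.
have p0 : p == 0 by rewrite -lead_coef_eq0 lead_coefE en; apply/eqP.
by split=> //; move: pq; rewrite (eqP p0) size_poly0 leqn0 size_poly_eq0.
Qed.

Lemma step_neq0 P X : nondeg P -> X != (0, 0) -> step P X != (0, 0).
Proof.
case: P X => p q [x y] ndP; have [sp sq] := nondeg_size ndP.
apply: contra_neq; rewrite /step /= => -[hp hq].
have [y0|yN0] := eqVneq y 0.
  have [x0|xN0] := eqVneq x 0; first by rewrite x0 y0.
  have E (r : {poly F}) : hom r x y = x ^+ n * r`_n.
    by rewrite -hom10 -hom_scale mulr0 mulr1 y0.
  have xn : x ^+ n != 0 by rewrite expf_neq0.
  by case: (nondeg_coef ndP); apply/eqP; [move: hp | move: hq];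
    rewrite E => /eqP; rewrite mulf_eq0 (negPf xn).
have E (r : {poly F}) : (size r <= n.+1)%N -> hom r x y = y ^+ n * r.[x / y].
  by move=> sr; rewrite -hom1r // -hom_scale mulr1 mulrCA divff // mulr1.
have yn : y ^+ n != 0 by rewrite expf_neq0.
move/eqP: hp; rewrite E // mulf_eq0 (negPf yn) /= => rp.
move/eqP: hq; rewrite E // mulf_eq0 (negPf yn) /= => rq.
case/andP: ndP => /= cop _; have := coprimep_root cop rp.
by rewrite (eqP rq) eqxx.
Qed.

Lemma orb_neq0 L X : all nondeg L -> X != (0, 0) -> orb L X != (0, 0).
Proof. by elim: L X => //= P L IH X /andP[ndP ndL] X0; apply: IH => //; apply: step_neq0. Qed.

End NonVanishing.

End Forms.
Arguments nondeg n {F} P.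

Local Open Scope complex_scope.

(** * The complex plane *)

Section ComplexTopology.
Variable R : realType.
Local Notation C := (cplane R).
Implicit Types (z w : C) (A : set C).

Lemma normE z : `|z| = (modulus z)%:C.
Proof. by []. Qed.

Lemma modulus_ge0 z : 0 <= modulus z.
Proof. by rewrite -lecR -normE normr_ge0. Qed.

Lemma modulus0 : modulus (0 : C) = 0.
Proof. by apply: complexI; rewrite -normE normr0. Qed.

Lemma modulus_eq0 z : (modulus z == 0) = (z == 0).
Proof. by rewrite -(inj_eq (@complexI R)) -normE normr_eq0. Qed.

Lemma modulusD z w : modulus (z + w) <= modulus z + modulus w.
Proof. by rewrite -lecR rmorphD /= -!normE ler_normD. Qed.

Lemma modulusM z w : modulus (z * w) = modulus z * modulus w.
Proof. by apply: complexI; rewrite rmorphM /= -!normE normrM. Qed.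

Lemma modulusN z : modulus (- z) = modulus z.
Proof. by apply: complexI; rewrite -!normE normrN. Qed.

Lemma modulusC z w : modulus (z - w) = modulus (w - z).
Proof. by rewrite -modulusN opprB. Qed.

(** Balls of [cplane R] have radii in [R[i]]; a positive radius has zero imaginary part and so is
    real. *)
Lemma nbhsP z (P : set C) :
  nbhs z P <-> exists2 e : R, 0 < e & forall w, modulus (w - z) < e -> P w.
Proof.
split.
  move=> /nbhs_ballP[e /= e0 He].
  case: e e0 He => a b; rewrite ltcE /= => /andP[/eqP b0 a0] He.
  exists a => // w wz; apply: He; rewrite -ball_normE /= ltcE /=.
  by rewrite b0 eqxx /= -/(modulus (z - w)) modulusC.
move=> [e e0 He]; apply/nbhs_ballP; exists e%:C; first by rewrite /= ltcR.
move=> w; rewrite -ball_normE /= => zw; apply: He.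
by rewrite modulusC -ltcR.
Qed.

Lemma modulus_sqr z : modulus z ^+ 2 = complex.Re z ^+ 2 + complex.Im z ^+ 2.
Proof. by case: z => a b; rewrite /modulus /= sqr_sqrtr // addr_ge0 ?sqr_ge0. Qed.

Lemma ler_Re_modulus z : `|complex.Re z| <= modulus z.
Proof.
rewrite -(@ler_pXn2r _ 2) ?nnegrE ?modulus_ge0 ?normr_ge0 //.
by rewrite modulus_sqr -normrX ger0_norm ?sqr_ge0 // lerDl sqr_ge0.
Qed.

Lemma ler_Im_modulus z : `|complex.Im z| <= modulus z.
Proof.
rewrite -(@ler_pXn2r _ 2) ?nnegrE ?modulus_ge0 ?normr_ge0 //.
by rewrite modulus_sqr -normrX ger0_norm ?sqr_ge0 // lerDr sqr_ge0.
Qed.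

Lemma modulus_le z : modulus z <= `|complex.Re z| + `|complex.Im z|.
Proof.
rewrite -(@ler_pXn2r _ 2) ?nnegrE ?modulus_ge0 ?addr_ge0 ?normr_ge0 //.
rewrite modulus_sqr sqrrD !real_normK ?num_real // -addrA.
by rewrite [X in _ <= _ + X]addrC lerD2l lerDl mulrn_wge0 // mulr_ge0.
Qed.

Lemma modulus_real (x : R) : modulus (x%:C : C) = `|x|.
Proof. by rewrite /modulus /= expr0n /= addr0 sqrtr_sqr. Qed.

Lemma ltr_modulus_gt0 z : (0 < modulus z) = (z != 0).
Proof. by rewrite lt_def modulus_ge0 andbT modulus_eq0. Qed.

Lemma modulusB z w : modulus (z - w) <= modulus z + modulus w.
Proof. by rewrite -[modulus w]modulusN modulusD. Qed.

Lemma openP A : open A <-> forall z, A z ->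
  exists2 e : R, 0 < e & forall w, modulus (w - z) < e -> A w.
Proof.
rewrite openE; split=> H z Az; first by apply/nbhsP; apply: H.
by apply/nbhsP; apply: H.
Qed.

Lemma closureP A z : closure A z <-> forall e : R, 0 < e ->
  exists2 w, A w & modulus (w - z) < e.
Proof.
split=> H.
  move=> e e0; have [|w [Aw we]] := H [set w | modulus (w - z) < e].
    by apply/nbhsP; exists e.
  by exists w.
move=> B /nbhsP[e e0 He]; have [w Aw we] := H e e0.
by exists w; split=> //; apply: He.
Qed.

Lemma continuousP_eps (f : C -> R) z : {for z, continuous f} <->
  forall e : R, 0 < e -> exists2 d : R, 0 < d &
    forall w, modulus (w - z) < d -> `|f w - f z| < e.
Proof.
split.
  move=> cf e e0.
  have /nbhsP[d d0 Hd] : nbhs z (f @^-1` ball (f z) e) by apply: cf; apply: nbhsx_ballx.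
  by exists d => // w /Hd; rewrite /= -ball_normE /= distrC.
move=> H A /nbhs_ballP[e /= e0 He]; have [d d0 Hd] := H e e0.
apply/nbhsP; exists d => // w /Hd wz; apply: He.
by rewrite -ball_normE /= distrC.
Qed.

Lemma modulus_continuous : continuous (@modulus R).
Proof.
move=> z; apply/continuousP_eps => e e0; exists e => // w wz.
rewrite ltr_norml; apply/andP; split.
  rewrite ltrNl opprB ltrBlDl; apply: le_lt_trans (_ : modulus w + modulus (w - z) < _).
    by rewrite [modulus (w - z)]modulusC -{1}(subrKC w z) modulusD.
  by rewrite ltrD2l.
rewrite ltrBlDl; apply: le_lt_trans (_ : modulus z + modulus (w - z) < _).
  by rewrite -{1}(subrKC z w) modulusD.
by rewrite ltrD2l.
Qed.

Lemma Re_continuous : continuous (@complex.Re R : C -> R).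
Proof.
move=> z; apply/continuousP_eps => e e0; exists e => // w; apply: le_lt_trans.
by rewrite -raddfB ler_Re_modulus.
Qed.

Lemma Im_continuous : continuous (@complex.Im R : C -> R).
Proof.
move=> z; apply/continuousP_eps => e e0; exists e => // w; apply: le_lt_trans.
by rewrite -raddfB ler_Im_modulus.
Qed.

Lemma conjc_continuous : continuous (@conjc R : C -> C).
Proof.
move=> z A /nbhsP[e e0 He]; apply/nbhsP; exists e => // w wz; apply: He.
by move: wz; rewrite -rmorphB /modulus; case: (w - z) => a b /=; rewrite sqrrN.
Qed.

Lemma bounded_closed_compactC (A : set C) (M : R) :
  closed A -> (forall z, A z -> modulus z <= M) -> compact A.
Proof.
move=> cA bA.
pose f (x : R * R) : C := x.1 +i* x.2.
have cf : continuous f.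
  move=> x B /nbhsP[e e0 He].
  have e20 : 0 < e / 2 by rewrite divr_gt0.
  exists (ball x.1 (e / 2), ball x.2 (e / 2)) => /=; first by split; apply: nbhsx_ballx.
  move=> [a b] [] /=; rewrite -!ball_normE /= => xa xb; apply: He.
  apply: le_lt_trans (modulus_le _) _ => /=.
  by rewrite distrC [X in _ + X]distrC (splitr e) ltrD.
have cK : compact (f @` (`[-M, M] `*` `[-M, M])).
  apply: continuous_compact; first exact: continuous_subspaceT.
  by apply: compact_setX; apply: segment_compact.
apply: subclosed_compact cA cK _ => -[a b] /bA zM.
exists (a, b) => //; split; rewrite /= in_itv /= -ler_norml.
  exact: le_trans (ler_Re_modulus (a +i* b)) zM.
exact: le_trans (ler_Im_modulus (a +i* b)) zM.
Qed.

End ComplexTopology.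

(** * The Ahlfors maximum principle *)

Section Jets.
Variable R : realType.
Local Notation C := (R[i]).

Lemma poly_ge0_near0 (h : {poly R}) (d : R) : 0 < d ->
  (forall s, 0 < s < d -> 0 <= h.[s]) -> 0 <= h.[0].
Proof.
move=> d0 Hh; rewrite leNgt; apply/negP => h0.
have : \forall s \near (0 : R), h.[s] < 0.
  have := @continuous_horner _ h 0; rewrite /continuous_at => ch.
  exact: cvgr_lt ch _ h0.
move=> /nbhs_ballP[e /= e0 He].
have m0 : 0 < Num.min d e / 2 by rewrite divr_gt0 // lt_min d0.
have : Num.min d e / 2 < Num.min d e by rewrite ltr_pdivrMr // mulrDr mulr1 ltrDl lt_min d0.
rewrite lt_min => /andP[md me].
have := Hh (Num.min d e / 2); rewrite m0 md => /(_ isT).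
rewrite leNgt => /negP; apply; apply: He.
by rewrite -ball_normE /= sub0r normrN gtr0_norm.
Qed.

(** Division by ['X] replaces differentiation. The signs of the first quotient on the two sides of 0
    force it to vanish there, and the second quotient is nonnegative for small positive [s]. *)
Lemma poly_min2 (h : {poly R}) (d : R) : 0 < d ->
  (forall s, `|s| < d -> 0 <= h.[s]) -> h`_0 = 0 -> h`_1 = 0 /\ 0 <= h`_2.
Proof.
move=> d0 Hh h0.
have factor0 (p : {poly R}) : p`_0 = 0 -> exists p', p = p' * 'X.
  rewrite -horner_coef0 => /eqP/factor_theorem[p' ->].
  by exists p'; rewrite polyC0 subr0.
have [h' Eh] := factor0 h h0.
have h1 : h'`_0 = 0.
  apply/eqP; rewrite eq_le -horner_coef0; apply/andP; split.
    have := @poly_ge0_near0 (- h' \Po (- 'X)) d d0.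
    rewrite horner_comp !hornerE oppr0 oppr_ge0; apply=> s /andP[s0 sd].
    have := Hh (- s); rewrite normrN gtr0_norm // sd => /(_ isT).
    by rewrite Eh horner_comp !hornerE mulrN -mulNr pmulr_lge0.
  apply: (@poly_ge0_near0 h' d) => // s /andP[s0 sd].
  have := Hh s; rewrite gtr0_norm // sd => /(_ isT).
  by rewrite Eh hornerM hornerX pmulr_lge0.
have [h'' Eh'] := factor0 h' h1.
rewrite Eh !coefMX /= h1; split=> //.
rewrite Eh' coefMX /= -horner_coef0; apply: (@poly_ge0_near0 h'' d) => // s /andP[s0 sd].
have := Hh s; rewrite gtr0_norm // sd => /(_ isT).
by rewrite Eh Eh' !hornerM hornerX !pmulr_lge0.
Qed.

Definition Rep (p : {poly C}) : {poly R} := map_poly (@complex.Re R) p.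
Definition Imp (p : {poly C}) : {poly R} := map_poly (@complex.Im R) p.

Lemma horner_Rep p s : (Rep p).[s] = complex.Re p.[s%:C].
Proof.
rewrite horner_coef (horner_coef_wide _ (_ : size p <= size p)%N) //.
rewrite raddf_sum /= (big_ord_widen_cond (size p) xpredT (fun i => (Rep p)`_i * s ^+ i)) ?size_poly //.
rewrite big_mkcond /=; apply: eq_bigr => i _.
have Ei : (Rep p)`_i = complex.Re p`_i by rewrite coef_map_id0.
rewrite -rmorphXn /= Ei; case: ifP => [_|/negbT].
  by case: (p`_i) => a b /=; rewrite mulr0 subr0.
rewrite -leqNgt => /(nth_default 0) E; move: Ei; rewrite E.
by case: (p`_i) => a b /= <-; rewrite mul0r mulr0 subr0.
Qed.

Lemma horner_Imp p s : (Imp p).[s] = complex.Im p.[s%:C].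
Proof.
rewrite horner_coef (horner_coef_wide _ (_ : size p <= size p)%N) //.
rewrite raddf_sum /= (big_ord_widen_cond (size p) xpredT (fun i => (Imp p)`_i * s ^+ i)) ?size_poly //.
rewrite big_mkcond /=; apply: eq_bigr => i _.
have Ei : (Imp p)`_i = complex.Im p`_i by rewrite coef_map_id0.
rewrite -rmorphXn /= Ei; case: ifP => [_|/negbT].
  by case: (p`_i) => a b /=; rewrite mulr0 add0r.
rewrite -leqNgt => /(nth_default 0) E; move: Ei; rewrite E.
by case: (p`_i) => a b /= <-; rewrite mulr0 mul0r addr0.
Qed.

Lemma coef_sqr (A : comNzRingType) (p : {poly A}) :
  [/\ (p * p)`_0 = p`_0 ^+ 2, (p * p)`_1 = p`_0 * p`_1 *+ 2
    & (p * p)`_2 = p`_1 ^+ 2 + p`_0 * p`_2 *+ 2].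
Proof.
by rewrite !coefM !big_ord_recr !big_ord0 /= !add0r !subn0 ?subSS ?subn0; split; ring.
Qed.

Definition lin_msq (I : finType) (c : I -> R) (p : I -> {poly C}) (t : C) : R :=
  \sum_i c i * modulus (p i).[t] ^+ 2.

(** On the real line in direction [w] the combination is a real polynomial; up to a factor 2 in the
    first, the two sums are its coefficients of degree 1 and 2. *)
Lemma jet_direction (I : finType) (c : I -> R) (p : I -> {poly C}) (d : R) (w : C) :
  0 < d -> modulus w = 1 ->
  (forall t : C, modulus t < d -> 0 <= lin_msq c p t) -> lin_msq c p 0 = 0 ->
  \sum_i c i * complex.Re (conjc (p i)`_0 * ((p i)`_1 * w)) = 0 /\
  0 <= \sum_i c i * (modulus (p i)`_1 ^+ 2 + complex.Re (conjc (p i)`_0 * ((p i)`_2 * w ^+ 2)) *+ 2).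
Proof.
move=> d0 w1 Hc H0.
pose q i := \poly_(j < size (p i)) ((p i)`_j * w ^+ j).
have coefq i j : (q i)`_j = (p i)`_j * w ^+ j.
  by rewrite coef_poly; case: ltnP => // /(nth_default 0) ->; rewrite mul0r.
pose h : {poly R} := \sum_i (c i)%:P * (Rep (q i) * Rep (q i) + Imp (q i) * Imp (q i)).
have hE s : h.[s] = lin_msq c p (w * s%:C).
  rewrite /h horner_sum; apply: eq_bigr => i _.
  rewrite hornerM hornerC; congr (_ * _).
  by rewrite hornerD !hornerM horner_Rep horner_Imp -!expr2 modulus_sqr horner_poly horner_coef;
  under [in RHS]eq_bigr do rewrite exprMn mulrA.
have Rj i j : (Rep (q i))`_j = complex.Re ((p i)`_j * w ^+ j).
  by rewrite coef_map_id0 // coefq.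
have Ij i j : (Imp (q i))`_j = complex.Im ((p i)`_j * w ^+ j).
  by rewrite coef_map_id0 // coefq.
have [||h1 h2] := @poly_min2 h d d0.
- move=> s sd; rewrite hE; apply: Hc; rewrite modulusM w1 mul1r.
  by rewrite modulus_real.
- by rewrite -horner_coef0 hE mulr0 H0.
have hj j : h`_j = \sum_i c i * ((Rep (q i) * Rep (q i))`_j + (Imp (q i) * Imp (q i))`_j).
  by rewrite /h coef_sum; apply: eq_bigr => i _; rewrite coefCM coefD.
have ReM (x y : C) : complex.Re (conjc x * y) = complex.Re x * complex.Re y + complex.Im x * complex.Im y.
  by case: x y => a b [a' b'] /=; rewrite mulNr opprK.
split.
  move/eqP: h1; rewrite hj.
  rewrite (_ : \sum_i _ = (\sum_i c i * complex.Re (conjc (p i)`_0 * ((p i)`_1 * w))) *+ 2).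
    by rewrite mulrn_eq0 /= => /eqP.
  rewrite -sumrMnl; apply: eq_bigr => i _.
  have [_ -> _] := coef_sqr (Rep (q i)); have [_ -> _] := coef_sqr (Imp (q i)).
  by rewrite !Rj !Ij !expr0 !expr1 !mulr1 ReM; ring.
suff <- : h`_2 = \sum_i c i * (modulus (p i)`_1 ^+ 2 + complex.Re (conjc (p i)`_0 * ((p i)`_2 * w ^+ 2)) *+ 2) by [].
rewrite hj; apply: eq_bigr => i _; congr (_ * _).
have [_ _ ->] := coef_sqr (Rep (q i)); have [_ _ ->] := coef_sqr (Imp (q i)).
rewrite !Rj !Ij ReM !expr0 !expr1 !mulr1.
have -> : modulus (p i)`_1 ^+ 2 = modulus ((p i)`_1 * w) ^+ 2 by rewrite modulusM w1 mulr1.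
by rewrite modulus_sqr; ring.
Qed.

(** The directions [1] and ['i] give real and imaginary part of the first-order condition. In second
    order [w ^+ 2] is 1 and -1, so the sum of both inequalities loses the holomorphic terms and
    keeps the Laplacian. *)
Lemma jet_min (I : finType) (c : I -> R) (p : I -> {poly C}) (d : R) : 0 < d ->
  (forall t : C, modulus t < d -> 0 <= lin_msq c p t) -> lin_msq c p 0 = 0 ->
  \sum_i (c i)%:C * (conjc (p i)`_0 * (p i)`_1) = 0 /\
  0 <= \sum_i c i * modulus (p i)`_1 ^+ 2.
Proof.
move=> d0 Hc H0.
have m1 : modulus (1 : C) = 1 by rewrite /modulus /= expr1n expr0n /= addr0 sqrtr1.
have mi : modulus ('i : C) = 1 by rewrite /modulus /= expr1n expr0n /= add0r sqrtr1.
have [A1 A2] := jet_direction d0 m1 Hc H0.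
have [B1 B2] := jet_direction d0 mi Hc H0.
split.
  apply/eqP; rewrite eq_complex; apply/andP; split; apply/eqP; rewrite raddf_sum /=.
    rewrite -[RHS]A1; apply: eq_bigr => i _; rewrite mulr1.
    by case: (conjc _ * _) => a b /=; rewrite mul0r subr0.
  rewrite -[RHS]oppr0 -[X in _ = - X]B1 -sumrN; apply: eq_bigr => i _; rewrite [in RHS]mulrA.
  case: (conjc _ * _) => a b /=. rewrite mul0r addr0; ring.
rewrite -(pmulrn_lge0 _ (isT : (0 < 2)%N)) -sumrMnl.
suff <- : \sum_i c i * (modulus (p i)`_1 ^+ 2 + complex.Re (conjc (p i)`_0 * ((p i)`_2 * 1 ^+ 2)) *+ 2) +
   \sum_i c i * (modulus (p i)`_1 ^+ 2 + complex.Re (conjc (p i)`_0 * ((p i)`_2 * 'i ^+ 2)) *+ 2) =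
   \sum_i c i * modulus (p i)`_1 ^+ 2 *+ 2 by rewrite addr_ge0.
rewrite -big_split; apply: eq_bigr => i _ /=.
rewrite sqr_i expr1n mulrN1 mulr1 mulrN raddfN /=; ring.
Qed.

End Jets.

(** * Comparison of logarithmic Laplacians *)

Section MaxAlgebra.
Variable R : realType.
Local Notation C := (R[i]).

Lemma modulus_sqrE (z : C) : (modulus z ^+ 2)%:C = z * conjc z.
Proof.
by rewrite modulus_sqr; case: z => a b; apply/eqP; rewrite eq_complex /=; apply/andP; split; apply/eqP; ring.
Qed.

(** Conjugates are treated as independent variables, with suffix [c]. For [T = |a|^2 - |b|^2] the
    mixed derivative of [log T] is [- |W(a, b)|^2 / T^2], and [log |k|^2] contributes 0. [X] is the
    mixed derivative of [T^2 K]; the hypotheses equate [mu T^2 K] and [S^2] in value and first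
    derivatives. The factor [S ^+ 2] replaces a division. *)
Lemma log_laplacian_identity (F : comUnitRingType)
  (a0 a1 b0 b1 f0 f1 g0 g1 k0 k1 a0c a1c b0c b1c f0c f1c g0c g1c k0c k1c mu : F) :
  let T := a0 * a0c - b0 * b0c in let S := g0 * g0c - f0 * f0c in
  let t1 := a0c * a1 - b0c * b1 in let t1c := a0 * a1c - b0 * b1c in
  let s1 := g0c * g1 - f0c * f1 in let s1c := g0 * g1c - f0 * f1c in
  let t2 := a1 * a1c - b1 * b1c in let s2 := g1 * g1c - f1 * f1c in
  let K := k0 * k0c in
  let X := (2 * T * t2 + 2 * t1 * t1c) * K + 2 * T * (t1 * k1c * k0 + t1c * k1 * k0c) + T ^+ 2 * (k1 * k1c) in
  mu * (2 * T * t1 * K + T ^+ 2 * k1 * k0c) = 2 * S * s1 ->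
  mu * (2 * T * t1c * K + T ^+ 2 * k1c * k0) = 2 * S * s1c ->
  mu * T ^+ 2 * K = S ^+ 2 ->
  S ^+ 2 * (mu * X - (2 * S * s2 + 2 * s1 * s1c)) =
  2 * (S ^+ 2 * ((f1 * g0 - f0 * g1) * (f1c * g0c - f0c * g1c) 
         - mu * K * ((a1 * b0 - a0 * b1) * (a1c * b0c - a0c * b1c)))).
Proof.
move=> T S t1 t1c s1 s1c t2 s2 K X e1 e1c e2.
have -> : (f1 * g0 - f0 * g1) * (f1c * g0c - f0c * g1c) = s1 * s1c - S * s2.
  by rewrite /s1 /s1c /S /s2; ring.
have -> : (a1 * b0 - a0 * b1) * (a1c * b0c - a0c * b1c) = t1 * t1c - T * t2.
  by rewrite /t1 /t1c /T /t2; ring.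
have E : S ^+ 2 * (mu * X) - (2 * S * s1) * (2 * S * s1c) =
   - (2 * mu * K * S ^+ 2 * (t1 * t1c - T * t2)).
  by rewrite -e1 -e1c -e2 /X /K; ring.

transitivity (S ^+ 2 * (mu * X) - (2 * S * s1) * (2 * S * s1c) + 2 * S ^+ 2 * (s1 * s1c) - 2 * S ^+ 2 * S * s2).
  by ring.
by rewrite E; ring.
Qed.

(** The difference [mu T^2 |k|^2 - S^2] is nonnegative near 0 and vanishes at 0, so its mixed
    derivative there is nonnegative; the previous identity translates this into Wronskians. *)
Lemma max_wronskian (a b f g k : {poly C}) (mu d : R) : 0 < d ->
  let T t := modulus a.[t] ^+ 2 - modulus b.[t] ^+ 2 in
  let S t := modulus g.[t] ^+ 2 - modulus f.[t] ^+ 2 in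
  0 < S 0 ->
  S 0 ^+ 2 = mu * (T 0 ^+ 2 * modulus k.[0] ^+ 2) ->
  (forall t, modulus t < d -> S t ^+ 2 <= mu * (T t ^+ 2 * modulus k.[t] ^+ 2)) ->
  mu * modulus k.[0] ^+ 2 * modulus (wronskian a b).[0] ^+ 2 <= modulus (wronskian f g).[0] ^+ 2.
Proof.
move=> d0 T S S0 eq0 Hd.
(* Expanding [T ^+ 2] and [S ^+ 2] writes the difference as a real combination of six squared moduli
   of polynomials, as [jet_min] requires. *)
pose c (i : 'I_6) : R := [:: mu; - mu *+ 2; mu; - 1; 2; -1]`_i.
pose p (i : 'I_6) : {poly C} := [:: a * a * k; a * b * k; b * b * k; g * g; f * g; f * f]`_i.
have msqM (x y z : C) : modulus (x * y * z) ^+ 2 = modulus x ^+ 2 * modulus y ^+ 2 * modulus z ^+ 2.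
  by rewrite !modulusM !exprMn.
have msqM2 (x y : C) : modulus (x * y) ^+ 2 = modulus x ^+ 2 * modulus y ^+ 2.
  by rewrite !modulusM !exprMn.
have E t : lin_msq c p t = mu * (T t ^+ 2 * modulus k.[t] ^+ 2) - S t ^+ 2.
  rewrite /lin_msq !big_ord_recl big_ord0 /c /p /=.
  rewrite !hornerM !msqM !msqM2 /T /S; ring.
have [||A1 A2] := @jet_min R _ c p d d0.
- by move=> t td; rewrite E subr_ge0 Hd.
- by rewrite E eq0 subrr.
have c0E (r : {poly C}) : r`_0 = r.[0] by rewrite horner_coef0.
have c1E (r : {poly C}) : r`_1 = r^`().[0] by rewrite horner_coef0 coef_deriv mulr1n.
have {}A2 : 0 <= \sum_i (c i)%:C * ((p i)`_1 * conjc (p i)`_1).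
  rewrite -(rmorph0 (real_complex R)) (_ : \sum_i _ = (\sum_i c i * modulus (p i)`_1 ^+ 2)%:C) ?lecR //.
  by rewrite rmorph_sum; apply: eq_bigr => i _; rewrite rmorphM /= modulus_sqrE.
have SC : (S 0)%:C = g.[0] * conjc g.[0] - f.[0] * conjc f.[0].
  by rewrite /S rmorphB /= !modulus_sqrE.
have TC : (T 0)%:C = a.[0] * conjc a.[0] - b.[0] * conjc b.[0].
  by rewrite /T rmorphB /= !modulus_sqrE.
have {}eq0 : mu%:C * (T 0)%:C ^+ 2 * (k.[0] * conjc k.[0]) = (S 0)%:C ^+ 2.
  by rewrite -modulus_sqrE -!rmorphXn -!rmorphM /= -mulrA -eq0.
have cN1 : (- 1 : R)%:C = -1 :> C by rewrite rmorphN rmorph1.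
have c2 : (2 : R)%:C = 2 :> C by rewrite rmorph_nat.
have cm2 : (- mu *+ 2)%:C = - mu%:C *+ 2 :> C by rewrite rmorphMn rmorphN.
have [m Em cm] : exists2 m : C, m = mu%:C & conjc m = m.
  by exists mu%:C => //; rewrite /conjc /= oppr0.
rewrite -Em in cm2 eq0; have c2c : conjc (2 : C) = 2 by rewrite rmorph_nat.
have A1c := congr1 (@conjc R) A1; rewrite rmorph0 in A1c.
move: A1 A1c A2; rewrite !big_ord_recl !big_ord0 /c /p /= !c0E !c1E cN1 c2 cm2 -Em.
rewrite !derivM !(hornerM, hornerD) !(rmorphM, rmorphD, rmorphN, rmorphMn, rmorph1, rmorph0) /= !conjcK cm ?c2c.
move=> A1 A1c A2.
rewrite /wronskian !(hornerM, hornerD, hornerN).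
have := @log_laplacian_identity C a.[0] a^`().[0] b.[0] b^`().[0] f.[0] f^`().[0]
  g.[0] g^`().[0] k.[0] k^`().[0] (conjc a.[0]) (conjc a^`().[0]) (conjc b.[0])
  (conjc b^`().[0]) (conjc f.[0]) (conjc f^`().[0]) (conjc g.[0]) (conjc g^`().[0])
  (conjc k.[0]) (conjc k^`().[0]) m.
rewrite /= -!SC -!TC => LI.
set wS := f^`().[0] * g.[0] - f.[0] * g^`().[0].
set wT := a^`().[0] * b.[0] - a.[0] * b^`().[0].
have S0C : 0 < (S 0)%:C ^+ 2 by rewrite exprn_gt0 // ltcR.
have MM (x y : R) : (x * y)%:C = x%:C * y%:C :> C by exact: rmorphM.
rewrite -lecR. rewrite (MM (mu * _)) (MM mu) !modulus_sqrE -Em.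
rewrite -subr_ge0 -(pmulr_rge0 _ S0C) -(pmulr_rge0 _ (ltr0n C 2)).
rewrite [conjc wS]rmorphB [conjc wT]rmorphB !rmorphM /= -LI.
- apply: mulr_ge0; first exact: ltW.
  apply: le_trans A2 _; rewrite le_eqVlt; apply/orP; left; apply/eqP.
  by rewrite ?TC ?SC; ring.
- by apply/eqP; rewrite -subr_eq0 -[X in _ == X]A1; apply/eqP; rewrite ?TC ?SC; ring.
- by apply/eqP; rewrite -subr_eq0 -[X in _ == X]A1c; apply/eqP; rewrite ?TC ?SC; ring.
- by rewrite eq0.
Qed.

End MaxAlgebra.

(** * Continuity of forms, orbits and Jacobians *)

Section Continuity.
Variables (R : realType) (n : nat).
Local Notation C := (cplane R).
Implicit Types (T : topologicalType).

Lemma continuous_exprC T (h : T -> C) k : continuous h -> continuous (fun t => h t ^+ k : C).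
Proof.
move=> ch s; elim: k => [|k IH].
  by under eq_fun do rewrite expr0; exact: cvg_cst.
by under eq_fun do rewrite exprS; apply: cvgM; [exact: ch | exact: IH].
Qed.

Lemma continuous_hornerC T (p : {poly R[i]}) (f : T -> C) :
  continuous f -> continuous (fun t => p.[f t] : C).
Proof.
move=> cf t; under eq_fun do rewrite horner_coef.
apply: cvg_big => [|i _]; first exact: add_continuous.
by apply: cvgM; [exact: cvg_cst | apply: continuous_exprC].
Qed.

Lemma continuous_hom T (p : {poly R[i]}) (f g : T -> C) :
  continuous f -> continuous g -> continuous (fun t => hom n p (f t) (g t) : C).
Proof.
move=> cf cg t; rewrite /hom.
apply: cvg_big => [|i _]; first exact: add_continuous.
apply: cvgM; first exact: cvg_cst.
by apply: cvgM; apply: continuous_exprC.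
Qed.

Lemma continuous_jac T (p q : {poly R[i]}) (f g : T -> C) :
  continuous f -> continuous g -> continuous (fun t => jac n p q (f t) (g t) : C).
Proof.
move=> cf cg t; rewrite /jac.
apply: cvg_big => [|i _]; first exact: add_continuous.
apply: cvg_big => [|j _]; first exact: add_continuous.
apply: cvgM; first exact: cvg_cst.
apply: cvgM; first exact: cvg_cst.
by apply: cvgM; apply: continuous_exprC.
Qed.

Lemma continuous_orb T L (f g : T -> C) : continuous f -> continuous g ->
  continuous (fun t => (orb n L (f t, g t)).1 : C) /\
  continuous (fun t => (orb n L (f t, g t)).2 : C).
Proof.
elim: L f g => [|P L IH] f g cf cg; first by split; [exact: cf | exact: cg].
by apply: (IH (fun t => hom n P.1 (f t) (g t)) (fun t => hom n P.2 (f t) (g t)));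
  apply: continuous_hom.
Qed.

Lemma continuous_jacs T L (f g : T -> C) : continuous f -> continuous g ->
  continuous (fun t => jacs n L (f t, g t) : C).
Proof.
elim: L f g => [|P L IH] f g cf cg t /=; first exact: cvg_cst.
apply: cvgM; first exact: continuous_jac.
by apply: (IH (fun t => hom n P.1 (f t) (g t)) (fun t => hom n P.2 (f t) (g t)));
  apply: continuous_hom.
Qed.

Lemma continuous_msq T (f : T -> C) : continuous f ->
  continuous (fun t => modulus (f t) ^+ 2 : R).
Proof.
move=> cf t; under eq_fun do rewrite expr2.
have cm : modulus (f x) @[x --> t] --> modulus (f t).
  by apply: continuous_comp; [exact: cf | exact: modulus_continuous].
exact: cvgM.
Qed.

End Continuity.

(** * The Schwarz-Ahlfors inequality for homogeneous lifts *)

Section Ahlfors.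
Variables (R : realType) (n : nat) (L : seq ({poly R[i]} * {poly R[i]})).
Local Notation C := (cplane R).
Variables (w0 w1 : C) (del eps : R).
Hypotheses (del0 : 0 < del) (eps0 : 0 < eps).

(** In the affine chart, a positive multiple of [del^2 - |z - w0|^2] at the image point. Up to
    constants, [del / gapS] and [eps / gapT] are the hyperbolic densities of the disc about [w0] and
    of the exterior of the disc about [w1]. *)
Definition gapS (X : C * C) : R :=
  del ^+ 2 * modulus (orb n L X).2 ^+ 2 - modulus ((orb n L X).1 - w0 * (orb n L X).2) ^+ 2.
Definition gapT (X : C * C) : R :=
  modulus (X.1 - w1 * X.2) ^+ 2 - eps ^+ 2 * modulus X.2 ^+ 2.
Definition msqJ (X : C * C) : R := modulus (jacs n L X) ^+ 2.

(** Up to a constant, the squared quotient of the density of the exterior by the pulled-back density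
    of the disc. It is homogeneous of degree 0, so its maximum may be sought on the unit sphere. *)
Let ratio X := gapS X ^+ 2 / (gapT X ^+ 2 * msqJ X).

Lemma gapS_scale c X : gapS (scale c X) = modulus (c ^+ (n ^ size L)) ^+ 2 * gapS X.
Proof.
rewrite /gapS orb_scale /scale /=; set d := c ^+ _.
have -> : d * (orb n L X).1 - w0 * (d * (orb n L X).2) = d * ((orb n L X).1 - w0 * (orb n L X).2).
  by ring.
by rewrite !modulusM !exprMn; ring.
Qed.

Lemma gapT_scale c X : gapT (scale c X) = modulus c ^+ 2 * gapT X.
Proof.
rewrite /gapT /scale /=.
have -> : c * X.1 - w1 * (c * X.2) = c * (X.1 - w1 * X.2) by ring.
by rewrite !modulusM !exprMn; ring.
Qed.

Lemma msqJ_scale c X :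
  modulus c ^+ 4 * msqJ (scale c X) = modulus (c ^+ (n ^ size L)) ^+ 4 * msqJ X.
Proof.
have := congr1 (fun z => modulus z ^+ 2) (jacs_scale n L c X).
rewrite /msqJ (modulusM (c ^+ 2)) (modulusM (_ ^+ 2)) !exprMn.
have mX (z : C) : modulus (z ^+ 2) ^+ 2 = modulus z ^+ 4.
  by rewrite expr2 modulusM; ring.
by rewrite !mX.
Qed.

Lemma ratio_scale c X : c != 0 -> gapT X != 0 -> msqJ X != 0 ->
  ratio (scale c X) = ratio X.
Proof.
move=> c0 T0 J0; rewrite /ratio gapS_scale gapT_scale.
have mc : modulus c != 0 by rewrite modulus_eq0.
have mcn : modulus (c ^+ (n ^ size L)) != 0 by rewrite modulus_eq0 expf_neq0.
have J1 : modulus c ^+ 4 * msqJ (scale c X) != 0.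
  by rewrite msqJ_scale mulf_neq0 // expf_neq0.
rewrite (_ : (modulus c ^+ 2 * gapT X) ^+ 2 * msqJ (scale c X) =
   gapT X ^+ 2 * (modulus c ^+ 4 * msqJ (scale c X))); last by ring.
rewrite msqJ_scale; field.
by rewrite T0 J0 mcn.
Qed.

(** This keeps the denominator of [ratio] positive: the preimage of the closed disc about [w0]
    contains no critical point and avoids the closed disc about [w1]. *)
Hypothesis sep : forall X : C * C, X != (0, 0) -> 0 <= gapS X -> 0 < gapT X /\ jacs n L X != 0.

Let sphere := [set X : C * C | modulus X.1 ^+ 2 + modulus X.2 ^+ 2 = 1 /\ 0 <= gapS X].

Let cfst : continuous (fst : C * C -> C).
Proof. by move=> X; exact: cvg_fst. Qed.
Let csnd : continuous (snd : C * C -> C).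
Proof. by move=> X; exact: cvg_snd. Qed.

Let pairE (X : C * C) : (X.1, X.2) = X. Proof. by case: X. Qed.

Lemma continuous_gapS : continuous gapS.
Proof.
have [c1 c2] := @continuous_orb _ n _ L _ _ cfst csnd.
have {}c1 : continuous (fun X : C * C => (orb n L X).1 : C).
  by move: c1; under eq_fun do rewrite pairE.
have {}c2 : continuous (fun X : C * C => (orb n L X).2 : C).
  by move: c2; under eq_fun do rewrite pairE.
move=> X; apply: cvgB; first by apply: cvgM; [exact: cvg_cst | exact: continuous_msq].
apply: (@continuous_msq _ _ (fun X : C * C => (orb n L X).1 - w0 * (orb n L X).2)).
by move=> Y; apply: cvgB; [exact: c1 | apply: cvgM; [exact: cvg_cst | exact: c2]].
Qed.

Lemma continuous_gapT : continuous gapT.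
Proof.
move=> X; apply: cvgB; last by apply: cvgM; [exact: cvg_cst | exact: continuous_msq].
apply: (@continuous_msq _ _ (fun X : C * C => X.1 - w1 * X.2)).
by move=> Y; apply: cvgB; [exact: cfst | apply: cvgM; [exact: cvg_cst | exact: csnd]].
Qed.

Lemma continuous_msqJ : continuous msqJ.
Proof.
apply: continuous_msq.
have := @continuous_jacs _ n _ L _ _ cfst csnd.
by under eq_fun do rewrite pairE.
Qed.

Let sphere_neq0 X : sphere X -> X != (0, 0).
Proof.
move=> [N _]; apply/eqP => E; move: N.
have -> : modulus X.1 = 0 by rewrite E; exact: modulus0.
have -> : modulus X.2 = 0 by rewrite E; exact: modulus0.
by rewrite expr0n addr0 => /eqP; rewrite eq_sym oner_eq0.
Qed.

Let compact_sphere : compact sphere.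
Proof.
pose B := [set z : C | modulus z <= 1].
have cB : compact B.
  apply: (@bounded_closed_compactC _ _ 1) => //.
  rewrite (_ : B = @modulus R @^-1` [set x | x <= 1]) //.
  apply: (@preimage_closed C R (@modulus R) [set x | x <= 1]); last exact: closed_le.
  by move=> z _; exact: modulus_continuous.
have sub : sphere `<=` B `*` B.
  move=> X [N _]; split; rewrite /B /= -(@ler_pXn2r _ 2) ?nnegrE ?modulus_ge0 // expr1n -N.
    by rewrite lerDl sqr_ge0.
  by rewrite lerDr sqr_ge0.
apply: subclosed_compact (compact_setX cB cB) sub.
have -> : sphere = (fun X : C * C => modulus X.1 ^+ 2 + modulus X.2 ^+ 2) @^-1` [set x | x = 1]
   `&` gapS @^-1` [set x | 0 <= x] by [].
apply: closedI.
  apply: (@preimage_closed (C * C)%type R _ [set x | x = 1]); last exact: closed_eq.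
  have c1 := continuous_msq cfst; have c2 := continuous_msq csnd.
  move=> X _; apply: cvgD; [exact: c1 | exact: c2].
apply: (@preimage_closed (C * C)%type R _ [set x | 0 <= x]); last exact: closed_ge.
by move=> X _; apply: continuous_gapS.
Qed.

Let msqJ_gt0 (X : C * C) : X != (0, 0) -> 0 <= gapS X -> 0 < msqJ X.
Proof.
move=> X0 S0; have [_ J0] := sep X0 S0.
by rewrite /msqJ exprn_gt0 // ltr_modulus_gt0.
Qed.

Let continuous_ratio : {within sphere, continuous ratio}.
Proof.
apply: continuous_in_subspaceT => X; rewrite inE => SX.
have [T0 J0] := sep (sphere_neq0 SX) SX.2.
have mJ := msqJ_gt0 (sphere_neq0 SX) SX.2.
rewrite /ratio; apply: cvgM.
  under eq_fun do rewrite expr2.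
  by apply: cvgM; apply: continuous_gapS.
apply: cvgV; first by apply: mulf_neq0; [apply: expf_neq0 |]; exact: lt0r_neq0.
apply: cvgM; last exact: continuous_msqJ.
under eq_fun do rewrite expr2.
by apply: cvgM; apply: continuous_gapT.
Qed.

Let to_sphere (X : C * C) : X != (0, 0) -> 0 <= gapS X -> exists2 Y, sphere Y & ratio Y = ratio X.
Proof.
move=> X0 SX; have [T0 J0] := sep X0 SX; have mJ := msqJ_gt0 X0 SX.
pose N := modulus X.1 ^+ 2 + modulus X.2 ^+ 2.
have N0 : 0 < N.
  rewrite lt_def addr_ge0 ?sqr_ge0 // andbT paddr_eq0 ?sqr_ge0 // !sqrf_eq0 !modulus_eq0.
  by apply: contraNN X0; case: (X) => a b /= /andP[/eqP -> /eqP ->].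
pose c : C := (Num.sqrt N)^-1%:C.
have c0 : c != 0.
  by rewrite -modulus_eq0 modulus_real normr_eq0 invr_eq0 gt_eqF // sqrtr_gt0.
exists (scale c X); last by apply: ratio_scale => //; exact: lt0r_neq0.
split; last by rewrite gapS_scale mulr_ge0 ?sqr_ge0.
rewrite /scale /= !modulusM !exprMn -mulrDr modulus_real real_normK ?num_real // exprVn.
by rewrite sqr_sqrtr ?ltW // mulVf ?lt0r_neq0.
Qed.

Let ratio_sqr (X : C * C) : X != (0, 0) -> 0 <= gapS X ->
  gapS X ^+ 2 = ratio X * (gapT X ^+ 2 * msqJ X).
Proof.
move=> X0 SX; have [T0 J0] := sep X0 SX; have mJ := msqJ_gt0 X0 SX.
rewrite /ratio divfK //.
by apply: mulf_neq0; [apply: expf_neq0 |]; exact: lt0r_neq0.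
Qed.

(* Restricting to the complex line through a maximum point [X] in the direction
   orthogonal to [X] reduces the bound to [max_wronskian]. *)
Let ratio_max X : sphere X -> (forall Y, sphere Y -> ratio Y <= ratio X) ->
  ratio X <= del ^+ 2 / eps ^+ 2.
Proof.
move=> SX maxX; have X0 := sphere_neq0 SX.
have [T0 J0] := sep X0 SX.2.
have mJ := msqJ_gt0 X0 SX.2.
have [S0|S0] := eqVneq (gapS X) 0.
  by rewrite /ratio S0 expr0n mul0r divr_ge0 ?sqr_ge0.
have {}S0 : 0 < gapS X by rewrite lt_def S0 SX.2.
pose x : R[i] := X.1; pose y : R[i] := X.2.
pose xi : {poly R[i]} * {poly R[i]} := (x%:P - (conjc y)%:P * 'X, y%:P + (conjc x)%:P * 'X).
pose L' := map (map_ppair (@polyC R[i])) L.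
pose al := (orb n L' xi).1; pose be := (orb n L' xi).2.
pose k := jacs n L' xi.
have ev t : map_pair (horner_eval t) xi = (xi.1.[t], xi.2.[t]) by [].
have L'E t : map (map_ppair (horner_eval t)) L' = L.
  rewrite /L' -map_comp -[RHS]map_id; apply: eq_map => -[p q] /=.
  have E (r : {poly R[i]}) : map_poly (horner_eval t) (map_poly polyC r) = r.
    by rewrite -map_poly_comp; apply: map_poly_id => c _ /=; rewrite /horner_eval hornerC.
  by rewrite /map_ppair /= !E.
have orbE t : orb n L (xi.1.[t], xi.2.[t]) = (al.[t], be.[t]).
  by rewrite -ev -{1}(L'E t) -orb_map.
have jacsE t : jacs n L (xi.1.[t], xi.2.[t]) = k.[t].
  by rewrite -ev -{1}(L'E t) -jacs_map.
have N1 : x * conjc x + y * conjc y = 1.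
  rewrite -!modulus_sqrE -rmorphD.
  by have [-> _] := SX.
have xi0 : (xi.1.[0], xi.2.[0]) = X.
  by rewrite /xi /= !hornerE ?mulr0 ?subr0 ?addr0 /x /y pairE.
have xi_neq0 t : (xi.1.[t], xi.2.[t]) != (0, 0).
  apply/eqP => -[]; rewrite !hornerE => e1 e2.
  have : (x - conjc y * t) * conjc x + (y + conjc x * t) * conjc y = 1 by rewrite -N1; ring.
  by rewrite e1 e2 !mul0r addr0 => /eqP; rewrite eq_sym oner_eq0.
have SE t : gapS (xi.1.[t], xi.2.[t]) =
    modulus (del%:C%:P * be).[t] ^+ 2 - modulus (al - (w0 : R[i])%:P * be).[t] ^+ 2.
  rewrite /gapS orbE /= hornerD hornerN !hornerM !hornerC.
  by rewrite (modulusM _%:C) modulus_real ger0_norm ?ltW // exprMn.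
have TE t : gapT (xi.1.[t], xi.2.[t]) =
    modulus (xi.1 - (w1 : R[i])%:P * xi.2).[t] ^+ 2 - modulus (eps%:C%:P * xi.2).[t] ^+ 2.
  rewrite /gapT; move: (xi.1) (xi.2) => a b /=.
  rewrite hornerD hornerN !hornerM !hornerC.
  by rewrite (modulusM _%:C) modulus_real ger0_norm ?ltW // exprMn.
have kE : modulus k.[0] ^+ 2 = msqJ X by rewrite -jacsE xi0.
have wxi : wronskian xi.1 xi.2 = - 1.
  rewrite /wronskian /xi /= !(derivD, derivN, derivM, derivC, derivX).
  transitivity (- (x * conjc x + y * conjc y)%:P : {poly R[i]}); last by rewrite N1.
  by rewrite polyCD !polyCM; ring.
have wab : wronskian (xi.1 - (w1 : R[i])%:P * xi.2) (eps%:C%:P * xi.2) = - eps%:C%:P.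
  rewrite -[RHS]mulrN1 -[X in _ = _ * X]wxi.
  by rewrite /wronskian !(derivD, derivN, derivM, derivC); ring.
have wfg : wronskian (al - (w0 : R[i])%:P * be) (del%:C%:P * be) = - (del%:C%:P * k).
  transitivity (del%:C%:P * wronskian al be).
    by rewrite /wronskian !(derivD, derivN, derivM, derivC); ring.
  by rewrite [wronskian _ _]wronskian_orb wxi mulrN1 mulrN.
have cS : continuous (fun t : C => gapS (xi.1.[t], xi.2.[t])).
  move=> t; apply: (@continuous_comp _ _ _ (fun t : C => ((xi.1.[t], xi.2.[t]) : C * C)) gapS).
    have cid : continuous (id : C -> C) by move=> s; exact: cvg_id.
    have c1 := @continuous_hornerC R C xi.1 _ cid; have c2 := @continuous_hornerC R C xi.2 _ cid.
    exact: (cvg_pair (c1 t) (c2 t)).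
  exact: continuous_gapS.
have /continuousP_eps /(_ _ S0)[d d0 Hd] := cS 0.
have S0' : 0 < gapS (xi.1.[0], xi.2.[0]) by rewrite xi0.
have Sd t : modulus t < d -> 0 < gapS (xi.1.[t], xi.2.[t]).
  move=> td; have := Hd t; rewrite subr0 xi0 => /(_ td).
  by rewrite ltr_norml => /andP[]; rewrite ltrBrDr addNr.
have W : ratio X * modulus k.[0] ^+ 2 *
    modulus (wronskian (xi.1 - (w1 : R[i])%:P * xi.2) (eps%:C%:P * xi.2)).[0] ^+ 2 <=
    modulus (wronskian (al - (w0 : R[i])%:P * be) (del%:C%:P * be)).[0] ^+ 2.
  apply: (@max_wronskian R _ _ _ _ _ _ d d0).
  - by rewrite -SE.
  - by rewrite -SE -TE kE xi0; exact: ratio_sqr SX.2.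
  move=> t td; rewrite -SE -TE -jacsE -/(msqJ (xi.1.[t], xi.2.[t])).
  rewrite (ratio_sqr (xi_neq0 t) (ltW (Sd t td))).
  have [Z SZ <-] := to_sphere (xi_neq0 t) (ltW (Sd t td)).
  by rewrite ler_wpM2r ?maxX // mulr_ge0 ?sqr_ge0.
(* The two Wronskians have moduli [eps] and [del * |k(0)|]; the positive number [|k(0)|^2 = msqJ X]
   cancels. *)
move: W; rewrite kE wab wfg.
rewrite !hornerN hornerM !modulusN !hornerC (modulusM del%:C) !modulus_real.
rewrite (ger0_norm (ltW del0)) (ger0_norm (ltW eps0)) exprMn kE.
rewrite mulrAC ler_pM2r // -ler_pdivlMr //.
by rewrite exprn_gt0.
Qed.

(** In the absence of critical points the pulled-back metric has the curvature of the exterior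
    metric and blows up at the edge of the preimage, where [ratio] is 0. The bound at a maximum
    passes to every [X] by homogeneity. *)
Lemma ahlfors (X : C * C) : X != (0, 0) -> 0 <= gapS X ->
  eps * gapS X <= del * gapT X * modulus (jacs n L X).
Proof.
move=> X0 SX; have [T0 J0] := sep X0 SX; have mJ := msqJ_gt0 X0 SX.
have [Y SY RY] := to_sphere X0 SX.
have [|Z SZ maxZ] := compact_EVT_max _ compact_sphere continuous_ratio.
  by exists Y.
have RX : ratio X <= del ^+ 2 / eps ^+ 2.
  rewrite -RY; have SZ' : sphere Z by rewrite inE in SZ.
  apply: (le_trans (maxZ Y _)); first by rewrite inE.
  by apply: ratio_max => // W SW; apply: maxZ; rewrite inE.
have eS0 : 0 <= eps * gapS X by rewrite mulr_ge0 // ltW.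
have dT0 : 0 <= del * gapT X * modulus (jacs n L X).
  by rewrite mulr_ge0 ?modulus_ge0 // mulr_ge0 // ltW.
rewrite -(@ler_pXn2r _ 2) ?nnegrE //.
rewrite !exprMn ratio_sqr // -/(msqJ X) [eps ^+ 2 * _]mulrA -[del ^+ 2 * _ * _]mulrA.
apply: ler_wpM2r; first by rewrite mulr_ge0 ?sqr_ge0 // ltW.
by rewrite mulrC -ler_pdivlMr ?exprn_gt0.
Qed.

End Ahlfors.

(** * Local dynamics at a fixed point *)

Section Local.
Variable R : realType.
Local Notation C := (R[i]).
Implicit Types (A B G H : {poly C}) (z : C).

Lemma rat_cont G B z0 (e : R) : B.[z0] != 0 -> 0 < e ->
  exists2 d : R, 0 < d & forall z, modulus (z - z0) <= d ->
    B.[z] != 0 /\ modulus (G.[z] / B.[z] - G.[z0] / B.[z0]) <= e.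
Proof.
move=> B0 e0.
have gen (T : topologicalType) (f : T -> cplane R) (t : T) : continuous f -> B.[f t] != 0 ->
    ((fun s => G.[f s] / B.[f s]) : T -> cplane R) @ t --> (G.[f t] / B.[f t] : cplane R).
  move=> cf Bt; apply: cvgM; first exact: (continuous_hornerC cf).
  by apply: cvgV => //; exact: (continuous_hornerC cf).
have cid : continuous (id : cplane R -> cplane R) by move=> s; exact: cvg_id.
have c1 := gen _ _ (z0 : cplane R) cid B0.
have c2 := @continuous_hornerC R (cplane R) B _ cid z0.
have /nbhsP[d1 d10 H1] : nbhs (z0 : cplane R) (fun z : cplane R => modulus (G.[z] / B.[z] - G.[z0] / B.[z0]) < e).
  by apply: (c1 (fun y => modulus (y - G.[z0] / B.[z0]) < e)); apply/nbhsP; exists e.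
have /nbhsP[d2 d20 H2] : nbhs (z0 : cplane R) (fun z : cplane R => modulus (B.[z] - B.[z0]) < modulus B.[z0]).
  apply: (c2 (fun y => modulus (y - B.[z0]) < modulus B.[z0])); apply/nbhsP.
  by exists (modulus B.[z0]); rewrite // ltr_modulus_gt0.
exists (Num.min d1 d2 / 2); first by rewrite divr_gt0 // lt_min d10.
move=> z /le_lt_trans zd.
have : modulus (z - z0) < Num.min d1 d2.
  by apply: zd; rewrite ltr_pdivrMr // mulrDr mulr1 ltrDl lt_min d10.
rewrite lt_min => /andP[/H1/ltW zd1 /H2 zd2]; split=> //.
by apply: contraTneq zd2 => ->; rewrite sub0r modulusN ltxx.
Qed.

Definition ratf A B z := A.[z] / B.[z].
Definition ratf' A B z := (A^`() * B - A * B^`()).[z] / B.[z] ^+ 2.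

(** The first clause keeps the orbit away from poles, where the division would return 0. *)
Definition attracted A B z0 z :=
  (forall m, B.[iter m (ratf A B) z] != 0) /\
  forall e : R, 0 < e -> exists M, forall m, (M <= m)%N ->
    modulus (iter m (ratf A B) z - z0) < e.

(** Common interface of the attracting and the parabolic case: relative to the radius of a disc
    lying in the basin, some iterate contracts by an arbitrarily large factor. [ahlfors] forbids
    this when the basin contains no critical point. *)
Definition expanding_discs A B z0 := exists (x : C) (del : nat -> R),
  [/\ forall m, 0 < del m,
      forall m z, modulus (z - iter m (ratf A B) x) <= del m -> attracted A B z0 z
    & forall e : R, 0 < e -> exists m,
       \prod_(j < m) modulus (ratf' A B (iter j (ratf A B) x)) <= e * del m].

Lemma expr_lt_small (q e : R) : 0 <= q -> q < 1 -> 0 < e -> exists M, forall m, (M <= m)%N -> q ^+ m < e.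
Proof.
move=> q0 q1 e0.
have : q ^+ n @[n --> \oo] --> 0 by apply: cvg_expr; rewrite ger0_norm.
move=> /cvgrPdist_lt /(_ _ e0)[M _ HM]; exists M => m Mm.
by have := HM m Mm; rewrite /= sub0r normrN ger0_norm // exprn_ge0.
Qed.

(** Dividing [A - f0 B] by ['X - z0] reduces differentiability to the continuity of a rational
    quotient. *)
Lemma ratf_derivative A B z0 (e : R) : B.[z0] != 0 -> 0 < e ->
  exists2 d : R, 0 < d & forall z, modulus (z - z0) <= d -> B.[z] != 0 /\
    modulus (ratf A B z - ratf A B z0 - ratf' A B z0 * (z - z0)) <= e * modulus (z - z0).
Proof.
move=> B0 e0; set f0 := ratf A B z0.
have [G EG] : exists G, A - f0%:P * B = G * ('X - z0%:P).
  have /factor_theorem : root (A - f0%:P * B) z0.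
    by rewrite /root !hornerE /f0 /ratf divfK // subrr.
  by case=> G ->; exists G.
have fE z : B.[z] != 0 -> ratf A B z - f0 = (z - z0) * (G.[z] / B.[z]).
  move=> Bz; rewrite mulrA -[(z - z0) * _]mulrC.
  have := congr1 (horner^~ z) EG; rewrite !hornerE => <-.
  by rewrite /ratf mulrBl mulfK.
have f'E : ratf' A B z0 = G.[z0] / B.[z0].
  have EA : A = G * ('X - z0%:P) + f0%:P * B by rewrite -EG subrK.
  rewrite /ratf' {1 2}EA !(derivD, derivM, derivN, derivB, derivX, derivC).
  rewrite !(hornerD, hornerN, hornerM, hornerX, hornerC, horner0) subrr.
  by field.
have [d d0 Hd] := rat_cont G B0 e0; exists d => // z zd.
have [Bz Gz] := Hd z zd; split=> //.
rewrite fE // f'E [G.[z0] / _ * _]mulrC -mulrBr modulusM mulrC.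
by rewrite ler_wpM2r ?modulus_ge0.
Qed.

(** The constant orbit of [z0] with one fixed radius suffices, since the product of derivatives is a
    power of the multiplier. The rate [q] is the midpoint between its modulus and 1. *)
Lemma attracting_discs A B z0 : B.[z0] != 0 -> ratf A B z0 = z0 ->
  modulus (ratf' A B z0) < 1 -> expanding_discs A B z0.
Proof.
move=> B0 fz0 lam1.
pose lam := modulus (ratf' A B z0); pose q := (1 + lam) / 2.
have lam0 : 0 <= lam by exact: modulus_ge0.
have q1 : q < 1 by rewrite /q ltr_pdivrMr // mul1r; move: lam1; rewrite -/lam; lra.
have q0 : 0 <= q by rewrite /q divr_ge0 // addr_ge0.
have lq : 0 < q - lam by rewrite /q; move: lam1; rewrite -/lam; lra.
have [d d0 Hd] := ratf_derivative A B0 lq.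
have step z : modulus (z - z0) <= d -> B.[z] != 0 /\ modulus (ratf A B z - z0) <= q * modulus (z - z0).
  move=> zd; have [Bz Gz] := Hd z zd; split=> //; rewrite fz0 in Gz.
  rewrite -[_ - z0](subrK (ratf' A B z0 * (z - z0))); apply: le_trans (modulusD _ _) _.
  by rewrite modulusM -/lam -lerBrDr -mulrBl.
have iterE z : modulus (z - z0) <= d -> forall m,
    B.[iter m (ratf A B) z] != 0 /\ modulus (iter m (ratf A B) z - z0) <= q ^+ m * d.
  move=> zd; elim=> [|m [Bm IH]] /=; first by rewrite expr0 mul1r; split=> //; case: (step z zd).
  have md : modulus (iter m (ratf A B) z - z0) <= d.
    by apply: le_trans IH _; rewrite ger_pMl // exprn_ile1 // ltW.
  have [_ S1] := step _ md.
  have S2 : modulus (ratf A B (iter m (ratf A B) z) - z0) <= q ^+ m.+1 * d.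
    by apply: le_trans S1 _; rewrite exprS -mulrA ler_wpM2l.
  split=> //; apply: (step _ _).1; apply: le_trans S2 _.
  by rewrite ger_pMl // exprn_ile1 // ltW.
have iz0 m : iter m (ratf A B) z0 = z0 by elim: m => //= m ->.
exists z0, (fun=> d); split=> // [m z|e e0].
  rewrite iz0 => zd; split=> [j|e e0]; first by case: (iterE z zd j).
  have [M HM] := expr_lt_small q0 q1 (divr_gt0 e0 d0).
  exists M => j /HM; rewrite ltr_pdivlMr //; apply: le_lt_trans.
  by case: (iterE z zd j).
have [M HM] := expr_lt_small lam0 lam1 (mulr_gt0 e0 d0).
exists M; apply/ltW; apply: le_lt_trans (HM M (leqnn M)).
rewrite (eq_bigr (fun=> lam)); last by move=> j _; rewrite iz0.
by rewrite prodr_const card_ord.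
Qed.

Lemma ler_Re (z : C) : complex.Re z <= modulus z.
Proof. exact: le_trans (ler_norm _) (ler_Re_modulus z). Qed.

Lemma ler_Re_near (a c : C) (r e : R) :
  modulus (a - c - r%:C) <= e -> complex.Re c + r - e <= complex.Re a.
Proof.
move=> H; have := le_trans (ler_Re_modulus _) H; rewrite ler_norml => /andP[+ _].
by case: a c {H} => a1 a2 [c1 c2] /=; lra.
Qed.

Lemma modulusV (z : C) : modulus z^-1 = (modulus z)^-1.
Proof. by apply: complexI; rewrite fmorphV /= -!normE normfV. Qed.

Lemma modulusX (z : C) m : modulus (z ^+ m) = modulus z ^+ m.
Proof. by apply: complexI; rewrite rmorphXn /= -!normE normrX. Qed.

Lemma modulus_nat m : modulus (m%:R : C) = m%:R.
Proof. by apply: complexI; rewrite rmorph_nat -normE normr_nat. Qed.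

Lemma modulus_ge_sub (z w : C) : modulus z - modulus w <= modulus (z - w).
Proof. by rewrite lerBlDr -{1}(subrK w z) modulusD. Qed.

(** The polynomial [p] has a double zero at 0; after one division the quotient [g] still vanishes
    there, which yields the factor [tau]. *)
Lemma inv_expr_expansion q (tau : R) : (0 < q)%N -> 0 < tau -> exists2 w0 : R, 0 < w0 &
  forall w, modulus w <= w0 -> 1 - w != 0 /\
    modulus (((1 - w) ^+ q)^-1 - 1 - q%:R * w) <= tau * modulus w.
Proof.
move=> q0 tau0; pose D : {poly C} := (1%:P - 'X) ^+ q.
have DE w : D.[w] = (1 - w) ^+ q by rewrite /D horner_exp !hornerE.
have D0 : D.[0] = 1 by rewrite DE subr0 expr1n.
have D'0 : D^`().[0] = - q%:R.
  rewrite /D deriv_exp derivB derivX derivC sub0r hornerMn mulN1r hornerN.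
  by rewrite horner_exp !hornerE subr0 expr1n mulNrn.
pose p : {poly C} := 1%:P - (1%:P + q%:R%:P * 'X) * D.
have p0 : p.[0] = 0 by rewrite /p !(hornerD, hornerN, hornerM, hornerC, hornerX) D0 mulr0 addr0 mulr1 subrr.
have [g Eg] : exists g, p = g * 'X.
  have /factor_theorem[g ->] : root p 0 by rewrite /root p0.
  by exists g; rewrite polyC0 subr0.
have g0 : g.[0] = 0.
  have : p^`().[0] = g.[0] by rewrite Eg derivM derivX !hornerE ?mulr0 ?add0r.
  rewrite /p !(derivD, derivN, derivM, derivC, derivX).
  by rewrite !(hornerD, hornerN, hornerM, hornerC, hornerX) D0 D'0; move=> <-; ring.
have D00 : D.[0] != 0 by rewrite D0 oner_eq0.
have [d d0 Hd] := rat_cont g D00 tau0.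
exists d => // w wd; have := Hd w; rewrite subr0 => /(_ wd)[]; rewrite DE => Dw.
have w1 : 1 - w != 0.
  apply: contraNneq Dw => w1; by rewrite w1 expr0n gtn_eqF.
rewrite g0 mul0r subr0 => gw; split=> //.
rewrite (_ : _ - 1 - _ = w * (g.[w] / D.[w])).
  by rewrite modulusM mulrC ler_wpM2r ?modulus_ge0 // DE.
have := congr1 (horner^~ w) Eg; rewrite /p !(hornerD, hornerN, hornerM, hornerC, hornerX) DE => E.
rewrite mulrA [w * _]mulrC -E; field.
exact: Dw.
Qed.

Lemma inv_expr_near1 q (e : R) : (0 < q)%N -> 0 < e -> exists2 c : R, 0 < c &
  forall s : C, modulus s <= c -> 1 - s != 0 /\ modulus (((1 - s) ^+ q)^-1 - 1) <= e.
Proof.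
move=> q0 e0; pose D : {poly C} := (1%:P - 'X) ^+ q.
have DE w : D.[w] = (1 - w) ^+ q by rewrite /D horner_exp !hornerE.
have D0 : D.[0] != 0 by rewrite DE subr0 expr1n oner_eq0.
have [d d0 Hd] := rat_cont 1 D0 e0.
exists d => // s sd; have := Hd s; rewrite subr0 => /(_ sd)[].
rewrite !DE subr0 expr1n !hornerC divr1 div1r => Ds H; split=> //.
by apply: contraNneq Ds => w1; by rewrite w1 expr0n gtn_eqF.
Qed.

(** * Parabolic fixed points of multiplier 1 *)

Section Parabolic.
Variables (A B H : {poly C}) (z0 : C) (q : nat).
Hypotheses (q0 : (0 < q)%N) (B0 : B.[z0] != 0) (H0 : H.[z0] != 0).
Hypothesis EN : A - 'X * B = H * ('X - z0%:P) ^+ q.+1.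

Let b := H.[z0] / B.[z0].
Let f := ratf A B.
Let kN : {poly C} := q.+1%:R *: (H * B) + ('X - z0%:P) * (H^`() * B - H * B^`()).
(** Fatou coordinate without the usual factor [q]: as [f z - z0] is about
    [(z - z0) (1 + b (z - z0)^q)], the map acts on [u] nearly as translation by [q]. *)
Let u z := - (b * (z - z0) ^+ q)^-1.

Let b0 : b != 0. Proof. by rewrite mulf_neq0 ?invr_eq0. Qed.
Let mb0 : 0 < modulus b. Proof. by rewrite ltr_modulus_gt0. Qed.

Let fE z : B.[z] != 0 -> f z - z0 = (z - z0) * (1 + (z - z0) ^+ q * (H.[z] / B.[z])).
Proof.
move=> Bz; have := congr1 (horner^~ z) EN.
rewrite !(hornerD, hornerN, hornerM, hornerC, hornerX, horner_exp) => E.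
have -> : f z - z0 = z - z0 + (A.[z] - z * B.[z]) / B.[z] by rewrite /f /ratf; field.
by rewrite E exprS; field.
Qed.

Let f'E z : B.[z] != 0 -> ratf' A B z = 1 + (z - z0) ^+ q * (kN.[z] / (B * B).[z]).
Proof.
move=> Bz; have EA : A = 'X * B + H * ('X - z0%:P) ^+ q.+1 by rewrite -EN addrC subrK.
rewrite /ratf' EA !(derivD, derivM, derivN, derivX, derivC, deriv_exp) /kN.
rewrite -(mulr_natl (_ * _) q.+1) /=.
rewrite !(hornerD, hornerN, hornerM, hornerC, hornerX, horner_exp, hornerZ) -polyC_natr hornerC.
by rewrite exprS; field.
Qed.

Let kN0 : kN.[z0] / (B * B).[z0] = q.+1%:R * b.
Proof.
rewrite /kN !(hornerD, hornerN, hornerM, hornerC, hornerX, hornerZ) subrr mul0r addr0 /b.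
by field.
Qed.

(** Here [Y = 1 / |u|], [s = (q + 1) Y], [r = |f'|], and [g] is the quotient of successive distances
    to the fixed point. To first order [r^2] loses at least [3.68 Y], because [q + 1 >= 2], and
    [g^3] at most [3.03 Y]; this margin dictates the exponents 2 and 3. *)
Let real_bound (s Y r a g : R) : 0 <= s -> s <= 1 / 100 -> 0 <= Y -> 2 * Y <= s -> 0 <= r ->
  0 <= a -> a ^+ 2 <= 1 - 188 / 100 * s + s ^+ 2 -> r <= a + s / 100 ->
  1 - 101 / 100 * Y <= g -> r ^+ 2 <= g ^+ 3.
Proof.
move=> s0 s1 Y0 Ys r0 a0 a2 ra gY.
have aS : a <= 1 - 93 / 100 * s.
  rewrite -(@ler_pXn2r _ 2) ?nnegrE //; last by lra.
  by apply: le_trans a2 _; nra.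
have rY : r <= 1 - 184 / 100 * Y by lra.
have r2 : r ^+ 2 <= (1 - 184 / 100 * Y) ^+ 2 by rewrite ler_pXn2r ?nnegrE //; lra.
have g3 : (1 - 101 / 100 * Y) ^+ 3 <= g ^+ 3 by rewrite ler_pXn2r ?nnegrE //; lra.
apply: le_trans r2 (le_trans _ g3).
have -> : (1 - 101 / 100 * Y) ^+ 3 = (1 - 101 / 100 * Y) * (1 - 101 / 100 * Y) ^+ 2 by rewrite exprS.
nra.
Qed.

(** The translation by [q] holds up to 3 percent. The last clause, in a sector about the positive
    axis, is the one-step form of a bound that telescopes along orbits. *)
Lemma parabolic_step : exists2 Mr : R, 0 < Mr &
  forall z, z != z0 -> Mr <= modulus (u z) ->
   [/\ B.[z] != 0, f z != z0, modulus (u (f z) - u z - q%:R) <= 3 / 100 * q%:R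
     & 94 / 100 * modulus (u z) <= complex.Re (u z) ->
       modulus (ratf' A B z) ^+ 2 * modulus (z - z0) ^+ 3 <= modulus (f z - z0) ^+ 3].
Proof.
have tau0 : 0 < (1 / 100 : R) by lra.
have q1 : 1 <= q%:R :> R by rewrite ler1n.
have BB0 : (B * B).[z0] != 0 by rewrite hornerM mulf_neq0.
have e10 : 0 < 1 / 100 * modulus b by rewrite mulr_gt0.
have e20 : 0 < 1 / 100 * q.+1%:R * modulus b by rewrite !mulr_gt0.
have [d1 d10 Hd1] := rat_cont H B0 e10.
have [d2 d20 Hd2] := rat_cont kN BB0 e20.
have [w0 w00 Hw] := inv_expr_expansion q0 tau0.
pose d := Num.min d1 d2; have d0 : 0 < d by rewrite /d lt_min d10.
have bd0 : 0 < modulus b * d ^+ q by rewrite mulr_gt0 ?exprn_gt0.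
(* The summands serve one estimate each: [z] is within [d] of [z0], [w] is within [w0] of 0, and
   [(q + 1) / |u|] is at most 1/100. *)
pose Mr : R := 1 + (modulus b * d ^+ q)^-1 + 2 / w0 + 100 * q.+1%:R.
have t1 : 0 < (modulus b * d ^+ q)^-1 by rewrite invr_gt0.
have t2 : 0 < 2 / w0 by rewrite divr_gt0.
have t3 : 0 < q.+1%:R :> R by [].
exists Mr => [|z zz0]; first by rewrite /Mr; lra.
set U := modulus (u z) => MU.
pose ze := z - z0; have ze0 : ze != 0 by rewrite subr_eq0.
pose t := b * ze ^+ q.
have t0 : t != 0 by rewrite mulf_neq0 // expf_neq0.
pose Y := modulus t.
have Y0 : 0 < Y by rewrite ltr_modulus_gt0.
have UE : U = Y^-1 by rewrite /U /u modulusN modulusV.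
have YU : Y * U = 1 by rewrite UE mulfV ?gt_eqF.
have U0 : 0 < U by rewrite UE invr_gt0.
have mt : Y = modulus b * modulus ze ^+ q by rewrite /Y modulusM modulusX.
have zed : modulus ze <= d.
  have : (modulus b * d ^+ q)^-1 <= U by apply: le_trans MU; rewrite /Mr; lra.
  rewrite UE lef_pV2 ?posrE // mt ler_pM2l // ler_pXn2r ?nnegrE ?modulus_ge0 //.
  exact: ltW.
have [zd1 zd2] : modulus ze <= d1 /\ modulus ze <= d2.
  by move: zed; rewrite /d le_min => /andP[].
have [Bz hz] := Hd1 z zd1; have [_ kz] := Hd2 z zd2.
rewrite -/b in hz; rewrite kN0 in kz.
set h := H.[z] / B.[z] in hz.
pose w := - (ze ^+ q * h).
have uw : u z * w = h / b by rewrite /u /w -/ze; field; rewrite b0 expf_neq0.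
have huw : modulus (u z * w - 1) <= 1 / 100.
  rewrite uw (_ : h / b - 1 = (h - b) / b); last by field.
  by rewrite modulusM modulusV ler_pdivrMr.
have uw2 : U * modulus w <= 101 / 100.
  rewrite -modulusM -[_ * w](subrK 1); apply: le_trans (modulusD _ _) _.
  by rewrite (modulus_nat 1); lra.
have wY : modulus w <= 101 / 100 * Y.
  by rewrite -(ler_pM2l U0); apply: le_trans uw2 _; rewrite mulrCA [U * Y]mulrC YU mulr1.
have ww0 : modulus w <= w0.
  have : 2 / w0 <= U by apply: le_trans MU; rewrite /Mr; lra.
  rewrite ler_pdivrMr // => U2; rewrite -(ler_pM2l U0); lra.
have [w1 Hinv] := Hw w ww0.
have fz : f z - z0 = ze * (1 - w) by rewrite fE // /w opprK.
split=> //.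
- by rewrite -subr_eq0 fz mulf_neq0.
- have -> : u (f z) = u z * ((1 - w) ^+ q)^-1.
    by rewrite /u fz exprMn -/ze; field; rewrite b0 !expf_neq0.
  have -> : u z * ((1 - w) ^+ q)^-1 - u z - q%:R =
     u z * (((1 - w) ^+ q)^-1 - 1 - q%:R * w) + q%:R * (u z * w - 1) by ring.
  apply: le_trans (modulusD _ _) _; rewrite !modulusM modulus_nat -/U.
  have T1 : U * modulus (((1 - w) ^+ q)^-1 - 1 - q%:R * w) <= 1 / 100 * (101 / 100).
    apply: (@le_trans _ _ (U * (1 / 100 * modulus w))); first by rewrite ler_pM2l.
    by lra.
  have T2 : q%:R * modulus (u z * w - 1) <= q%:R * (1 / 100) by rewrite ler_wpM2l ?ler0n.
  by lra.
move=> ReU.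
have Ret : complex.Re t <= - (94 / 100) * Y.
  have ut : u z * (Y ^+ 2)%:C = - conjc t.
    by rewrite modulus_sqrE /u -/ze -/t; field.
  have : complex.Re (u z) * Y ^+ 2 = - complex.Re t.
    move: (congr1 (@complex.Re R) ut).
    by case: (u z) => c1 c2; case: (t) => a1 a2 /=; rewrite mulr0 subr0.
  have : 94 / 100 * Y <= complex.Re (u z) * Y ^+ 2.
    rewrite (_ : 94 / 100 * Y = 94 / 100 * (Y * U) * Y); last by rewrite YU mulr1.
    rewrite (_ : 94 / 100 * (Y * U) * Y = 94 / 100 * U * Y ^+ 2); last by ring.
    by rewrite ler_pM2r // exprn_gt0.
  lra.
set kk := kN.[z] / (B * B).[z] in kz.
have fp : ratf' A B z = (1 + q.+1%:R * t) + ze ^+ q * (kk - q.+1%:R * b).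
  by rewrite f'E // -/kk /t; ring.
have -> : modulus (f z - z0) ^+ 3 = modulus (1 - w) ^+ 3 * modulus ze ^+ 3.
  by rewrite fz (modulusM ze) exprMn mulrC.
apply: ler_wpM2r.
  by rewrite exprn_ge0 ?modulus_ge0.
apply: (@real_bound (q.+1%:R * Y) Y _ (modulus (1 + q.+1%:R * t))); rewrite ?modulus_ge0 ?(ltW Y0) //.
- by rewrite mulr_ge0 ?ltW.
- have : 100 * q.+1%:R <= U by apply: le_trans MU; rewrite /Mr; lra.
  by rewrite -(ler_pM2l Y0) YU => HH; lra.
- by rewrite ler_pM2r // ler_nat ltnS.
- have -> : modulus (1 + q.+1%:R * t) ^+ 2 = 1 + 2 * q.+1%:R * complex.Re t + (q.+1%:R * Y) ^+ 2.
    rewrite exprMn modulus_sqr (modulus_sqr t).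
    have -> : q.+1%:R * t = q.+1%:R *: complex.Re t +i* (q.+1%:R *: complex.Im t).
      by rewrite -(rmorph_nat (real_complex R)); case: (t) => a1 a2;
        apply/eqP; rewrite eq_complex /=; apply/andP; split; apply/eqP; rewrite /GRing.scale /=; ring.
    by rewrite /= /GRing.scale /=; ring.
  rewrite lerD2r lerD2l -mulrA -mulrN.
  have : q.+1%:R * complex.Re t <= q.+1%:R * (- (94 / 100) * Y) by rewrite ler_pM2l.
  lra.
- rewrite fp; apply: le_trans (modulusD _ _) _; rewrite lerD2l modulusM modulusX.
  apply: (@le_trans _ _ (modulus ze ^+ q * (1 / 100 * q.+1%:R * modulus b))).
    by rewrite ler_wpM2l // exprn_ge0 ?modulus_ge0.
  by rewrite mt; lra.
apply: le_trans (modulus_ge_sub _ _); rewrite (modulus_nat 1); lra.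
Qed.

Let modulus_u z : modulus (u z) = (modulus b * modulus (z - z0) ^+ q)^-1.
Proof. by rewrite /u modulusN modulusV modulusM modulusX. Qed.

(** In the half plane [Re u >= Mr] orbits move right and converge to [z0]. Discs about an orbit
    point of radius [c] times its distance to [z0] stay there, whereas the derivative of the
    iterates is bounded by the power 3/2 of that distance. *)
Lemma parabolic_discs : expanding_discs A B z0.
Proof.
have [Mr Mr0 Hstep] := parabolic_step.
have q1 : 1 <= q%:R :> R by rewrite ler1n.
have iterRe z : z != z0 -> Mr <= complex.Re (u z) -> forall m,
    iter m f z != z0 /\ Mr + m%:R * (q%:R / 2) <= complex.Re (u (iter m f z)).
  move=> zz0 Mz; elim=> [|m [mz0 IH]] /=; first by rewrite mul0r addr0.
  have m0 : 0 <= m%:R * (q%:R / 2) :> R by rewrite mulr_ge0 // divr_ge0.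
  have [|_ fz0 du _] := Hstep _ mz0; first by apply: le_trans (ler_Re _); lra.
  split=> //; move: du; rewrite -(rmorph_nat (real_complex R)) => /ler_Re_near; move: IH.
  by rewrite -[m.+1%:R]natr1; set x1 := complex.Re _; set x2 := complex.Re _; lra.
have attr z : z != z0 -> Mr <= complex.Re (u z) -> attracted A B z0 z.
  move=> zz0 Mz; split=> [m|e e0].
    have [mz0 Mm] := iterRe z zz0 Mz m.
    have m0 : 0 <= m%:R * (q%:R / 2) :> R by rewrite mulr_ge0 // divr_ge0.
    by have [|] := Hstep _ mz0; first by apply: le_trans (ler_Re _); lra.
  have be0 : 0 < modulus b * e ^+ q by rewrite mulr_gt0 // exprn_gt0.
  pose M := Num.bound (2 / (modulus b * e ^+ q)).
  exists M => m Mm; have [mz0 Mm2] := iterRe z zz0 Mz m.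
  have bM : 2 / (modulus b * e ^+ q) < m%:R.
    apply: lt_le_trans (archi_boundP _) _; first by rewrite divr_ge0 // ltW.
    by rewrite ler_nat.
  have ze0 : 0 < modulus (iter m f z - z0) by rewrite ltr_modulus_gt0 subr_eq0.
  have : (modulus b * e ^+ q)^-1 < modulus (u (iter m f z)).
    apply: lt_le_trans (ler_Re _); apply: lt_le_trans Mm2.
    have : m%:R * (1 / 2) <= m%:R * (q%:R / 2) :> R by rewrite ler_wpM2l // ler_pM2r.
    by move: bM; set v := _^-1; lra.
  rewrite modulus_u ltf_pV2 ?posrE ?mulr_gt0 ?exprn_gt0 // ltr_pM2l //.
  by rewrite ltr_pXn2r ?nnegrE ?ltW.
have q4 : 0 < 1 / 4 :> R by lra.
have [c c0 Hc] := inv_expr_near1 q0 q4.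
(* The root makes [u x] the real number [2 Mr], twice the threshold, which leaves room for the
   discs. *)
pose ze0 := q.-root (- (b * 2 * Mr%:C)^-1).
have ze0E : ze0 ^+ q = - (b * 2 * Mr%:C)^-1 by rewrite /ze0 rootCK.
pose x := z0 + ze0.
have Mr0C : Mr%:C != 0 :> C by rewrite (_ : 0 = 0%:C) // (inj_eq (@complexI R)) gt_eqF.
have c2 : (2 : C) != 0 by rewrite pnatr_eq0.
have ux : u x = (2 * Mr)%:C.
  rewrite /u /x addrAC subrr add0r ze0E rmorphM /= (_ : 2%:C = 2); last by rewrite rmorph_nat.
  by field; rewrite ?Mr0C ?c2 ?b0.
have xz0 : x != z0.
  rewrite /x -subr_eq0 addrAC subrr add0r; apply/eqP => E; move: ze0E.
  rewrite E expr0n gtn_eqF // => /esym/eqP.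
  have nz : b * 2 * Mr%:C != 0 by apply: mulf_neq0 => //; apply: mulf_neq0.
  by rewrite oppr_eq0 invr_eq0 (negPf nz).
have Mx : Mr <= complex.Re (u x) by rewrite ux /=; lra.
have traj m : modulus (u (iter m f x) - u x - m%:R * q%:R) <= m%:R * (3 / 100 * q%:R).
  elim: m => [|m IH] /=; first by rewrite !mul0r subrr subr0 modulus0.
  have [mz0 Mm] := iterRe x xz0 Mx m.
  have m0 : 0 <= m%:R * (q%:R / 2) :> R by rewrite mulr_ge0 // divr_ge0.
  have [|_ _ du _] := Hstep _ mz0; first by apply: le_trans (ler_Re _); lra.
  rewrite (_ : _ - _ - _ = (u (iter m f x) - u x - m%:R * q%:R) +
     (u (f (iter m f x)) - u (iter m f x) - q%:R)); last by rewrite -[m.+1%:R]natr1; ring.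
  by apply: le_trans (modulusD _ _) _; rewrite -[m.+1%:R]natr1 mulrDl mul1r lerD.
(* An error of 3 percent per step leaves the quotient [0.97 / 1.03], just above the aperture 0.94
   demanded by [parabolic_step]. *)
have sector m : 94 / 100 * modulus (u (iter m f x)) <= complex.Re (u (iter m f x))
    /\ 2 * Mr <= complex.Re (u (iter m f x)).
  have := traj m; rewrite ux.
  have -> : m%:R * q%:R = (m%:R * q%:R)%:C :> C by rewrite rmorphM /= !rmorph_nat.
  set U := u _; set mq := m%:R * q%:R : R => T.
  have mq0 : 0 <= mq by rewrite mulr_ge0.
  have T1 : modulus U <= 2 * Mr + mq + 3 / 100 * mq.
    rewrite (_ : U = (U - (2 * Mr)%:C - mq%:C) + (2 * Mr + mq)%:C); last by rewrite rmorphD; ring.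
    apply: le_trans (modulusD _ _) _; rewrite modulus_real ger0_norm; last by lra.
    by move: T; rewrite mulrCA -/mq; lra.
  have T2 : 2 * Mr + mq - 3 / 100 * mq <= complex.Re U.
    by move/ler_Re_near: T; rewrite mulrCA -/mq /=; lra.
  by split; lra.
have prodle m : \prod_(j < m) modulus (ratf' A B (iter j f x)) ^+ 2 * modulus (x - z0) ^+ 3
    <= modulus (iter m f x - z0) ^+ 3.
  elim: m => [|m IH]; first by rewrite big_ord0 mul1r.
  have [mz0 _] := iterRe x xz0 Mx m; have [Sm1 Sm2] := sector m.
  have [|_ _ _ HH] := Hstep _ mz0; first by apply: le_trans (ler_Re _); lra.
  rewrite big_ord_recr /= -mulrA mulrCA; apply: le_trans (HH Sm1).
  by rewrite ler_wpM2l ?sqr_ge0.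
exists x, (fun m => c * modulus (iter m f x - z0)).
have mzgt m : 0 < modulus (iter m f x - z0).
  by rewrite ltr_modulus_gt0 subr_eq0; case: (iterRe x xz0 Mx m).
split=> [m|m z|e e0]; first by rewrite mulr_gt0.
  move=> zm; have [mz0 _] := iterRe x xz0 Mx m; have [Sm1 Sm2] := sector m.
  pose s := (iter m f x - z) / (iter m f x - z0).
  have D0 : iter m f x - z0 != 0 by rewrite subr_eq0.
  have sc : modulus s <= c by rewrite modulusM modulusV ler_pdivrMr // modulusC.
  have [s1 Hs] := Hc s sc.
  have zE : z - z0 = (iter m f x - z0) * (1 - s) by rewrite /s; field.
  apply: attr; first by rewrite -subr_eq0 zE mulf_neq0.
  have uE : u z = u (iter m f x) + u (iter m f x) * (((1 - s) ^+ q)^-1 - 1).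
    by rewrite /u zE exprMn; field; rewrite b0 !expf_neq0.
  have : modulus (u (iter m f x) * (((1 - s) ^+ q)^-1 - 1)) <= modulus (u (iter m f x)) * (1 / 4).
    by rewrite modulusM ler_wpM2l ?modulus_ge0.
  rewrite (_ : u _ * (_ - 1) = u z - u (iter m f x) - 0%:C); last by rewrite uE rmorph0; ring.
  by move=> /ler_Re_near; move: Sm1 Sm2; lra.
have [_ cx] := attr x xz0 Mx.
have xz : 0 < modulus (x - z0) by exact: (mzgt 0%N).
(* With this tolerance [|z_M - z0|^3] is at most [e^2 c^2 |x - z0|^3 |z_M - z0|^2], which matches
   the squared goal after [prodle]. *)
have [M HM] := cx (e ^+ 2 * c ^+ 2 * modulus (x - z0) ^+ 3) (ltac:(by rewrite !mulr_gt0 ?exprn_gt0)).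
have {HM} HM := HM M (leqnn M); exists M.
have P0 : 0 <= \prod_(j < M) modulus (ratf' A B (iter j f x)).
  by apply: prodr_ge0 => j _; exact: modulus_ge0.
rewrite -(@ler_pXn2r _ 2) ?nnegrE ?mulr_ge0 ?modulus_ge0 ?(ltW c0) ?(ltW e0) //.
rewrite -prodrXl -(ler_pM2r (_ : 0 < modulus (x - z0) ^+ 3)) ?exprn_gt0 //.
apply: le_trans (prodle M) _; rewrite exprS mulrC !exprMn.
have := mzgt M; move: HM; rewrite -/f; set X := modulus _; set Z := modulus _ => XZ X0.
rewrite (_ : e ^+ 2 * _ * _ = X ^+ 2 * (e ^+ 2 * c ^+ 2 * Z ^+ 3)); last by ring.
by rewrite ler_pM2l ?exprn_gt0 // ltW.
Qed.

End Parabolic.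

End Local.

(** * Counting non-repelling fixed points *)

Section Fatou.
Variables (R : realType) (n : nat) (P Q : {poly R[i]}).
Local Notation C := (R[i]).
Hypotheses (nd : nondeg n (P, Q)) (n2 : (2 <= n)%N).
Implicit Types (z : C) (X : C * C).

Let conjp : {poly C} -> {poly C} := map_poly (@conjc R).
(** An antiholomorphic map is not a composite of forms, but its square is: [P / Q] followed by the
    map with conjugate coefficients. *)
Let LL := [:: (P, Q); (conjp P, conjp Q)].

Fixpoint iterL m := if m is m'.+1 then iterL m' ++ LL else [::].

Definition conj2 X : C * C := (conjc X.1, conjc X.2).
Definition antirat X : C * C := conj2 (step n (P, Q) X).

Let ndc : nondeg n (conjp P, conjp Q).
Proof.
case/andP: nd => /= cop sz; rewrite /nondeg /= coprimep_map cop /=.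
by rewrite !size_map_poly.
Qed.

Lemma nd_iterL m : all (nondeg n) (iterL m).
Proof. by elim: m => //= m IH; rewrite all_cat IH /= nd ndc. Qed.

Lemma antirat_neq0 X : X != (0, 0) -> antirat X != (0, 0).
Proof.
move=> X0; have := step_neq0 nd X0; apply: contra_neq.
move=> E; have : conj2 (antirat X) = (0, 0) by rewrite E; congr (_, _); rewrite rmorph0.
by rewrite /antirat /conj2 /= !conjcK.
Qed.

Lemma orb_LL X : orb n LL X = antirat (antirat X).
Proof.
rewrite /LL /antirat /=; move: (step n (P, Q) X) => Y.
have E (p : {poly C}) : hom n (conjp p) Y.1 Y.2 = conjc (hom n p (conjc Y.1) (conjc Y.2)).
  by rewrite [RHS]hom_map /= !conjcK.
by rewrite /step /conj2 /= !E.
Qed.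

Lemma orb_iterL m X : orb n (iterL m) X = iter (m + m) antirat X.
Proof.
elim: m => //= m IH; rewrite orb_cat orb_LL IH addnS /=; congr (antirat (antirat _)).
Qed.

Lemma jacs_LL X : jacs n LL X = jac n P Q X.1 X.2 *
   conjc (jac n P Q (antirat X).1 (antirat X).2).
Proof.
rewrite /LL /= mulr1; congr (_ * _).
by rewrite jac_map /antirat /conj2 /= !conjcK.
Qed.

Lemma antirat_scale c X : antirat (scale c X) = scale (conjc c ^+ n) (antirat X).
Proof. by rewrite /antirat step_scale /conj2 /scale /= !rmorphM !rmorphXn. Qed.

(* [basin z0] is the set of points of the projective line, in homogeneous
   coordinates, whose orbit under the second iterate converges to [z0]. *)
Definition basin z0 X := X != (0, 0) /\ forall e : R, 0 < e -> exists M, forall m, (M <= m)%N ->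
   (orb n (iterL m) X).2 != 0 /\
   modulus ((orb n (iterL m) X).1 / (orb n (iterL m) X).2 - z0) < e.

Lemma scale_neq0 c X : c != 0 -> X != (0, 0) -> scale c X != (0, 0).
Proof.
move=> c0; apply: contra_neq; case: X => x y; rewrite /scale /= => -[/eqP + /eqP].
by rewrite !mulf_eq0 (negPf c0) /= => /eqP -> /eqP ->.
Qed.

Lemma basin_scale z0 c X : c != 0 -> basin z0 X -> basin z0 (scale c X).
Proof.
move=> c0 [X0 HX]; split; first exact: scale_neq0.
move=> e /HX[M HM]; exists M => m /HM[Y2 Ye].
rewrite orb_scale /scale /=; set d := c ^+ _.
have d0 : d != 0 by rewrite expf_neq0.
by rewrite mulf_neq0 // -mulf_div divff // mul1r.
Qed.

Lemma orb_iterLD m j X : orb n (iterL j) (orb n (iterL m) X) = orb n (iterL (m + j)) X.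
Proof. by rewrite !orb_iterL -iterD; congr (iter _ _ _); lia. Qed.

Lemma basin_back z0 m X : X != (0, 0) -> basin z0 (orb n (iterL m) X) -> basin z0 X.
Proof.
move=> X0 [_ HX]; split=> // e /HX[M HM]; exists (m + M)%N => j Mj.
have -> : j = (m + (j - m))%N by lia.
by rewrite -orb_iterLD; apply: HM; lia.
Qed.

Lemma basin_forward z0 m X : basin z0 X -> basin z0 (orb n (iterL m) X).
Proof.
move=> [X0 HX]; split; first exact: orb_neq0 (nd_iterL m) X0.
move=> e /HX[M HM]; exists M => j Mj; rewrite orb_iterLD; apply: HM; lia.
Qed.

Lemma basin_disjoint z0 z1 X : basin z0 X -> basin z1 X -> z0 = z1.
Proof.
move=> [_ H0] [_ H1]; apply/eqP/negPn/negP => z01.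
have d0 : 0 < modulus (z0 - z1) / 2 by rewrite divr_gt0 // ltr_modulus_gt0 subr_eq0.
have [M HM] := H0 _ d0; have [N HN] := H1 _ d0.
have [_] := HM (maxn M N) (leq_maxl _ _); have [_] := HN (maxn M N) (leq_maxr _ _).
set w := _ / _ => W1 W0.
have := modulusD (z0 - w) (w - z1); rewrite subrKA [modulus (z0 - w)]modulusC => H.
by have := le_lt_trans H (ltrD W0 W1); rewrite -splitr ltxx.
Qed.

Definition fixpt z := Q.[z] != 0 /\ P.[z] = conjc z * Q.[z].

Let sP : (size P <= n.+1)%N. Proof. by case: (nondeg_size nd). Qed.
Let sQ : (size Q <= n.+1)%N. Proof. by case: (nondeg_size nd). Qed.

Lemma antirat_affine z : antirat (z, 1) = (conjc P.[z], conjc Q.[z]).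
Proof. by rewrite /antirat /step /conj2 /= !hom1r. Qed.

Lemma scale1E z c : scale c (z, 1) = (c * z, c) :> C * C.
Proof. by rewrite /scale /= mulr1. Qed.

Lemma antirat_fixpt z : fixpt z -> antirat (z, 1) = scale (conjc Q.[z]) (z, 1).
Proof.
by move=> [_ E]; rewrite antirat_affine scale1E E rmorphM /= conjcK mulrC.
Qed.

(** The basin refers to the square of [antirat]; as [z0] is fixed by [antirat] itself, continuity
    there gives invariance under a single step. Hence a critical point of the square yields one of
    [P / Q] in the same basin. *)
Lemma basin_antirat z0 X : fixpt z0 -> basin z0 X -> basin z0 (antirat X).
Proof.
move=> [Q0 E0] [X0 HX]; split; first exact: antirat_neq0.
move=> e e0; have [d d0 Hd] := rat_cont P Q0 (divr_gt0 e0 (ltr0n R 2)).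
have [M HM] := HX d d0; exists M => m /HM.
rewrite !orb_iterL -iterSr iterS; case: (iter _ _ _) => a b [b0 /ltW/Hd[Qab Pab]].
have -> : antirat (a, b) = scale (conjc b ^+ n) (antirat (a / b, 1)).
  by rewrite -antirat_scale scale1E mulrCA divff // mulr1.
rewrite antirat_affine /scale /=.
have cb0 : conjc b ^+ n != 0 by rewrite expf_neq0 // conjc_eq0.
rewrite mulf_neq0 ?conjc_eq0 //; split=> //.
rewrite -mulf_div divff // mul1r; apply: le_lt_trans (_ : e / 2 < e); last first.
  by rewrite ltr_pdivrMr // mulrDr mulr1 ltrDl.
move: Pab; rewrite E0 mulfK // /modulus.
by rewrite -fmorphV -rmorphM -[in X in _ -> X](conjcK z0) -rmorphB; case: (_ - _) => x y /=; rewrite sqrrN.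
Qed.

(* In the affine chart the second iterate is the rational function [secA / secB]. *)
Let LLp := map (map_ppair (@polyC C)) LL.
Definition secA : {poly C} := (orb n LLp ('X, 1)).1.
Definition secB : {poly C} := (orb n LLp ('X, 1)).2.

Let LLpE z : map (map_ppair (horner_eval z)) LLp = LL.
Proof.
rewrite /LLp -map_comp -[RHS]map_id; apply: eq_map => -[p q] /=.
have E (r : {poly R[i]}) : map_poly (horner_eval z) (map_poly polyC r) = r.
  by rewrite -map_poly_comp; apply: map_poly_id => c _ /=; rewrite /horner_eval hornerC.
by rewrite /map_ppair /= !E.
Qed.

Let evX1 z : map_pair (horner_eval z) ('X, 1) = (z, 1).
Proof. by rewrite /map_pair /= /horner_eval hornerX hornerC. Qed.

Lemma orb_LL_affine z : orb n LL (z, 1) = (secA.[z], secB.[z]).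
Proof.
transitivity (orb n LL (map_pair (horner_eval z) ('X, 1))).
  by rewrite (evX1 z).
by rewrite -{1}(LLpE z) -orb_map.
Qed.

(** The curve [('X, 1)] has Wronskian 1, so the numerator of the derivative of the second iterate is
    the Jacobian of the composite form. *)
Lemma wronskian_sec z : (secA^`() * secB - secA * secB^`()).[z] = jacs n LL (z, 1).
Proof.
have := wronskian_orb n LL ('X, 1); rewrite -/LLp -/secA -/secB /= => E.
have E2 : secA^`() * secB - secA * secB^`() = jacs n LLp ('X, 1).
  rewrite -[LHS]/(wronskian secA secB) [LHS](wronskian_orb n LL ('X, 1)) -/LLp.
  rewrite /wronskian /= derivX (_ : 1^`() = 0) ?mulr0 ?subr0 ?mulr1 //.
  by rewrite -polyC1 derivC.
rewrite E2; apply: eq_trans (congr1 (jacs n LL) (evX1 z)).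
by rewrite -{1}(LLpE z) -jacs_map.
Qed.

Notation f := (ratf secA secB).

Lemma orb_LL_ratf z : secB.[z] != 0 -> orb n LL (z, 1) = scale secB.[z] (f z, 1).
Proof. by move=> Bz; rewrite orb_LL_affine scale1E /ratf mulrCA divff // mulr1. Qed.

(** [c] is the second homogeneous coordinate of the image; the numerator of a derivative carries the
    square of the denominator, whence [c ^+ 2]. *)
Lemma orb_iterL_ratf z m : (forall j, (j < m)%N -> secB.[iter j f z] != 0) ->
  exists2 c : C, c != 0 & orb n (iterL m) (z, 1) = scale c (iter m f z, 1) /\
    jacs n (iterL m) (z, 1) = c ^+ 2 * \prod_(j < m) ratf' secA secB (iter j f z).
Proof.
elim: m => [|m IH] Hj.
  exists 1; first by rewrite oner_eq0.
  by split; rewrite /= ?scale1E ?big_ord0 ?expr1n !mul1r.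
have [|c c0 [Eo Ej]] := IH; first by move=> j jm; apply: Hj; exact: ltnW.
have Bm := Hj m (ltnSn m).
exists (c ^+ (n ^ size LL) * secB.[iter m f z]); first by rewrite mulf_neq0 // expf_neq0.
split.
  rewrite orb_cat Eo orb_scale orb_LL_ratf // /scale /=; congr (_, _); ring.
rewrite jacs_cat Ej Eo big_ord_recr /=.
have := jacs_scale n LL c (iter m f z, 1); rewrite -wronskian_sec => E.
rewrite /ratf' mulrAC E; field.
exact: Bm.
Qed.

Lemma attracted_basin z0 z : attracted secA secB z0 z -> basin z0 (z, 1).
Proof.
move=> [Bz cz]; split.
  by apply/eqP => -[_ /eqP]; rewrite oner_eq0.
move=> e /cz[M HM]; exists M => m /HM mz.
have [|c c0 [-> _]] := @orb_iterL_ratf z m; first by move=> j _; exact: Bz.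
by rewrite scale1E /= [c * _]mulrC mulfK.
Qed.

Lemma basin_affine z0 X : X.2 != 0 -> attracted secA secB z0 (X.1 / X.2) -> basin z0 X.
Proof.
move=> X2 /attracted_basin /(basin_scale X2).
by rewrite scale1E mulrCA divff // mulr1; case: X X2.
Qed.

Let disc_ineq (w a b : C) (d : R) : (a, b) != (0, 0) -> 
  modulus (a - w * b) ^+ 2 <= d ^+ 2 * modulus b ^+ 2 -> 0 < d ->
  b != 0 /\ modulus (a / b - w) <= d.
Proof.
move=> ab0 H d0; have [b0|b0] := eqVneq b 0.
  move: H; rewrite b0 mulr0 subr0 modulus0 expr0n /= mulr0 => H.
  have : modulus a ^+ 2 == 0 by rewrite eq_le H sqr_ge0.
  rewrite sqrf_eq0 modulus_eq0 => /eqP a0.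
  by move: ab0; rewrite a0 b0 eqxx.
split=> //; move: H; rewrite -exprMn ler_pXn2r ?nnegrE ?mulr_ge0 ?modulus_ge0 ?(ltW d0) // => H.
have -> : a / b - w = (a - w * b) / b by field.
by rewrite modulusM modulusV ler_pdivrMr ?ltr_modulus_gt0.
Qed.

(** Otherwise [ahlfors] applies to every disc of the family at [z0], and the set avoided is the disc
    of index 0 about [y], which lies in the basin of [z1]; this is the purpose of a second fixed
    point. At [(x, 1)] the factor [gapT] does not depend on [m]. *)
Lemma critical_in_basin z0 z1 : fixpt z0 -> z0 <> z1 ->
  expanding_discs secA secB z0 -> expanding_discs secA secB z1 ->
  exists X, basin z0 X /\ jac n P Q X.1 X.2 = 0.
Proof.
move=> fz0 z01 [x [del [del0 Hdel Hprod]]] [y [eps [eps0 Heps _]]].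
apply: contrapT => nocrit.
have jac0 X : basin z0 X -> jac n P Q X.1 X.2 != 0.
  by move=> BX; apply/eqP => J; apply: nocrit; exists X.
have jacsLL X : basin z0 X -> jacs n LL X != 0.
  move=> BX; rewrite jacs_LL mulf_neq0 ?conjc_eq0 ?jac0 //.
  exact: basin_antirat.
have jacsL m X : basin z0 X -> jacs n (iterL m) X != 0.
  move=> BX; elim: m => [|m IH]; first by rewrite oner_eq0.
  by rewrite /= jacs_cat mulf_neq0 // jacsLL //; exact: basin_forward.
have x_attr : attracted secA secB z0 x.
  by apply: (Hdel 0%N); rewrite subrr modulus0 ltW.
have Bx := x_attr.1.
have sep m X : X != (0, 0) -> 0 <= gapS n (iterL m) (iter m f x) (del m) X ->
    0 < gapT y (eps 0%N) X /\ jacs n (iterL m) X != 0.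
  move=> X0; rewrite /gapS subr_ge0 => SX.
  have oX0 := orb_neq0 (nd_iterL m) X0.
  have [||o2 oS] := disc_ineq _ SX; first by case: (orb _ _ _) oX0.
    exact: del0.
  have BX : basin z0 X.
    apply: (@basin_back z0 m) => //; apply: basin_affine => //.
    exact: Hdel oS.
  split; last exact: jacsL.
  rewrite ltNge; apply/negP; rewrite /gapT subr_le0 => TX.
  have [||x2 xT] := disc_ineq _ TX; first by case: (X) X0.
    exact: eps0.
  apply: z01; apply: basin_disjoint BX _; apply: basin_affine => //.
  exact: (Heps 0%N).
have x10 : (x, 1) != (0, 0) :> C * C by apply/eqP => -[_ /eqP]; rewrite oner_eq0.
have key m : eps 0%N * del m <= gapT y (eps 0%N) (x, 1) *
     \prod_(j < m) modulus (ratf' secA secB (iter j f x)).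
  have [|c c0 [Eo Ej]] := @orb_iterL_ratf x m; first by move=> j _; exact: Bx.
  have gS : gapS n (iterL m) (iter m f x) (del m) (x, 1) = del m ^+ 2 * modulus c ^+ 2.
    by rewrite /gapS Eo /scale /= mulr1 [c * _]mulrC subrr modulus0 expr0n subr0.
  have := @ahlfors R n (iterL m) (iter m f x) y (del m) (eps 0%N) (del0 m) (eps0 0%N) (sep m) (x, 1) x10.
  rewrite gS Ej => H; have {H} := H (mulr_ge0 (sqr_ge0 _) (sqr_ge0 _)).
  rewrite modulusM modulusX (big_morph _ (@modulusM R) (modulus_nat R 1)).
  have mc : 0 < del m * modulus c ^+ 2 by rewrite mulr_gt0 // exprn_gt0 // ltr_modulus_gt0.
  by move=> H; rewrite -(ler_pM2r mc); apply: le_trans (le_trans _ H) _;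
    rewrite le_eqVlt; apply/orP; left; apply/eqP; ring.
have [T0 _] : 0 < gapT y (eps 0%N) (x, 1) /\ jacs n (iterL 0) (x, 1) != 0.
  apply: (sep 0%N) => //; rewrite /gapS /= mulr1 subrr modulus0 expr0n subr0.
  by rewrite mulr_ge0 ?sqr_ge0.
(* With this tolerance the two bounds give [eps 0 * del m <= eps 0 * del m / 2]. *)
have e0 : 0 < eps 0%N / (2 * gapT y (eps 0%N) (x, 1)) by rewrite divr_gt0 // mulr_gt0.
have [m Hm] := Hprod _ e0.
have := le_trans (key m) (ler_wpM2l (ltW T0) Hm).
rewrite (_ : gapT _ _ _ * _ = eps 0%N * del m / 2); last by field; rewrite gt_eqF.
by rewrite leNgt ltr_pdivrMr // mulrDr mulr1 ltrDl mulr_gt0.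
Qed.

Let kap : {poly C} := wronskian P Q.

Lemma kapE z : kap.[z] = jac n P Q z 1.
Proof.
have hX (p : {poly C}) : (size p <= n.+1)%N -> hom n p^:P 'X 1 = p.
  move=> sp; rewrite hom1r ?size_map_polyC //.
  by rewrite -[RHS]comp_polyXr /comp_poly.
have := wronskian_hom n P Q 'X 1; rewrite !hX // -/kap => ->.
have w1 : wronskian 'X 1 = 1 :> {poly C}.
  rewrite /wronskian derivX (_ : 1^`() = 0) ?mulr0 ?subr0 ?mulr1 //.
  by rewrite -polyC1 derivC.
have hx : horner_eval z 'X = z by rewrite /horner_eval hornerX.
have h1 : horner_eval z 1 = 1 by rewrite /horner_eval hornerC.
rewrite w1 mulr1; apply: eq_trans (jac_map n (horner_eval z) P^:P Q^:P 'X 1) _.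
have E (r : {poly R[i]}) : map_poly (horner_eval z) (map_poly polyC r) = r.
  by rewrite -map_poly_comp; apply: map_poly_id => c _ /=; rewrite /horner_eval hornerC.
by congr (jac n _ _ _ _); [exact: E | exact: E | exact: hx | exact: h1].
Qed.

(** Chain rule for the square of an antiholomorphic map: at a fixed point the second factor is the
    conjugate of the first. *)
Lemma ratf'_fixpt z : fixpt z ->
  secB.[z] != 0 /\ f z = z /\
  ratf' secA secB z = ratf' P Q z * conjc (ratf' P Q z).
Proof.
move=> fz; have [Q0 _] := fz; have cQ0 : conjc Q.[z] != 0 by rewrite conjc_eq0.
have o2 : orb n LL (z, 1) = scale (Q.[z] ^+ n * conjc Q.[z]) (z, 1).
  rewrite orb_LL antirat_fixpt // antirat_scale conjcK antirat_fixpt //.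
  by rewrite /scale /= !mulr1 mulrA.
move: (o2); rewrite orb_LL_affine scale1E => -[EA EB].
have B0 : secB.[z] != 0 by rewrite EB mulf_neq0 // expf_neq0.
split=> //; split; first by rewrite /ratf EA EB mulrAC divff ?mul1r // -EB.
have rE : ratf' P Q z = jac n P Q z 1 / Q.[z] ^+ 2 by rewrite /ratf' -kapE.
rewrite rE /ratf' wronskian_sec jacs_LL antirat_fixpt // EB.
have := congr1 (@conjc R) (jac_scale n P Q (conjc Q.[z]) z 1).
rewrite !rmorphM !rmorphXn /= conjcK rmorphV ?unitfE ?expf_neq0 // rmorphXn /= => E.
rewrite /scale /=; set J := conjc (jac _ _ _ (_ * z) _) in E *.
have -> : J = Q.[z] ^+ (n + n) * conjc (jac n P Q z 1) / Q.[z] ^+ 2.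
  by rewrite -E; field.
rewrite exprD; field.
by rewrite Q0 cQ0 expf_neq0.
Qed.

Lemma poly_zero_off0 (h : {poly C}) : (forall t, t != 0 -> h.[t] = 0) -> h = 0.
Proof.
move=> H; apply/eqP/negPn/negP => h0.
have := @max_poly_roots _ h [seq i.+1%:R | i <- iota 0 (size h)] h0.
rewrite size_map size_iota ltnn => HH; suff : false by []; apply: HH.
  by apply/allP => _ /mapP[i _ ->]; rewrite /root H // pnatr_eq0.
rewrite map_inj_uniq ?iota_uniq // => i j /eqP.
by rewrite eqr_nat eqSS => /eqP.
Qed.

(** Degree [2n - 1] would need [i = j = n], where the coefficient is 0. Vanishing of the coefficient
    of degree [2n - 2] means that infinity is critical. *)
Lemma coef_kap : (size kap <= n + n - 1)%N /\ jac n P Q 1 0 = kap`_(n + n - 2).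
Proof.
have kE : kap = \sum_(i < n.+1) \sum_(j < n.+1)
    (P`_i * Q`_j * (i%:R - j%:R))%:P * 'X^((i + j).-1).
  apply/eqP; rewrite -subr_eq0; apply/eqP.
  apply: poly_zero_off0 => t _; rewrite hornerD hornerN kapE /jac horner_sum.
  apply/eqP; rewrite subr_eq0; apply/eqP; apply: eq_bigr => i _.
  rewrite horner_sum; apply: eq_bigr => j _.
  by rewrite hornerM hornerC hornerXn expr1n mulr1 mulrA.
split.
  rewrite kE; apply: (leq_trans (size_sum _ _ _)); apply/bigmax_leqP => i _.
  apply: (leq_trans (size_sum _ _ _)); apply/bigmax_leqP => j _.
  have [->|ij] := eqVneq (i : nat) j; first by rewrite subrr mulr0 mul0r size_poly0.
  rewrite mul_polyC; apply: (leq_trans (size_scale_leq _ _)); rewrite size_polyXn.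
  by have := ltn_ord i; have := ltn_ord j; move/eqP: ij; lia.
rewrite kE coef_sum /jac; apply: eq_bigr => i _; rewrite coef_sum; apply: eq_bigr => j _.
have [->|ij] := eqVneq (i : nat) j; first by rewrite subrr mul0r !mulr0 coefCM mul0r.
rewrite coefCM coefXn expr1n mul1r expr0n mulrA; congr (_ * _%:R); congr nat_of_bool.
apply/eqP/eqP; have := ltn_ord i; have := ltn_ord j; move/eqP: ij; lia.
Qed.

Lemma kap_neq0 : kap != 0.
Proof.
case/andP: nd => /= cop /eqP sz; apply/negP => /eqP k0.
have const (p q : {poly C}) : coprimep p q -> p^`() * q = p * q^`() -> (size p <= 1)%N.
  move=> cpq E; have pp : p %| p^`().
    by rewrite -(Gauss_dvdpl _ cpq) E dvdp_mulr.
  rewrite leqNgt; apply/negP => sp.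
  have p0 : p != 0 by rewrite -size_poly_gt0; exact: ltn_trans sp.
  have dp0 : p^`() != 0.
    have : p^`()`_(size p).-2 != 0.
      rewrite coef_deriv; have -> : (size p).-2.+1 = (size p).-1 by case: (size p) sp => [|[]].
      by rewrite mulrn_eq0 -lead_coefE lead_coef_eq0 (negPf p0) orbF; case: (size p) sp => [|[]].
    by apply: contraNneq => ->; rewrite coef0.
  have := dvdp_leq dp0 pp; rewrite leqNgt.
  by rewrite lt_size_deriv.
have E : P^`() * Q = P * Q^`() by apply/eqP; rewrite -subr_eq0; apply/eqP.
have sP1 : (size P <= 1)%N by exact: const cop E.
have sQ1 : (size Q <= 1)%N.
  by apply: (const Q P); [rewrite coprimep_sym | rewrite mulrC -E mulrC].
have m1 : (maxn (size P) (size Q) <= 1)%N by rewrite geq_max sP1.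
by move: n2; rewrite -sz; move: m1; case: (maxn _ _) => [|[]].
Qed.

(* If the second iterate were the identity, then along a line through a critical
   point the Jacobian of the iterated form would be a square of a polynomial
   vanishing there, and the form itself would vanish. *)
Lemma sec_neqX : secA - 'X * secB != 0.
Proof.
apply/negP => /eqP; move/eqP; rewrite subr_eq0 => /eqP EA.
have ndLL : all (nondeg n) LL by rewrite /= nd ndc.
have [ksize k10] := coef_kap.
have noroot z : kap.[z] != 0.
  apply/eqP => kz; have : jacs n LL (z, 1) = 0 by rewrite jacs_LL -kapE kz mul0r.
  rewrite -wronskian_sec EA derivM derivX mul1r !hornerE.
  rewrite (_ : _ - _ = secB.[z] ^+ 2); last by ring.
  move/eqP; rewrite sqrf_eq0 => /eqP Bz.
  have x10 : (z, 1) != (0, 0) :> C * C by apply/eqP => -[_ /eqP]; rewrite oner_eq0.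
  by have := orb_neq0 ndLL x10; rewrite orb_LL_affine EA !hornerE Bz mulr0 eqxx.
(* Without affine critical points [kap] is constant; since [n >= 2] its coefficient of degree
   [2n - 2] is then 0, so infinity is critical and the argument is repeated in the chart
   [(1, 'X)]. *)
have sk : size kap = 1%N.
  by apply/eqP; apply/negPn/negP => /closed_rootP[z]; rewrite /root (negPf (noroot z)).
have j0 : jac n P Q 1 0 = 0 by rewrite k10 nth_default // sk; move: n2; lia.
pose A3 := (orb n LLp (1, 'X)).1; pose B3 := (orb n LLp (1, 'X)).2.
have ev z : map_pair (horner_eval z) (1, 'X) = (1, z).
  by rewrite /map_pair /= /horner_eval hornerX hornerC.
have o3 z : orb n LL (1, z) = (A3.[z], B3.[z]).
  transitivity (orb n LL (map_pair (horner_eval z) (1, 'X))); first by rewrite (ev z).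
  by rewrite -{1}(LLpE z) -orb_map.
have EB : B3 = 'X * A3.
  apply/eqP; rewrite -subr_eq0; apply/eqP; apply: poly_zero_off0 => t t0.
  have : orb n LL (1, t) = scale (t ^+ (n ^ size LL)) (orb n LL (t^-1, 1)).
    by rewrite -orb_scale scale1E divff.
  rewrite o3 orb_LL_affine EA /scale /= !hornerE => -[-> ->].
  by field.
have E2 : wronskian A3 B3 = - jacs n LLp (1, 'X).
  rewrite [LHS](wronskian_orb n LL (1, 'X)) -/LLp /wronskian /= derivX.
  rewrite (_ : 1^`() = 0) ?mul0r ?sub0r ?mulrN ?mulr1 //.
  by rewrite -polyC1 derivC.
have J0 : jacs n LL (1, 0) = 0 by rewrite jacs_LL j0 mul0r.
have : (wronskian A3 B3).[0] = 0.
  rewrite E2 hornerN; apply/eqP; rewrite oppr_eq0; apply/eqP.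
  rewrite -[RHS]J0; apply: eq_trans (congr1 (jacs n LL) (ev 0)).
  by rewrite -{1}(LLpE 0) -jacs_map.
rewrite /wronskian EB derivM derivX mul1r.
rewrite (_ : _ - _ = - (A3 * A3)); last by ring.
rewrite hornerN hornerM => /eqP; rewrite oppr_eq0 mulf_eq0 orbb => /eqP A0.
have x10 : (1, 0) != (0, 0) :> C * C by apply/eqP => -[/eqP]; rewrite oner_eq0.
by have := orb_neq0 ndLL x10; rewrite o3 EB !hornerE A0 ?mulr0 ?mul0r eqxx.
Qed.

(** If the multiplier is 1, then [secA - 'X * secB] vanishes at [z] together with its derivative;
    its multiplicity, finite by [sec_neqX], is at least 2 and exceeds the parabolic exponent by
    one. *)
Lemma nonrepelling_discs z : fixpt z -> modulus (ratf' P Q z) <= 1 ->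
  expanding_discs secA secB z.
Proof.
move=> fz; have [B0 [ffz Elam]] := ratf'_fixpt fz.
have Emod : ratf' secA secB z = (modulus (ratf' P Q z) ^+ 2)%:C by rewrite modulus_sqrE.
rewrite le_eqVlt => /orP[/eqP lam1|lam1]; last first.
  apply: attracting_discs => //; rewrite Emod modulus_real ger0_norm ?sqr_ge0 //.
  by rewrite expr_lt1 ?modulus_ge0.
have {}Elam : ratf' secA secB z = 1 by rewrite Emod lam1 expr1n.
have [m [H H0 EN]] := multiplicity_XsubC (secA - 'X * secB) z.
rewrite sec_neqX /= in H0.
have Hz : H.[z] != 0 by move: H0; rewrite /root.
have Nz : (secA - 'X * secB).[z] = 0.
  rewrite !hornerE; apply/eqP; rewrite subr_eq0; apply/eqP.
  by rewrite -{2}ffz /ratf divfK.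
have N'z : (secA - 'X * secB)^`().[z] = 0.
  have EA : secA.[z] = z * secB.[z] by rewrite -{2}ffz /ratf divfK.
  have := Elam; rewrite /ratf' => /(congr1 (fun w => w * secB.[z] ^+ 2)).
  rewrite divfK ?expf_neq0 // mul1r => E.
  have {}E : secB.[z] * (secA^`().[z] - z * secB^`().[z] - secB.[z]) = 0.
    rewrite !(hornerD, hornerN, hornerM) EA in E.
    by apply/eqP; rewrite -subr_eq0 in E *; rewrite -[X in _ == X](subrr (secB.[z] ^+ 2)) -{1}E; apply/eqP; ring.
  move/eqP: E; rewrite mulf_eq0 (negPf B0) /= => /eqP E.
  rewrite derivB derivM derivX mul1r !(hornerD, hornerN, hornerM, hornerX) -[RHS]E; ring.
case: m EN => [|[|q]] EN.
- by move: Nz; rewrite EN expr0 mulr1 => /eqP; rewrite (negPf Hz).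
- move: N'z; rewrite EN expr1 derivM derivB derivX derivC subr0 mulr1.
  rewrite hornerD hornerM !hornerE subrr mulr0 add0r => /eqP; by rewrite (negPf Hz).
exact: (@parabolic_discs _ _ _ H z q.+1).
Qed.

Let basin_proj z z' X X' : basin z X -> basin z' X' -> X.2 * X'.1 = X.1 * X'.2 -> z = z'.
Proof.
move=> BX BX' E; have [X0 _] := BX; have [X'0 _] := BX'.
have [c c0 Ec] : exists2 c, c != 0 & X' = scale c X.
  case: X X' E X0 X'0 {BX BX'} => x y [x' y'] /= E X0 X'0.
  have [y0|yN0] := eqVneq y 0.
    have x0 : x != 0 by apply: contraNneq X0 => ->; rewrite y0.
    have y'0 : y' = 0.
      by apply/eqP; move/eqP: E; rewrite y0 mul0r eq_sym mulf_eq0 (negPf x0).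
    have x'0 : x' != 0 by apply: contraNneq X'0 => ->; rewrite y'0.
    exists (x' / x); first by rewrite mulf_neq0 ?invr_eq0.
    by rewrite /scale /= divfK // y0 mulr0 y'0.
  have y'0 : y' != 0.
    apply: contraNneq X'0 => y'0; move/eqP: E; rewrite y'0 mulr0 mulf_eq0 (negPf yN0) /=.
    by move/eqP => ->.
  exists (y' / y); first by rewrite mulf_neq0 ?invr_eq0.
  rewrite /scale /= divfK //; congr (_, _).
  by rewrite mulrAC [y' * x]mulrC -E mulrAC divff // mul1r.
by apply: (@basin_disjoint _ _ X') => //; rewrite Ec; exact: basin_scale.
Qed.

(** A single point obeys the bound because [n >= 2]. With two or more, each basin holds a critical
    point, and disjointness makes these projectively distinct. *)
Theorem fatou_count (s : seq C) : uniq s ->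
  (forall z, z \in s -> fixpt z /\ modulus (ratf' P Q z) <= 1) -> (size s <= n + n - 2)%N.
Proof.
move=> us Hs; have [s1|s2] := leqP (size s) 1; first by move: n2; lia.
have /choice[F HF] : forall z, exists X : C * C, z \in s -> basin z X /\ jac n P Q X.1 X.2 = 0.
  move=> z; have [zs|zs] := boolP (z \in s); last by exists (0, 0).
  have [z1 z1s zz1] : exists2 z1, z1 \in s & z != z1.
    case: s us s2 zs {Hs} => [|a [|b t]] //= /andP[/negP ab _] _ _.
    have [->|za] := eqVneq z a; last by exists a; rewrite ?mem_head.
    exists b; first by rewrite !inE eqxx orbT.
    by apply/eqP => E; apply: ab; rewrite E mem_head.
  have [fz lz] := Hs z zs; have [fz1 lz1] := Hs z1 z1s.
  have [X HX] := critical_in_basin fz (elimN eqP zz1) (nonrepelling_discs fz lz) (nonrepelling_discs fz1 lz1).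
  by exists X.
pose aff := [seq z <- s | (F z).2 != 0]; pose inf := [seq z <- s | (F z).2 == 0].
have sizeE : size s = (size aff + size inf)%N.
  by rewrite !size_filter addnC count_predC.
have [ksize k10] := coef_kap.
have inf1 : (size inf <= 1)%N.
  rewrite leqNgt; apply/negP => i2.
  have [a [b [ai bi ab]]] : exists a b, [/\ a \in inf, b \in inf & a != b].
    have : uniq inf by rewrite filter_uniq.
    case: (inf) i2 => [|a [|b t]] //= _; rewrite inE negb_or => /andP[/andP[ab _] _].
    by exists a, b; rewrite !inE !eqxx orbT.
  move: ai bi; rewrite !mem_filter => /andP[/eqP a2 /HF[Ba _]] /andP[/eqP b2 /HF[Bb _]].
  by move/eqP: ab; apply; apply: (basin_proj Ba Bb); rewrite a2 b2 mul0r mulr0.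
have roots : (size aff < size kap)%N.
  have -> : size aff = size [seq (F z).1 / (F z).2 | z <- aff] by rewrite size_map.
  apply: max_poly_roots; first exact: kap_neq0.
    apply/allP => _ /mapP[z + ->]; rewrite mem_filter => /andP[z2 /HF[_ Jz]].
    rewrite /root kapE; have := jac_scale n P Q (F z).2 ((F z).1 / (F z).2) 1.
    rewrite mulrCA divff // !mulr1 Jz mulr0 => /esym/eqP.
    by rewrite mulf_eq0 expf_eq0 (negPf z2) andbF.
  rewrite map_inj_in_uniq ?filter_uniq // => a b; rewrite !mem_filter.
  move=> /andP[a2 /HF[Ba _]] /andP[b2 /HF[Bb _]] E; apply: (basin_proj Ba Bb).
  have -> : (F a).1 = (F b).1 / (F b).2 * (F a).2 by rewrite -E divfK.
  by field.
have [i0|i0] := eqVneq (size inf) 0%N; first by rewrite sizeE i0; move: roots ksize; lia.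
have [z zi] : exists z, z \in inf by case: (inf) i0 => // a t _; exists a; rewrite mem_head.
(* A critical point at infinity lowers the degree of [kap], hence the number of affine ones, by at
   least one. *)
have J10 : kap`_(n + n - 2) = 0.
  rewrite -k10; move: zi; rewrite mem_filter => /andP[/eqP z2 /HF[[z0 _] Jz]].
  have z1 : (F z).1 != 0.
    by apply: contraNneq z0; case: (F z) z2 => x y /= -> ->.
  have := jac_scale n P Q (F z).1 1 0; rewrite mulr1 mulr0 -z2 Jz mulr0 z2 => /esym/eqP.
  by rewrite mulf_eq0 expf_eq0 (negPf z1) andbF => /eqP.
have : (size kap <= n + n - 2)%N.
  rewrite leqNgt; apply/negP => sk; have sE : (size kap).-1 = (n + n - 2)%N by move: sk ksize; lia.
  by move/eqP: J10; rewrite -sE -lead_coefE lead_coef_eq0 (negPf kap_neq0).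
by rewrite sizeE; move: inf1 roots; lia.
Qed.

Lemma fixpt_root z : fixpt z -> root (secA - 'X * secB) z.
Proof.
move=> fz; have [B0 [ffz _]] := ratf'_fixpt fz; rewrite /root !hornerE subr_eq0.
by rewrite -{2}ffz /ratf divfK.
Qed.

End Fatou.

(** * Second-order expansion of the landscape function *)

Section Expansions.
Variable R : realType.
Local Notation C := (cplane R).
Implicit Types (z w : C) (f : R -> R) (F : C -> R).

Lemma real_derive_eps f (t d : R) :
  (forall e, 0 < e -> exists2 del, 0 < del & forall s, `|s| < del ->
     `|f (t + s) - f t - d * s| <= e * `|s|) -> is_derive t (1 : R) f d.
Proof.
move=> H.
have L : h^-1 *: (f (h *: (1 : R) + t) - f t) @[h --> 0^'] --> d.
  apply/cvgrPdist_le => e e0; have [del del0 Hd] := H e e0.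
  near=> s.
  have s0 : s != 0 by near: s; exact: nbhs_dnbhs_neq.
  have sd : `|s| < del.
    near: s; apply: (@nbhs_dnbhs _ (0 : R)); apply/nbhs_ballP; exists del => //= s.
    by rewrite -ball_normE /= sub0r normrN.
  have := Hd s sd; rewrite -ler_pdivrMr ?normr_gt0 // -normfV -normrM.
  rewrite distrC /GRing.scale /= mulr1 [s + t]addrC.
  by apply: le_trans; rewrite le_eqVlt; apply/orP; left; apply/eqP; congr `|_|; field.
split; first by apply/cvg_ex; exists d.
exact: cvg_lim L.
Unshelve. all: by end_near.
Qed.

Lemma derive_real_eps f (t d : R) : is_derive t (1 : R) f d ->
  forall e, 0 < e -> exists2 del, 0 < del & forall s, `|s| < del ->
     `|f (t + s) - f t - d * s| <= e * `|s|.
Proof.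
move=> [df <-] e e0.
have : h^-1 *: (f (h *: (1 : R) + t) - f t) @[h --> 0^'] --> 'D_1 f t by exact: df.
move=> /cvgrPdist_le /(_ e e0) /nbhs_ballP[del /= del0 Hd].
exists del => // s sd; have [->|s0] := eqVneq s 0.
  by rewrite addr0 subrr mulr0 subr0 normr0 mulr0.
have := Hd s; rewrite -ball_normE /= sub0r normrN => /(_ sd s0).
rewrite distrC /GRing.scale /= mulr1 [s + t]addrC => HH.
rewrite -ler_pdivrMr ?normr_gt0 // -normfV -normrM.
by apply: le_trans HH; rewrite le_eqVlt; apply/orP; left; apply/eqP; congr `|_|; field.
Qed.

Lemma complex_derive_eps (g : C -> C) z (d : C) : is_derive z (1 : C) g d ->
  forall e : R, 0 < e -> exists2 del : R, 0 < del & forall h : C, modulus h < del ->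
     modulus (g (z + h) - g z - d * h) <= e * modulus h.
Proof.
move=> [df <-] e e0.
have L : h^-1 *: (g (h *: (1 : C) + z) - g z) @[h --> (0 : C)^'] --> 'D_1 g z by exact: df.
have : nbhs (0 : C)^' (fun h => modulus (h^-1 *: (g (h *: (1 : C) + z) - g z) - 'D_1 g z) < e).
  by apply: (L (fun y => modulus (y - 'D_1 g z) < e)); apply/nbhsP; exists e.
move=> /nbhsP[del del0 Hd].
exists del => // h hd; have [->|h0] := eqVneq h 0.
  by rewrite addr0 subrr mulr0 subr0 modulus0 mulr0.
have := Hd h; rewrite subr0 => /(_ hd h0) /ltW.
rewrite /GRing.scale /= mulr1 [h + z]addrC => HH.
rewrite -ler_pdivrMr ?ltr_modulus_gt0 // -modulusV -modulusM.
by apply: le_trans HH; rewrite le_eqVlt; apply/orP; left; apply/eqP; congr modulus; field.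
Qed.

Lemma is_derive_continuous f (t d : R) : is_derive t (1 : R) f d -> {for t, continuous f}.
Proof. by move=> df; apply: differentiable_continuous; apply/derivable1_diffP; case: df. Qed.

Lemma mean_value f f' (a b : R) : a < b ->
  (forall t, a <= t <= b -> is_derive t (1 : R) f (f' t)) ->
  exists2 c, a < c < b & f b - f a = f' c * (b - a).
Proof.
move=> ab df; have [||c cab E] := @MVT R f f' a b ab.
- by move=> t; rewrite in_itv /= => /andP[at_ tb]; apply: df; rewrite !ltW.
- apply: continuous_in_subspaceT => t; rewrite inE /= in_itv /= => tab.
  exact: is_derive_continuous (df t tab).
by exists c => //; move: cab; rewrite in_itv.
Qed.

Lemma second_derivative_max f f' (c del : R) : 0 < del ->
  (forall t, `|t| < del -> is_derive t (1 : R) f (f' t)) ->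
  is_derive (0 : R) (1 : R) f' c -> 0 < c ->
  (forall t, `|t| < del -> f t <= f 0) -> False.
Proof.
move=> del0 df df' c0 fmax.
have f'0 : f' 0 = 0.
  apply/eqP/negPn/negP => f'0.
  have e0 : 0 < `|f' 0| / 2 by rewrite divr_gt0 // normr_gt0.
  have d00 : is_derive (0 : R) (1 : R) f (f' 0) by apply: df; rewrite normr0.
  have [d d0 Hd] := derive_real_eps d00 e0.
  pose s := Num.sg (f' 0) * (Num.min d del / 2).
  have m0 : 0 < Num.min d del by rewrite lt_min d0.
  have sE : `|s| = Num.min d del / 2.
    by rewrite normrM normr_sg f'0 mul1r ger0_norm // divr_ge0 // ltW.
  have sm : `|s| < Num.min d del by rewrite sE ltr_pdivrMr // mulrDr mulr1 ltrDl.
  move: (sm); rewrite lt_min => /andP[sd sdel].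
  have := Hd s sd; have := fmax s sdel; rewrite add0r => F1.
  rewrite ler_norml => /andP[F2 _].
  have F3 : f' 0 * s = `|f' 0| * `|s|.
    by rewrite sE /s mulrA [f' 0 * _]mulrC -normrEsg.
  have : 0 < `|f' 0| * `|s| by rewrite mulr_gt0 ?normr_gt0 // -normr_gt0 sE divr_gt0.
  by move: F2; rewrite F3; lra.
have c20 : 0 < c / 2 by rewrite divr_gt0.
have [d d0 Hd] := derive_real_eps df' c20.
pose t := Num.min d del / 2.
have m0 : 0 < Num.min d del by rewrite lt_min d0.
have t0 : 0 < t by rewrite divr_gt0.
have tm : t < Num.min d del by rewrite ltr_pdivrMr // mulrDr mulr1 ltrDl.
move: (tm); rewrite lt_min => /andP[td tdel].
have [s|s /andP[s0 st] E] := @mean_value f f' 0 t t0.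
  by move=> /andP[s0 st]; apply: df; rewrite ger0_norm //; exact: le_lt_trans tdel.
have := fmax t; rewrite gtr0_norm // => /(_ tdel).
have sd : `|s| < d by rewrite gtr0_norm //; exact: lt_trans td.
have := Hd s sd; rewrite add0r f'0 subr0 [`|s|]gtr0_norm // ler_norml => /andP[F _].
have f's : 0 < f' s by have := mulr_gt0 c0 s0; lra.
have := mulr_gt0 f's t0; move: E; rewrite subr0; lra.
Qed.

Definition expansion1 F z (a : C) := forall e : R, 0 < e -> exists2 d : R, 0 < d &
  forall w : C, modulus w < d -> `|F (z + w) - F z - complex.Re (a * w)| <= e * modulus w.

(** Taylor expansion in complex notation: the gradient is the conjugate of [a], and the quadratic
    part has Laplacian [- 2 c]. So [c = 0] for the harmonic [u] and [c = 1] for [v]. *)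
Definition expansion2 F z (a b : C) (c : R) := forall e : R, 0 < e -> exists2 d : R, 0 < d &
  forall w : C, modulus w < d ->
   `|F (z + w) - F z - complex.Re (a * w) - (complex.Re (b * w ^+ 2) - c * modulus w ^+ 2) / 2|
   <= e * modulus w ^+ 2.

Lemma expansion1_partial F z a : expansion1 F z a ->
  is_derive (0 : R) (1 : R) (hslice F z) (complex.Re a) /\
  is_derive (0 : R) (1 : R) (vslice F z) (- complex.Im a).
Proof.
move=> H; split; apply: real_derive_eps => e e0; have [d d0 Hd] := H e e0;
  exists d => // s sd.
  have ms : modulus ((s +i* 0) : C) = `|s| by exact: modulus_real.
  have := Hd (s +i* 0); rewrite ms => /(_ sd).
  rewrite /hslice add0r; have -> : (z + (0 +i* 0)) = z by rewrite [(0 +i* 0)](_ : _ = 0) ?addr0.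
  by have -> : complex.Re (a * (s +i* 0)) = complex.Re a * s by case: (a) => x y /=; rewrite mulr0 subr0.
have ms : modulus ((0 +i* s) : C) = `|s| by rewrite /modulus /= expr0n /= add0r sqrtr_sqr.
have := Hd (0 +i* s); rewrite ms => /(_ sd).
rewrite /vslice add0r; have -> : (z + (0 +i* 0)) = z by rewrite [(0 +i* 0)](_ : _ = 0) ?addr0.
by have -> : complex.Re (a * (0 +i* s)) = - complex.Im a * s by case: (a) => x y /=; ring.
Qed.

Lemma expansion1_grad F z a : expansion1 F z a ->
  partial_x F z = complex.Re a /\ partial_y F z = - complex.Im a.
Proof.
move=> /expansion1_partial[H1 H2]; rewrite /partial_x /partial_y !derive1E.
by split; apply: derive_val.
Qed.

Lemma expansion21 F z a b c : expansion2 F z a b c -> expansion1 F z a.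
Proof.
move=> H e e0; have [d d0 Hd] := H 1 ltr01.
pose K := modulus b + `|c| + 2; have K0 : 0 < K.
  by rewrite /K ltr_wpDl // addr_ge0 ?modulus_ge0.
exists (Num.min d (e / K)); first by rewrite lt_min d0 divr_gt0.
move=> w; rewrite lt_min ltr_pdivlMr // => /andP[/Hd wd wK].
have m0 := modulus_ge0 w.
have B1 : `|complex.Re (b * w ^+ 2)| <= modulus b * modulus w ^+ 2.
  by apply: le_trans (ler_Re_modulus _) _; rewrite modulusM modulusX.
have B2 : `|c * modulus w ^+ 2| <= `|c| * modulus w ^+ 2.
  by rewrite normrM [X in _ * X]ger0_norm ?sqr_ge0.
have : K * modulus w ^+ 2 <= e * modulus w by rewrite expr2 mulrA ler_wpM2r // mulrC ltW.
move: wd B1 B2; rewrite !ler_norml /K mul1r !mulrDl.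
set x1 := complex.Re (a * w); set x2 := complex.Re _; set x3 := c * _; set x4 := modulus b * _.
set x5 := `|c| * _; set m2 := modulus w ^+ 2; set m := e * modulus w.
have : 0 <= x4 by rewrite mulr_ge0 ?modulus_ge0 ?sqr_ge0.
have : 0 <= x5 by rewrite mulr_ge0 ?sqr_ge0.
move=> ? ? /andP[? ?] /andP[? ?] /andP[? ?] ?; apply/andP; split; lra.
Qed.

Lemma expansion1_continuous F z a : expansion1 F z a -> {for z, continuous F}.
Proof.
move=> H; apply/continuousP_eps => e e0; have [d d0 Hd] := H 1 ltr01.
pose K := modulus a + 1; have K0 : 0 < K by rewrite /K ltr_wpDl // modulus_ge0.
exists (Num.min d (e / K)); first by rewrite lt_min d0 divr_gt0.
move=> w; rewrite lt_min ltr_pdivlMr // => /andP[/Hd wd wK].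
move: wd; rewrite subrKC mul1r => wd.
rewrite -[_ - _](subrK (complex.Re (a * (w - z)))); apply: le_lt_trans (ler_normD _ _) _.
apply: le_lt_trans (lerD wd (ler_Re_modulus _)) _; rewrite modulusM.
by move: wK; rewrite /K mulrDr mulr1 mulrC [modulus a * _]mulrC addrC.
Qed.

Definition cexpansion (r : C -> C) z (r1 : C) := forall e : R, 0 < e -> exists2 d : R, 0 < d &
  forall w : C, modulus w < d -> modulus (r (z + w) - r z - r1 * w) <= e * modulus w.

Lemma cexpansion_Re (r : C -> C) z r1 : cexpansion r z r1 ->
  expansion1 (fun w => complex.Re (r w)) z r1.
Proof.
move=> H e e0; have [d d0 Hd] := H e e0; exists d => // w /Hd; apply: le_trans.
by rewrite -!raddfB /=; exact: ler_Re_modulus.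
Qed.

Lemma cexpansion_Im (r : C -> C) z r1 : cexpansion r z r1 ->
  expansion1 (fun w => - complex.Im (r w)) z ('i * r1).
Proof.
move=> H e e0; have [d d0 Hd] := H e e0; exists d => // w /Hd; apply: le_trans.
have -> : - complex.Im (r (z + w)) - - complex.Im (r z) - complex.Re ('i * r1 * w) =
   - complex.Im (r (z + w) - r z - r1 * w).
  rewrite -mulrA !raddfB /=; case: (r1 * w) => a b /=; ring.
by rewrite normrN; exact: ler_Im_modulus.
Qed.

Lemma ratfun_expansion (P Q : {poly R[i]}) (z : C) : ~~ root Q z ->
  cexpansion (ratfun P Q) z (ratf' P Q z).
Proof.
move=> Qz e e0; have [d d0 Hd] := ratf_derivative P Qz e0.
exists d => // w wd; have := Hd (z + w); rewrite [z + w]addrC addrK => /(_ (ltW wd))[_].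
by [].
Qed.

Lemma line_derive (g r : C -> C) (u : C -> R) z (w : C) (del t : R) :
  (forall p : C, modulus (p - z) < del -> is_derive p (1 : C) g (r p) /\ u p = complex.Re (g p)) ->
  modulus w < del -> 0 <= t <= 1 ->
  is_derive t (1 : R) (fun s => u (z + s%:C * w)) (complex.Re (r (z + t%:C * w) * w)).
Proof.
move=> H wdel /andP[t0 t1]; apply: real_derive_eps => e e0.
have near_seg s : `|s| <= 1 + (del - modulus w) / (modulus w + 1) * 1 / 2 ->
    modulus (z + s%:C * w - z) < del.
  have k0 : 0 < modulus w + 1 by rewrite ltr_wpDl ?modulus_ge0.
  rewrite [z + _]addrC addrK modulusM modulus_real => sb.
  apply: le_lt_trans (_ : (1 + (del - modulus w) / (modulus w + 1) * 1 / 2) * modulus w < _).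
    by rewrite ler_wpM2r ?modulus_ge0.
  have m0 := modulus_ge0 w.
  have : (del - modulus w) / (modulus w + 1) * modulus w < del - modulus w.
    by rewrite mulrAC ltr_pdivrMr // ltr_pM2l ?subr_gt0 // ltrDl.
  have : 0 <= (del - modulus w) / (modulus w + 1) * modulus w.
    by rewrite mulr_ge0 // divr_ge0 // ltW // subr_gt0.
  set x := _ / _; lra.
(* Room beyond [[0, 1]], since two-sided derivatives are needed at the ends:
   [(1 + eta) |w| < del]. *)
pose eta := (del - modulus w) / (modulus w + 1) * 1 / 2.
have k0 : 0 < modulus w + 1 by rewrite ltr_wpDl ?modulus_ge0.
have eta0 : 0 < eta by rewrite /eta !mulr_gt0 ?subr_gt0 ?invr_gt0.
have tt : `|t| <= 1 + eta by rewrite ger0_norm //; lra.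
have [dg ut] := H _ (near_seg t tt).
have [d d0 Hd] := complex_derive_eps dg (divr_gt0 e0 k0).
exists (Num.min eta (d / (modulus w + 1))); first by rewrite lt_min eta0 divr_gt0.
move=> s; rewrite lt_min (ltr_pdivlMr _ _ k0) => /andP[se sd].
have [_ uts] : is_derive (z + (t + s)%:C * w) (1 : C) g (r (z + (t + s)%:C * w)) /\
    u (z + (t + s)%:C * w) = complex.Re (g (z + (t + s)%:C * w)).
  apply: H; apply: near_seg; apply: le_trans (ler_normD _ _) _.
  rewrite (ger0_norm t0); by apply: lerD; [exact: t1 | exact: (ltW se)].
rewrite uts ut; have swd : modulus (s%:C * w) < d.
  rewrite modulusM modulus_real; apply: le_lt_trans sd.
  by rewrite ler_wpM2l // lerDl.
have := Hd _ swd; have -> : z + t%:C * w + s%:C * w = z + (t + s)%:C * w by rewrite rmorphD; ring.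
set p := z + t%:C * w; set p' := z + _ => HH.
have -> : complex.Re (g p') - complex.Re (g p) - complex.Re (r p * w) * s =
   complex.Re (g p' - g p - r p * (s%:C * w)).
  rewrite !raddfB /= mulrCA; congr (_ - _).
  by case: (r p * w) => a b /=; rewrite mul0r subr0 mulrC.
apply: le_trans (ler_Re_modulus _) (le_trans HH _).
rewrite modulusM modulus_real mulrCA mulrC ler_wpM2r //.
by rewrite mulrAC ler_pdivrMr // ler_pM2l // lerDl.
Qed.

(** The mean value theorem, applied along the segment to [u] minus the expected quadratic
    polynomial, gains one order over the first-order expansion of [r]. *)
Lemma Re_primitive_expansion (D : set C) (r : C -> C) (u : C -> R) z r1 :
  Re_primitive D r u -> D z -> cexpansion r z r1 -> expansion2 u z (r z) r1 0.
Proof.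
move=> Hprim Dz Hr e e0; have [g /nbhsP[del del0 Hg]] := Hprim z Dz.
have [d d0 Hd] := Hr e e0; exists (Num.min del d); first by rewrite lt_min del0.
move=> w; rewrite lt_min => /andP[wdel wd].
pose q : {poly R} := complex.Re (r z * w) *: 'X + (complex.Re (r1 * w ^+ 2) / 2) *: 'X^2.
have dF (t : R) : 0 <= t <= 1 -> is_derive t (1 : R) ((fun s => u (z + s%:C * w)) - horner q)
     (complex.Re (r (z + t%:C * w) * w) - q^`().[t]).
  by move=> t01; apply: is_deriveB; exact: line_derive Hg wdel t01.
have [c /andP[c0 c1]] := mean_value ltr01 dF.
rewrite subr0 mulr1 !fctE /= rmorph1 rmorph0 mul1r mul0r addr0.
have q1 : q.[1] = complex.Re (r z * w) + complex.Re (r1 * w ^+ 2) / 2.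
  by rewrite /q !(hornerD, hornerZ, hornerXn, hornerX) expr1n !mulr1.
have q0 : q.[0] = 0 by rewrite /q !(hornerD, hornerZ, hornerXn, hornerX) expr0n !mulr0 addr0.
have q'c : q^`().[c] = complex.Re (r z * w) + complex.Re (r1 * w ^+ 2) * c.
  by rewrite /q derivD !derivZ derivX derivXn;
    rewrite !(hornerD, hornerZ, hornerXn, hornerX, hornerC, hornerMn) expr1 mulr1 mulr2n; field.
rewrite q1 q0 subr0 q'c mul0r subr0 => E.
have -> : u (z + w) - u z - complex.Re (r z * w) - complex.Re (r1 * w ^+ 2) / 2 =
   complex.Re (r (z + c%:C * w) * w) - (complex.Re (r z * w) + complex.Re (r1 * w ^+ 2) * c).
  by rewrite -E; ring.
have cwd : modulus (c%:C * w) <= modulus w.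
  by rewrite modulusM modulus_real gtr0_norm // ler_piMl ?modulus_ge0 // ltW.
have -> : complex.Re (r (z + c%:C * w) * w) - (complex.Re (r z * w) + complex.Re (r1 * w ^+ 2) * c) =
   complex.Re ((r (z + c%:C * w) - r z - r1 * (c%:C * w)) * w).
  have -> : (r (z + c%:C * w) - r z - r1 * (c%:C * w)) * w =
    r (z + c%:C * w) * w - r z * w - r1 * w ^+ 2 * c%:C by ring.
  rewrite !raddfB /= opprD addrA; congr (_ - _).
  by case: (r1 * w ^+ 2) => a b /=; rewrite mulr0 subr0.
apply: le_trans (ler_Re_modulus _) _; rewrite modulusM expr2 mulrA ler_wpM2r ?modulus_ge0 //.
apply: le_trans (Hd _ _) _; first exact: le_lt_trans wd.
by rewrite ler_wpM2l // ltW.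
Qed.

End Expansions.

(** * Maximum principle and identification of the landscape function *)

Section MaxPrinciple.
Variable R : realType.
Local Notation C := (cplane R).
Implicit Types (z w : C) (F G : C -> R) (Omega D : set C).

Lemma hslice_shift F z (t d : R) :
  is_derive (0 : R) (1 : R) (hslice F (z + (t +i* 0))) d -> is_derive t (1 : R) (hslice F z) d.
Proof.
move=> H; apply: real_derive_eps => e e0; have [del del0 Hd] := derive_real_eps H e0.
exists del => // s /Hd; rewrite add0r /hslice.
have E x : z + (t +i* 0) + (x +i* 0) = z + ((t + x) +i* 0).
  by rewrite -addrA; congr (_ + _); apply/eqP; rewrite eq_complex /= addr0 !eqxx.
by rewrite !E addr0.
Qed.

Lemma vslice_shift F z (t d : R) :
  is_derive (0 : R) (1 : R) (vslice F (z + (0 +i* t))) d -> is_derive t (1 : R) (vslice F z) d.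
Proof.
move=> H; apply: real_derive_eps => e e0; have [del del0 Hd] := derive_real_eps H e0.
exists del => // s /Hd; rewrite add0r /vslice.
have E x : z + (0 +i* t) + (0 +i* x) = z + (0 +i* (t + x)).
  by rewrite -addrA; congr (_ + _); apply/eqP; rewrite eq_complex /= addr0 !eqxx.
by rewrite !E addr0.
Qed.

(** A pointwise notion weaker than class C^2, shared by [v] and by real parts of primitives, and
    stable under sums: first partials on [Omega], pure second partials at [z] only. *)
Definition laplacian_at Omega F z (c : R) := exists (Fx Fy : C -> R) (c1 c2 : R),
  [/\ forall w, Omega w -> is_derive (0 : R) (1 : R) (hslice F w) (Fx w) /\
        is_derive (0 : R) (1 : R) (vslice F w) (Fy w),
      is_derive (0 : R) (1 : R) (hslice Fx z) c1,
      is_derive (0 : R) (1 : R) (vslice Fy z) c2 & c = c1 + c2].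

Lemma laplacian_atD Omega F G z c d : laplacian_at Omega F z c ->
  laplacian_at Omega G z d -> laplacian_at Omega (fun w => F w + G w) z (c + d).
Proof.
move=> [Fx [Fy [c1 [c2 [F1 F2 F3 ->]]]]] [Gx [Gy [d1 [d2 [G1 G2 G3 ->]]]]].
exists (fun w => Fx w + Gx w), (fun w => Fy w + Gy w), (c1 + d1), (c2 + d2).
split; last by ring.
- move=> w Ow; have [A1 A2] := F1 w Ow; have [B1 B2] := G1 w Ow.
  by split; [exact: (is_deriveD A1 B1) | exact: (is_deriveD A2 B2)].
- exact: (is_deriveD F2 G2).
- exact: (is_deriveD F3 G3).
Qed.

Lemma laplacian_atN Omega F z c : laplacian_at Omega F z c ->
  laplacian_at Omega (fun w => - F w) z (- c).
Proof.
move=> [Fx [Fy [c1 [c2 [F1 F2 F3 ->]]]]].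
exists (fun w => - Fx w), (fun w => - Fy w), (- c1), (- c2).
split; last by ring.
- move=> w Ow; have [A1 A2] := F1 w Ow.
  by split; [exact: (is_deriveN A1) | exact: (is_deriveN A2)].
- exact: (is_deriveN F2).
- exact: (is_deriveN F3).
Qed.

Lemma laplacian_at_max Omega F z c : open Omega -> Omega z -> laplacian_at Omega F z c ->
  0 < c -> (forall w, Omega w -> F w <= F z) -> False.
Proof.
move=> /openP oO Oz [Fx [Fy [c1 [c2 [F1 F2 F3 ->]]]]] c0 Fmax.
have [d d0 Hd] := oO z Oz.
have E0 : z + (0 +i* 0) = z by rewrite [(0 +i* 0)](_ : _ = 0) ?addr0.
have Oh t : `|t| < d -> Omega (z + (t +i* 0)).
  by move=> td; apply: Hd; rewrite [z + _]addrC addrK -[modulus _]/(modulus (t%:C)) modulus_real.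
have Ov t : `|t| < d -> Omega (z + (0 +i* t)).
  move=> td; apply: Hd; rewrite [z + _]addrC addrK.
  by rewrite /modulus /= expr0n /= add0r sqrtr_sqr.
have [c1p|c1n] := ltP 0 c1.
  apply: (@second_derivative_max _ (hslice F z) (hslice Fx z) c1 d) => //.
    by move=> t /Oh Ot; apply: hslice_shift; case: (F1 _ Ot).
  by move=> t /Oh Ot; rewrite {2}/hslice E0; exact: Fmax.
have c2p : 0 < c2 by move: c0 c1n; lra.
apply: (@second_derivative_max _ (vslice F z) (vslice Fy z) c2 d) => //.
  by move=> t /Ov Ot; apply: vslice_shift; case: (F1 _ Ot).
by move=> t /Ov Ot; rewrite {2}/vslice E0; exact: Fmax.
Qed.

Lemma bounded_modulus Omega : bounded_set Omega ->
  exists2 M : R, 0 <= M & forall z, closure Omega z -> modulus z <= M.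
Proof.
move=> [M [Mr HM]].
have [m Em] : exists m : R, M = m%:C by exists (complex.Re M); rewrite RRe_real.
have bO z : Omega z -> modulus z <= `|m| + 1.
  move=> Oz; have Mm : M < (`|m| + 1)%:C.
    by rewrite Em ltcR (le_lt_trans (ler_norm m)) // ltrDl.
  by have := HM _ Mm z Oz; rewrite -lecR.
exists (`|m| + 2) => [|z /closureP /(_ 1 ltr01)[w /bO wb wz]].
  by rewrite addr_ge0.
rewrite -(subrK w z); apply: le_trans (modulusD _ _) _.
by rewrite modulusC; lra.
Qed.

Lemma closure_boundary Omega z : open Omega -> closure Omega z -> ~ Omega z -> boundary Omega z.
Proof. by move=> oO cz nz; split=> //; move/interior_id: oO => ->. Qed.

Lemma sqr_modulusD z w : modulus (z + w) ^+ 2 =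
  modulus z ^+ 2 + complex.Re (2 * conjc z * w) + modulus w ^+ 2.
Proof.
rewrite !modulus_sqr -mulrA mulr_natl; case: z w => a b [c d] /=; rewrite ?mulr2n /=; ring.
Qed.

Lemma expansion1_sqr z (e : R) :
  expansion1 (fun w => e * modulus w ^+ 2) z (e%:C * (2 * conjc z)).
Proof.
move=> eps eps0; pose K := `|e| + 1; have K0 : 0 < K by rewrite ltr_wpDl.
  exists (eps / K); first by rewrite divr_gt0.
  move=> h; rewrite ltr_pdivlMr // => hK; rewrite sqr_modulusD.
  have -> : complex.Re (e%:C * (2 * conjc z) * h) = e * complex.Re (2 * conjc z * h).
    by rewrite -mulrA; case: (2 * conjc z * h) => a b /=; rewrite mul0r subr0.
  rewrite (_ : _ - _ - _ = e * modulus h ^+ 2); last by ring.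
  rewrite normrM [X in _ * X]ger0_norm ?sqr_ge0 // expr2 mulrA ler_wpM2r ?modulus_ge0 //.
  by apply: le_trans (ltW hK); rewrite mulrC ler_wpM2l ?modulus_ge0 // lerDl.
Qed.

Lemma laplacian_at_sqr Omega z (e : R) :
  laplacian_at Omega (fun w => e * modulus w ^+ 2) z (4 * e).
Proof.
exists (fun w => 2 * e * complex.Re w), (fun w => 2 * e * complex.Im w), (2 * e), (2 * e).
split; last by ring.
- move=> w _; have [] := expansion1_partial (expansion1_sqr w e).
  have -> : complex.Re (e%:C * (2 * conjc w)) = 2 * e * complex.Re w.
    by rewrite mulr_natl mulr2n; case: w => a b /=; ring.
  have -> : - complex.Im (e%:C * (2 * conjc w)) = 2 * e * complex.Im w.
    by rewrite mulr_natl mulr2n; case: w => a b /=; ring.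
  by [].
- apply: real_derive_eps => eps eps0; exists 1 => // s _; rewrite /hslice add0r.
  have -> : 2 * e * complex.Re (z + (s +i* 0)) - 2 * e * complex.Re (z + (0 +i* 0)) - 2 * e * s = 0.
    by rewrite !(raddfD (@complex.Re R)) /=; ring.
  by rewrite normr0 mulr_ge0 // ltW.
- apply: real_derive_eps => eps eps0; exists 1 => // s _; rewrite /vslice add0r.
  have -> : 2 * e * complex.Im (z + (0 +i* s)) - 2 * e * complex.Im (z + (0 +i* 0)) - 2 * e * s = 0.
    by rewrite !(raddfD (@complex.Im R)) /=; ring.
  by rewrite normr0 mulr_ge0 // ltW.
Qed.

Lemma max_principle Omega F : domain Omega -> {within closure Omega, continuous F} ->
  (forall z, boundary Omega z -> F z <= 0) ->
  (forall z, Omega z -> laplacian_at Omega F z 0) -> forall z, Omega z -> F z <= 0.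
Proof.
move=> [_ oO _ bO] cF Fb HF z Oz; rewrite leNgt; apply/negP => Fz.
have [M M0 HM] := bounded_modulus bO.
have K0 : 0 < 2 * (M ^+ 2 + 1) by rewrite mulr_gt0 // ltr_wpDl // sqr_ge0.
(* Chosen so that [e (M^2 + 1) = F z / 2]: the perturbation [e |w|^2], which makes the Laplacian
   positive, stays below [F z] on the boundary. *)
pose e := F z / (2 * (M ^+ 2 + 1)); have e0 : 0 < e by rewrite divr_gt0.
have cl : compact (closure Omega).
  by apply: (bounded_closed_compactC (M := M)); [exact: closed_closure | exact: HM].
have cG : {within closure Omega, continuous (fun w => F w + e * modulus w ^+ 2)}.
  have cs : {within closure Omega, continuous (fun w : C => e * modulus w ^+ 2)}.
    apply: continuous_subspaceT => w.
    exact: (expansion1_continuous (expansion1_sqr w e)).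
  by move=> w; apply: cvgD; [exact: cF | exact: cs].
have [|w wcl wmax] := compact_EVT_max _ cl cG.
  by exists z; exact: subset_closure.
rewrite inE in wcl.
have Gz : F z <= F w + e * modulus w ^+ 2.
  apply: le_trans (wmax z _); last by rewrite inE; exact: subset_closure.
  by rewrite lerDl mulr_ge0 ?sqr_ge0 // ltW.
have [Ow|nOw] := pselect (Omega w).
  have L := laplacian_atD (HF w Ow) (laplacian_at_sqr Omega w e).
  apply: (laplacian_at_max oO Ow L); first by rewrite add0r mulr_gt0.
  by move=> x Ox; apply: wmax; rewrite inE; exact: subset_closure.
have Fw := Fb w (closure_boundary oO wcl nOw).
have : e * modulus w ^+ 2 <= e * M ^+ 2.
  by rewrite ler_pM2l // ler_pXn2r ?nnegrE ?modulus_ge0 // HM.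
have E : e * M ^+ 2 + e = F z / 2 by rewrite /e; field; rewrite gt_eqF // ltr_wpDl // sqr_ge0.
by move=> ?; lra.
Qed.

Lemma laplacian_at_C2 Omega F z : Cn 2 Omega F -> Omega z -> laplacian_at Omega F z (laplacian F z).
Proof.
move=> [_ [Fx Fy [_ [Fxx _ _ _]] [_ [_ Fyy _ _]]]] Oz.
have D (f : R -> R) : derivable f 0 1 -> is_derive (0 : R) (1 : R) f (derive1 f 0).
  by move=> df; rewrite derive1E; exact: DeriveDef.
exists (partial_x F), (partial_y F), (partial_x (partial_x F) z), (partial_y (partial_y F) z).
split=> //.
- by move=> w Ow; split; apply: D; [exact: Fx | exact: Fy].
- by apply: D; exact: Fxx.
- by apply: D; exact: Fyy.
Qed.

Lemma Re_primitive_laplacian Omega D (P Q : {poly R[i]}) (u : C -> R) z :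
  Omega `<=` D -> (forall z, D z -> ~~ root Q z) -> Re_primitive D (ratfun P Q) u ->
  Omega z -> laplacian_at Omega u z 0.
Proof.
move=> OD Qz Hu Oz.
have rz w : Omega w -> cexpansion (ratfun P Q) w (ratf' P Q w).
  by move=> Ow; apply: ratfun_expansion; exact/Qz/OD.
exists (fun w => complex.Re (ratfun P Q w)), (fun w => - complex.Im (ratfun P Q w)),
  (complex.Re (ratf' P Q z)), (- complex.Re (ratf' P Q z)); split; last by rewrite subrr.
- move=> w Ow; apply: expansion1_partial.
  by apply: expansion21; exact: (Re_primitive_expansion Hu (OD w Ow) (rz w Ow)).
- by case: (expansion1_partial (cexpansion_Re (rz z Oz))).
- have [_] := expansion1_partial (cexpansion_Im (rz z Oz)).
  by rewrite (_ : complex.Im ('i * _) = complex.Re (ratf' P Q z)) //; case: (ratf' P Q z) => a b /=; ring.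
Qed.

(** The difference of the two sides is 0 on the boundary, and the Laplacians -2, 0 and 2 of its
    three terms add up to 0; the maximum principle applies to it and to its opposite. *)
Lemma landscape_eq Omega D (P Q : {poly R[i]}) (u v : C -> R) :
  RL_domain Omega D P Q u -> landscape Omega v ->
  forall z, Omega z -> v z = u z - modulus z ^+ 2 / 2.
Proof.
move=> [dO _ [oD cOD QD] Hu bO] [v2 vlap vc vb] z Oz.
have [_ oO _ _] := dO.
have OD : Omega `<=` D by apply: subset_trans cOD; exact: subset_closure.
pose F w := v w + (- u w + 1 / 2 * modulus w ^+ 2).
have F0 w : boundary Omega w -> F w = 0.
  by move=> bw; rewrite /F vb // (bO w bw); field.
have cF : {within closure Omega, continuous F}.
  have cu : {within closure Omega, continuous (fun w => - u w + 1 / 2 * modulus w ^+ 2)}.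
    apply: continuous_in_subspaceT => w; rewrite inE => /cOD Dw.
    have H := Re_primitive_expansion Hu Dw (ratfun_expansion P (QD w Dw)).
    have c1 := expansion1_continuous (expansion21 H).
    have c2 := expansion1_continuous (expansion1_sqr w (1 / 2)).
    exact: (cvgD (cvgN c1) c2).
  by move=> w; exact: (cvgD (vc w) (cu w)).
have lapF w : Omega w -> laplacian_at Omega F w 0.
  move=> Ow; have L1 := laplacian_at_C2 v2 Ow; rewrite vlap // in L1.
  have L2 := laplacian_atN (Re_primitive_laplacian OD QD Hu Ow).
  have := laplacian_atD L1 (laplacian_atD L2 (laplacian_at_sqr Omega w (1 / 2))).
  by rewrite (_ : -2 + _ = 0 :> R) //; field.
have Fle : F z <= 0 by apply: (max_principle dO cF) => // w /F0 ->.
have Fge : - F z <= 0.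
  apply: (@max_principle Omega (fun w => - F w) dO) => //.
  - by move=> w; exact: (cvgN (cF w)).
  - by move=> w /F0 ->; rewrite oppr0.
  - by move=> w Ow; have := laplacian_atN (lapF w Ow); rewrite oppr0.
by move: Fle Fge; rewrite /F; lra.
Qed.

Lemma landscape_expansion Omega D (P Q : {poly R[i]}) (u v : C -> R) z :
  RL_domain Omega D P Q u -> landscape Omega v -> Omega z ->
  expansion2 v z (ratfun P Q z - conjc z) (ratf' P Q z) 1.
Proof.
move=> HR Hv Oz e e0; have [dO _ [oD cOD QD] Hu _] := HR.
have [_ /openP oO _ _] := dO.
have Dz : D z by apply: cOD; exact: subset_closure.
have [d1 d10 Hd1] := Re_primitive_expansion Hu Dz (ratfun_expansion P (QD z Dz)) e0.
have [d2 d20 Hd2] := oO z Oz.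
exists (Num.min d1 d2); first by rewrite lt_min d10.
move=> w; rewrite lt_min => /andP[/Hd1 wd1 wd2].
have Ozw : Omega (z + w) by apply: Hd2; rewrite [z + w]addrC addrK.
rewrite (landscape_eq HR Hv Oz) (landscape_eq HR Hv Ozw) sqr_modulusD.
apply: le_trans wd1; rewrite le_eqVlt; apply/orP; left; apply/eqP; congr `|_|.
have -> : complex.Re ((ratfun P Q z - conjc z) * w) =
   complex.Re (ratfun P Q z * w) - complex.Re (2 * conjc z * w) / 2.
  by rewrite mulrBl raddfB /= -mulrA mulr_natl mulr2n; case: (conjc z * w) => a b /=; field.
by field.
Qed.

End MaxPrinciple.

(** * Winding numbers of polygonal chains *)

Section Argument.
Variable R : realType.
Local Notation C := (cplane R).
Implicit Types (w z a b p : R[i]).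

(* Principal argument on the plane slit along the nonpositive real axis, which is
   the set where [modulus w + Re w] is positive. *)
Definition Arg w : R := 2 * atan (complex.Im w / (modulus w + complex.Re w)).
Definition slit w := 0 < modulus w + complex.Re w.
Definition cis (t : R) : R[i] := cos t +i* sin t.

Lemma cisD (s t : R) : cis (s + t) = cis s * cis t.
Proof.
by rewrite /cis; apply/eqP; rewrite eq_complex /= cosD sinD; apply/andP; split; apply/eqP; ring.
Qed.

Lemma cisN (t : R) : cis (- t) = conjc (cis t).
Proof. by rewrite /cis /= cosN sinN. Qed.

Lemma slit_ge w : 0 <= modulus w + complex.Re w.
Proof.
by have := ler_Re_modulus w; rewrite ler_norml => /andP[+ _]; rewrite lerNl -subr_ge0; lra.
Qed.

(** Half-angle formulas: [t] is the tangent of half the argument. *)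
Lemma cis_Arg w : slit w -> (modulus w)%:C * cis (Arg w) = w.
Proof.
rewrite /slit /Arg /cis => s0; have E := modulus_sqr w.
rewrite [RHS](_ : w = complex.Re w +i* complex.Im w); last by case: (w).
move: E s0; set m := modulus w; set x := complex.Re w; set y := complex.Im w => E s0.
pose t := y / (m + x); have T : 0 < 1 + t ^+ 2 by rewrite ltr_pwDl ?sqr_ge0.
have c2 : cos (atan t) ^+ 2 = (1 + t ^+ 2)^-1.
  by rewrite cos_atan exprVn sqr_sqrtr // ltW.
have st : sin (atan t) = t * cos (atan t).
  rewrite -{2}(atanK t) /tan divfK // cos_atan invr_eq0 gt_eqF // sqrtr_gt0 //.
have -> : 2 * atan t = atan t *+ 2 by rewrite mulr_natl.
have cE : cos (atan t *+ 2) * (1 + t ^+ 2) = 1 - t ^+ 2.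
  rewrite cos_mulr2n c2; field; exact: lt0r_neq0.
have sE : sin (atan t *+ 2) * (1 + t ^+ 2) = 2 * t.
  by rewrite sin_mulr2n st mulrCA -expr2 c2; field; exact: lt0r_neq0.
have mx : m + x != 0 by exact: lt0r_neq0.
have T2 : (1 + t ^+ 2) * (m + x) = 2 * m.
  have y2 : y ^+ 2 = (m + x) * (m - x) by rewrite (_ : (m + x) * (m - x) = m ^+ 2 - x ^+ 2); [rewrite E; ring | ring].
  by rewrite /t exprMn exprVn y2; field.
have tE : t * (m + x) = y by rewrite /t divfK.
have TN : 1 + t ^+ 2 != 0 by exact: lt0r_neq0.
apply/eqP; rewrite eq_complex /= !mul0r subr0 addr0; apply/andP; split; apply/eqP.
  apply: (mulIf TN); rewrite -mulrA cE; apply: (mulIf mx).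
  rewrite -!mulrA T2; have -> : m * ((1 - t ^+ 2) * (m + x)) = m * (2 * (m + x) - (1 + t ^+ 2) * (m + x)) by ring.
  by rewrite T2; ring.
apply: (mulIf TN); rewrite -mulrA sE; apply: (mulIf mx).
rewrite -[RHS]mulrA T2; transitivity (m * 2 * (t * (m + x))); first by ring.
by rewrite tE; ring.
Qed.

Lemma slit_real (x : R) : 0 < x -> slit x%:C /\ Arg x%:C = 0.
Proof.
move=> x0; rewrite /slit /Arg modulus_real (_ : complex.Im x%:C = 0) //.
by rewrite mul0r atan0 mulr0 gtr0_norm //; split=> //; exact: addr_gt0.
Qed.

Lemma slit_neq0 w : slit w -> w != 0.
Proof. by apply: contraTneq => ->; rewrite /slit modulus0 addr0 ltxx. Qed.

Lemma slit_scale w (x : R) : 0 < x -> slit w -> slit (x%:C * w) /\ Arg (x%:C * w) = Arg w.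
Proof.
move=> x0 sw; have mE : modulus (x%:C * w) = x * modulus w.
  by rewrite modulusM modulus_real gtr0_norm.
have RE : complex.Re (x%:C * w) = x * complex.Re w.
  by case: (w) => a b /=; rewrite mul0r subr0.
have IE : complex.Im (x%:C * w) = x * complex.Im w.
  by case: (w) => a b /=; rewrite mul0r addr0.
rewrite /slit /Arg mE RE IE -mulrDr; split; first exact: mulr_gt0.
congr (2 * atan _); rewrite -mulf_div divff ?mul1r //; exact: lt0r_neq0.
Qed.

Section AtFilter.
Variables (T : topologicalType) (f : T -> C) (t : T).
Hypothesis cf : {for t, continuous f}.

Let cden : {for t, continuous (fun s => modulus (f s) + complex.Re (f s) : R)}.
Proof.
apply: cvgD.
  by apply: (@continuous_comp _ _ _ f (@modulus R)) => //; exact: modulus_continuous.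
by apply: (@continuous_comp _ _ _ f (@complex.Re R)) => //; exact: Re_continuous.
Qed.

Lemma Arg_continuous_at : slit (f t) -> {for t, continuous (fun s => Arg (f s))}.
Proof.
move=> st; apply: cvgM; first exact: cvg_cst.
apply: (@continuous_comp _ _ _ (fun s => complex.Im (f s) / (modulus (f s) + complex.Re (f s))) (@atan R));
  last exact: continuous_atan.
apply: cvgM.
  by apply: (@continuous_comp _ _ _ f (@complex.Im R)) => //; exact: Im_continuous.
by apply: cvgV; [exact: lt0r_neq0 | exact: cden].
Qed.

Lemma slit_near_at : slit (f t) -> \forall s \near t, slit (f s).
Proof. by move=> st; exact: (cvgr_gt _ cden). Qed.

End AtFilter.

(* Up to a positive factor this is the quotient [(b - p) / (a - p)]. *)
Definition edge a b p := (b - p) * conjc (a - p).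
Definition off a b p := slit (edge a b p).
Definition ang a b p := Arg (edge a b p).

Lemma edge_continuous a b : continuous (edge a b : C -> C).
Proof.
have gen (T : topologicalType) (f : T -> C) : continuous f -> continuous (fun t => edge a b (f t) : C).
  move=> cf t; apply: cvgM; first by apply: cvgB; [exact: cvg_cst | exact: cf].
  apply: (@continuous_comp _ _ _ (fun t => a - f t : C) (@conjc R : C -> C)); last exact: conjc_continuous.
  by apply: cvgB; [exact: cvg_cst | exact: cf].
by apply: (gen C id) => s; exact: cvg_id.
Qed.

Lemma off_near a b p : off a b p -> \forall q \near (p : C), off a b q.
Proof. exact: (slit_near_at (@edge_continuous a b p)). Qed.

Lemma ang_continuous a b p : off a b p -> {for (p : C), continuous (ang a b : C -> R)}.
Proof. exact: (Arg_continuous_at (@edge_continuous a b p)). Qed.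

Lemma off_neq a b p : off a b p -> a - p != 0 /\ b - p != 0.
Proof.
by move=> /slit_neq0; rewrite /edge mulf_eq0 negb_or conjc_eq0 => /andP[].
Qed.

(** When [(b - p) / (a - p)] is real and negative, [p] divides the segment in the ratio of its
    distances to the ends, which gives [t]; the two ends are treated apart. *)
Lemma not_off a b p : ~ off a b p -> exists2 t : R, 0 <= t <= 1 & p = a + t%:C * (b - a).
Proof.
move=> /negP; rewrite /off /slit -leNgt => le0.
have m0 : modulus (edge a b p) = - complex.Re (edge a b p).
  by apply/eqP; rewrite -addr_eq0 eq_le le0 slit_ge.
have [ap|ap] := eqVneq (a - p) 0.
  by exists 0; rewrite ?lexx ?ler01 // rmorph0 mul0r addr0; apply/eqP; rewrite eq_sym -subr_eq0 ap.
have [bp|bp] := eqVneq (b - p) 0.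
  by exists 1; rewrite ?lexx ?ler01 // rmorph1 mul1r addrC subrK; apply/eqP; rewrite eq_sym -subr_eq0 bp.
have eI : complex.Im (edge a b p) = 0.
  have := modulus_sqr (edge a b p); rewrite m0 sqrrN => /eqP.
  by rewrite -[X in X == _]addr0 (inj_eq (addrI _)) eq_sym sqrf_eq0 => /eqP.
have ee : edge a b p = - (modulus (a - p) * modulus (b - p))%:C.
  have -> : modulus (a - p) * modulus (b - p) = modulus (edge a b p).
    rewrite /edge modulusM mulrC; congr (_ * _).
    by case: (a - p) => x y; rewrite /modulus /= sqrrN.
  rewrite m0; move: eI; case: (edge a b p) => x y /= ->.
  by apply/eqP; rewrite eq_complex /= opprK oppr0 !eqxx.
set A := modulus (a - p) in ee; set B := modulus (b - p) in ee.
have A0 : 0 < A by rewrite ltr_modulus_gt0.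
have B0 : 0 < B by rewrite ltr_modulus_gt0.
have AB : 0 < A + B by rewrite addr_gt0.
have key : A%:C * (b - p) = - B%:C * (a - p).
  have cA0 : conjc (a - p) != 0 by rewrite conjc_eq0.
  apply: (mulIf cA0); rewrite -mulrA -/(edge a b p) ee.
  by rewrite -mulrA -modulus_sqrE -/A rmorphM rmorphXn /=; ring.
exists (A / (A + B)).
  rewrite ler_pdivrMr // mul1r lerDl (ltW B0) andbT.
  exact: divr_ge0 (ltW A0) (ltW AB).
have ABC : (A + B)%:C != 0 :> R[i] by rewrite (_ : 0 = 0%:C) // (inj_eq (@complexI R)) lt0r_neq0.
apply: (mulfI ABC); rewrite mulrDr mulrA -rmorphM /= [_ * (A / _)]mulrC divfK ?lt0r_neq0 //.
have key0 : A%:C * (b - p) + B%:C * (a - p) = 0 by rewrite key; ring.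
apply/eqP; rewrite -subr_eq0 -oppr_eq0 -[X in _ == X]key0; apply/eqP.
by rewrite rmorphD /=; ring.
Qed.

(** For [p] near [p0], the change of the argument of [x - p] as [p] leaves [p0]. *)
Definition turn x p0 p := Arg ((x - p) * conjc (x - p0)).

(** Makes an identity of arguments modulo half turns exact once the discrepancy is below 1, since 0
    is the only zero of [sin] in [(-1, 1)]. *)
Lemma cis_Im_eq0 (t rho : R) : `|t| < 1 -> 0 < rho ->
  complex.Im (rho%:C * cis t) = 0 -> t = 0.
Proof.
move=> t1 rho0; rewrite /cis /= mul0r addr0 => /eqP; rewrite mulf_eq0 gt_eqF //= => /eqP st.
move: t1; rewrite ltr_norml => /andP[t1 t2]; apply/eqP/negPn/negP => t0.
have [tp|tn] := ltP 0 t.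
  by have := @sin2_gt0 R t; rewrite tp st ltxx => /(_ _); rewrite (lt_trans t2) ?ltr1n // => /(_ isT).
have tn' : 0 < - t by rewrite oppr_gt0 lt_neqAle t0.
have := @sin2_gt0 R (- t); rewrite tn' sinN st oppr0 ltxx => H.
suff : - t < 2 by move=> h; move: (H h).
by rewrite ltrNl; move: t1; lra.
Qed.

(** The discrepancy [D] is continuous and 0 at [p0], so it is below 1 nearby; the arguments cancel
    in the product of the four factors, so [cis (D p)] is real and [cis_Im_eq0] applies. *)
Lemma ang_local a b p0 : off a b p0 -> exists2 d : R, 0 < d & forall p,
  modulus (p - p0) < d -> off a b p /\
  ang a b p - ang a b p0 = turn b p0 p - turn a p0 p.
Proof.
move=> o0; have [a0 b0] := off_neq o0.
have st x : x - p0 != 0 -> slit ((x - p0) * conjc (x - p0)).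
  move=> x0; rewrite -modulus_sqrE; apply: (slit_real _).1.
  by rewrite exprn_gt0 // ltr_modulus_gt0.
have ct x : x - p0 != 0 -> {for (p0 : C), continuous (turn x p0 : C -> R)} /\
    \forall q \near (p0 : C), slit ((x - q) * conjc (x - p0)).
  move=> x0; have c0 : {for (p0 : C), continuous (fun q : C => (x - q) * conjc (x - p0) : C)}.
    have gen (T : topologicalType) (f : T -> C) : continuous f ->
        continuous (fun t => (x - f t) * conjc (x - p0) : C).
      move=> cf t; apply: cvgM; last exact: cvg_cst.
      by apply: cvgB; [exact: cvg_cst | exact: cf].
    by apply: (gen C id) => s; exact: cvg_id.
  by split; [exact: (Arg_continuous_at c0 (st x x0)) | exact: (slit_near_at c0 (st x x0))].
have [ca sa] := ct a a0; have [cb sb] := ct b b0.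
pose D q := ang a b q - ang a b p0 - (turn b p0 q - turn a p0 q).
have turn0 x : x - p0 != 0 -> turn x p0 p0 = 0.
  move=> x0; rewrite /turn -modulus_sqrE; apply: (slit_real _).2.
  by rewrite exprn_gt0 // ltr_modulus_gt0.
have D0 : D p0 = 0 by rewrite /D !turn0 // !subrr.
have cD : {for (p0 : C), continuous (D : C -> R)}.
  apply: (cvgB (cvgB (ang_continuous o0) _) (cvgB cb ca)).
  exact: cvg_cst.
have /continuousP_eps /(_ 1 ltr01)[d1 d10 Hd1] := cD.
have /nbhsP[d2 d20 Hd2] := off_near o0.
have /nbhsP[d3 d30 Hd3] := sa; have /nbhsP[d4 d40 Hd4] := sb.
exists (Num.min (Num.min d1 d2) (Num.min d3 d4)); first by rewrite !lt_min d10 d20 d30.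
move=> p; rewrite !lt_min => /andP[/andP[/Hd1 p1 /Hd2 op] /andP[/Hd3 spa /Hd4 spb]].
split=> //; apply/eqP; rewrite -subr_eq0; apply/eqP; rewrite -/(D p).
rewrite D0 subr0 in p1.
set E := edge a b p in op; set E0 := edge a b p0.
set B := (b - p) * conjc (b - p0) in spb; set A := (a - p) * conjc (a - p0) in spa.
have mgt w : slit w -> 0 < modulus w by move=> /slit_neq0; rewrite ltr_modulus_gt0.
have := cis_Im_eq0 p1 (mulr_gt0 (mulr_gt0 (mgt _ op) (mgt _ o0)) (mulr_gt0 (mgt _ spb) (mgt _ spa))).
apply; have -> : cis (D p) = cis (Arg E) * conjc (cis (Arg E0)) * (conjc (cis (Arg B)) * cis (Arg A)).
  by rewrite /D /ang /turn -/E -/E0 -/A -/B opprB addrC cisD !cisD !cisN; ring.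
have -> : (modulus E * modulus E0 * (modulus B * modulus A))%:C *
    (cis (Arg E) * conjc (cis (Arg E0)) * (conjc (cis (Arg B)) * cis (Arg A))) =
    E * conjc E0 * (conjc B * A).
  have e1 : (modulus E)%:C * cis (Arg E) = E := cis_Arg op.
  have e2 : (modulus E0)%:C * cis (Arg E0) = E0 := cis_Arg o0.
  have e3 : (modulus B)%:C * cis (Arg B) = B := cis_Arg spb.
  have e4 : (modulus A)%:C * cis (Arg A) = A := cis_Arg spa.
  rewrite -[in RHS]e1 -[in RHS]e2 -[in RHS]e3 -[in RHS]e4.
  have crM (x : R) (v : R[i]) : conjc (x%:C * v) = x%:C * conjc v.
    by case: v => v1 v2; apply/eqP; rewrite eq_complex /=; apply/andP; split; apply/eqP; ring.
  rewrite !crM !(rmorphM (real_complex R)) /=; ring.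
have -> : E * conjc E0 * (conjc B * A) =
    (modulus (b - p) ^+ 2 * modulus (a - p) ^+ 2 * (modulus (b - p0) ^+ 2 * modulus (a - p0) ^+ 2))%:C.
  have MM (x y : R) : (x * y)%:C = x%:C * y%:C :> R[i] by exact: rmorphM.
  rewrite (MM (_ * _) (_ * _)) (MM (modulus (b - p) ^+ 2)) (MM (modulus (b - p0) ^+ 2)).
  rewrite !modulus_sqrE /E /E0 /A /B /edge !rmorphM /= !conjcK; ring.
by [].
Qed.

Fixpoint theta a (l : seq R[i]) p : R := if l is b :: l' then ang a b p + theta b l' p else 0.
Fixpoint offp a (l : seq R[i]) p : Prop := if l is b :: l' then off a b p /\ offp b l' p else True.

(** The turns at intermediate vertices telescope. *)
Lemma theta_local a l p0 : offp a l p0 -> exists2 d : R, 0 < d & forall p,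
  modulus (p - p0) < d -> offp a l p /\
  theta a l p - theta a l p0 = turn (last a l) p0 p - turn a p0 p.
Proof.
elim: l a => [|b l IH] a /=; first by exists 1 => // p _; rewrite !subrr.
move=> [/ang_local[d1 d10 H1] /IH[d2 d20 H2]].
exists (Num.min d1 d2); first by rewrite lt_min d10.
move=> p; rewrite lt_min => /andP[/H1[of1 E1] /H2[of2 E2]]; split=> //.
by rewrite opprD addrACA E1 E2; ring.
Qed.

Lemma theta_continuous a l p0 : offp a l p0 -> {for (p0 : C), continuous (theta a l : C -> R)}.
Proof.
have c0 (T : topologicalType) (t : T) : {for t, continuous (fun=> 0 : R)} by exact: cvg_cst.
elim: l a => [|b l IH] a /=; first by move=> _; exact: c0.
by move=> [of1 of2]; exact: (cvgD (ang_continuous of1) (IH _ of2)).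
Qed.

Lemma ang_far a b (e : R) : 0 < e -> exists2 M : R, 0 < M & forall p, M <= modulus p -> `|ang a b p| < e.
Proof.
move=> e0.
have o1 : slit 1 /\ Arg 1 = 0 by exact: (@slit_real 1).
have c1 : {for (1 : C), continuous (Arg : C -> R)}.
  have cid : {for (1 : C), continuous (id : C -> C)} by exact: cvg_id.
  exact: (Arg_continuous_at cid o1.1).
have /continuousP_eps /(_ e e0)[d d0 Hd] := c1.
pose K := modulus a + modulus b + modulus a * modulus b.
have a0 := modulus_ge0 a; have b0 := modulus_ge0 b; have ab0 : 0 <= modulus a * modulus b by rewrite mulr_ge0.
have K0 : 0 <= K by rewrite /K !addr_ge0.
exists (1 + K / d) => [|p Mp]; first by rewrite ltr_pwDl // divr_ge0 // ltW.
have p1 : 1 <= modulus p by apply: le_trans Mp; rewrite lerDl divr_ge0 // ltW.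
have p0 : 0 < modulus p by exact: lt_le_trans p1.
have ip0 : 0 < (modulus p ^+ 2)^-1 by rewrite invr_gt0 exprn_gt0.
pose w := (modulus p ^+ 2)^-1%:C * edge a b p.
have wE : ang a b p = Arg w.
  rewrite /ang /w; have [se|nse] := pselect (slit (edge a b p)).
    by rewrite (slit_scale ip0 se).2.
  have p20 : 0 < modulus p ^+ 2 by rewrite exprn_gt0.
  have mE (x : R) (v : R[i]) : 0 < x -> Arg (x%:C * v) = Arg v.
    move=> x0; rewrite /Arg modulusM modulus_real gtr0_norm //.
    have -> : complex.Re (x%:C * v) = x * complex.Re v by case: (v) => c1' c2' /=; rewrite mul0r subr0.
    have -> : complex.Im (x%:C * v) = x * complex.Im v by case: (v) => c1' c2' /=; rewrite mul0r addr0.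
    by rewrite -mulrDr -mulf_div divff ?mul1r // lt0r_neq0.
  by rewrite mE.
rewrite wE -[Arg w]subr0 -o1.2; apply: Hd.
have -> : w - 1 = (modulus p ^+ 2)^-1%:C * (b * conjc a - b * conjc p - p * conjc a).
  rewrite /w /edge -[X in _ - X](_ : (modulus p ^+ 2)^-1%:C * (modulus p ^+ 2)%:C = 1).
    by rewrite -mulrBr modulus_sqrE rmorphB /=; congr (_ * _); ring.
  by rewrite -rmorphM mulVf ?rmorph1 // lt0r_neq0 // exprn_gt0.
have mc (v : R[i]) : modulus (conjc v) = modulus v by case: v => x y; rewrite /modulus /= sqrrN.
rewrite modulusM modulus_real gtr0_norm // mulrC ltr_pdivrMr ?exprn_gt0 //.
apply: le_lt_trans (modulusB _ _) _; rewrite modulusM mc.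
apply: le_lt_trans (lerD (modulusB _ _) (lexx _)) _; rewrite !modulusM !mc.
have Kd : K < d * modulus p.
  have : K / d < modulus p by apply: lt_le_trans Mp; rewrite ltrDr.
  by rewrite ltr_pdivrMr // mulrC.
apply: (@le_lt_trans _ _ (K * modulus p)); last by rewrite expr2 mulrA ltr_pM2r.
rewrite /K !mulrDl.
have : modulus a * modulus b <= modulus a * modulus b * modulus p by rewrite ler_peMr.
by lra.
Qed.

Lemma theta_far a l (e : R) : 0 < e -> exists2 M : R, 0 < M & forall p, M <= modulus p -> `|theta a l p| < e.
Proof.
elim: l a e => [|b l IH] a e e0 /=; first by exists 1 => // p _; rewrite normr0.
have e20 : 0 < e / 2 by rewrite divr_gt0.
have [M1 M10 H1] := ang_far a b e20; have [M2 M20 H2] := IH b _ e20.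
exists (Num.max M1 M2); first by rewrite lt_max M10.
move=> p; rewrite ge_max => /andP[/H1 p1 /H2 p2].
by apply: le_lt_trans (ler_normD _ _) _; rewrite (splitr e) ltrD.
Qed.

(** For [s = 0] and [h = 1] the edge product at ['i x] is [(x + 'i)^2], of argument
    [2 atan (1 / x)]. For [0 < x <= 1] this is at least half of pi, and the sign changes with that
    of [x]. *)
Lemma ang_jump (s h : R[i]) (t : R) : h != 0 -> 0 < t <= 1 ->
  [/\ off (s - h) (s + h) (s + t%:C * ('i * h)), off (s - h) (s + h) (s - t%:C * ('i * h)),
     1 <= ang (s - h) (s + h) (s + t%:C * ('i * h)) &
     ang (s - h) (s + h) (s - t%:C * ('i * h)) <= -1].
Proof.
move=> h0 /andP[t0 t1].
have m0 : 0 < modulus h ^+ 2 by rewrite exprn_gt0 // ltr_modulus_gt0.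
pose w (t : R) : R[i] := (t ^+ 2 - 1) +i* (2 * t).
have wE x : (modulus h ^+ 2)%:C * w x = edge (s - h) (s + h) (s + x%:C * ('i * h)).
  have -> : w x = (x ^+ 2 - 1)%:C + 'i * (2 * x)%:C.
    by apply/eqP; rewrite eq_complex /=; apply/andP; split; apply/eqP; ring.
  rewrite modulus_sqrE /edge.
  have -> : s - h - (s + x%:C * ('i * h)) = (- 1 - x%:C * 'i) * h by ring.
  have -> : s + h - (s + x%:C * ('i * h)) = (1 - x%:C * 'i) * h by ring.
  rewrite (rmorphM (@conjc R)) /= mulrACA; rewrite [LHS]mulrC; congr (_ * _).
  by apply/eqP; rewrite eq_complex /=; apply/andP; split; apply/eqP; ring.
have mw x : modulus (w x) = x ^+ 2 + 1.
  apply/eqP; rewrite -(@eqrXn2 _ 2) ?modulus_ge0 ?addr_ge0 ?sqr_ge0 // modulus_sqr /w /=.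
  by apply/eqP; ring.
have sw x : x != 0 -> slit (w x).
  move=> x0; rewrite /slit mw /w /=.
  rewrite (_ : _ + _ = x ^+ 2 *+ 2) ?pmulrn_lgt0 ?exprn_even_gt0 ?x0 //; ring.
have aw x : x != 0 -> Arg (w x) = 2 * atan x^-1.
  move=> x0; rewrite /Arg mw /w /=; congr (2 * atan _).
  have -> : x ^+ 2 + 1 + (x ^+ 2 - 1) = 2 * x ^+ 2 by ring.
  by field.
have tN0 : t != 0 by rewrite gt_eqF.
have NtN0 : - t != 0 by rewrite oppr_eq0.
have iv : 1 <= t^-1 by rewrite invf_ge1.
have at1 : 1 <= 2 * atan t^-1.
  have : 2 * atan 1 <= 2 * atan t^-1 by rewrite ler_pM2l // le_atan.
  by rewrite atan1; have := @pi_ge2 R; lra.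
have EN : s - t%:C * ('i * h) = s + (- t)%:C * ('i * h) by rewrite rmorphN mulNr.
rewrite EN /off /ang -!wE !(slit_scale m0 (sw _ _)).2 //.
split; [exact: (slit_scale m0 (sw _ _)).1 | exact: (slit_scale m0 (sw _ NtN0)).1 | by rewrite aw | ].
by rewrite aw // invrN atanN mulrN lerN2.
Qed.

End Argument.

(** * Winding function of a real chain of polygons *)

Section Chain.
Variables (R : realType) (I : finType).
Local Notation C := (cplane R).
Variables (s h : I -> R[i]) (lp lm : I -> seq R[i]) (c : I -> R).

Let tip i := last (s i + h i) (lp i).
Let tail i := last (s i - h i) (lm i).

(* The [i]-th path runs from [tail i] backwards along [lm i], through [s i], and
   then along [lp i] to [tip i]. *)
Definition sweep i (p : R[i]) : R :=
  theta (s i + h i) (lp i) p + ang (s i - h i) (s i + h i) p - theta (s i - h i) (lm i) p.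

Definition off_path i (p : R[i]) := [/\ offp (s i + h i) (lp i) p,
  off (s i - h i) (s i + h i) p & offp (s i - h i) (lm i) p].

Definition winding (p : R[i]) : R := \sum_i c i * sweep i p.

Definition off_chain (p : R[i]) := forall i, c i != 0 -> off_path i p.

(** The formal boundary of the chain is 0, expressed by testing against all functions; the choice of
    [turn] for [phi] makes the winding locally constant. *)
Hypothesis cycle : forall phi : R[i] -> R, \sum_i c i * (phi (tip i) - phi (tail i)) = 0.

Lemma sweep_local i p0 : off_path i p0 -> \forall p \near (p0 : C),
  off_path i p /\ sweep i p - sweep i p0 = turn (tip i) p0 p - turn (tail i) p0 p.
Proof.
move=> [/theta_local[d1 d10 H1] /ang_local[d2 d20 H2] /theta_local[d3 d30 H3]].
apply/nbhsP; exists (Num.min d1 (Num.min d2 d3)); first by rewrite !lt_min d10 d20.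
move=> p; rewrite !lt_min => /andP[/H1[A1 E1] /andP[/H2[A2 E2] /H3[A3 E3]]].
split; first by split.
rewrite /sweep /tip /tail; move: E1 E2 E3.
set x1 := theta _ _ p; set x2 := theta _ _ p0; set x3 := ang _ _ p; set x4 := ang _ _ p0.
by set x5 := theta _ _ p; set x6 := theta _ _ p0; lra.
Qed.

Lemma winding_local p0 : off_chain p0 -> \forall p \near (p0 : C),
  off_chain p /\ winding p = winding p0.
Proof.
move=> op; have H i : \forall p \near (p0 : C), c i != 0 ->
    off_path i p /\ sweep i p - sweep i p0 = turn (tip i) p0 p - turn (tail i) p0 p.
  have [c0|c0] := eqVneq (c i) 0; first by apply/nbhsP; exists 1 => // p _ /negP.
  have /nbhsP[d d0 Hd] := sweep_local (op i c0).
  by apply/nbhsP; exists d => // p /Hd.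
have /nbhsP[d d0 Hd] := @filter_forall _ I _ _ (nbhs_filter (p0 : C)) H.
apply/nbhsP; exists d => // p /Hd Hp; split.
  by move=> i /Hp[].
apply/eqP; rewrite -subr_eq0 -[X in _ == X](cycle (fun x => turn x p0 p)) /winding -sumrB; apply/eqP.
apply: eq_bigr => i _; have [->|c0] := eqVneq (c i) 0; first by rewrite !mul0r subrr.
by rewrite -mulrBr; have [_ ->] := Hp i c0.
Qed.

Lemma winding_connected (A : set C) x y : connected A -> (forall p, A p -> off_chain p) ->
  A x -> A y -> winding x = winding y.
Proof.
move=> cA offA Ax Ay.
have opn (P : R -> Prop) : open [set q : C | off_chain q /\ P (winding q)].
  apply/openP => q [oq Pq]; have /nbhsP[d d0 Hd] := winding_local oq.
  by exists d => // w /Hd[ow E]; split=> //; rewrite E.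
have /(_ _)E := cA [set q : C | A q /\ winding q = winding x].
have : [set q : C | A q /\ winding q = winding x] = A.
  apply: E; first by exists x.
    exists [set q : C | off_chain q /\ winding q = winding x]; first exact: (opn (fun r => r = winding x)).
    by apply/seteqP; split=> q [Aq H]; split=> //; [split=> //; exact: offA | case: H].
  exists (~` [set q : C | off_chain q /\ winding q <> winding x]).
    by apply: open_closedC; exact: (opn (fun r => r <> winding x)).
  apply/seteqP; split=> q [Aq H]; split=> //; first by move=> [_]; apply.
  by apply: contrapT => nq; apply: H; split=> //; exact: offA.
by move=> /seteqP[_ /(_ y Ay)[_ ->]].
Qed.

Lemma winding_far (e : R) : 0 < e -> exists2 M : R, 0 < M & forall p, M <= modulus p -> `|winding p| < e.
Proof.
(* One more than the number of paths: nonzero even for an empty index type, and it makes the final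
   sum strictly smaller than [e]. *)
move=> e0; pose K := (#|I|.+1)%:R : R; have K0 : 0 < K by [].
have H i : exists M : R, 0 < M /\ forall p, M <= modulus p -> `|c i * sweep i p| < e / K.
  have e1 : 0 < e / K / (`|c i| + 1) / 3.
    by rewrite !divr_gt0 // ltr_wpDl.
  have [M1 M10 H1] := theta_far (s i + h i) (lp i) e1.
  have [M2 M20 H2] := ang_far (s i - h i) (s i + h i) e1.
  have [M3 M30 H3] := theta_far (s i - h i) (lm i) e1.
  exists (Num.max M1 (Num.max M2 M3)); split; first by rewrite lt_max M10.
  move=> p; rewrite !ge_max => /andP[/H1 p1 /andP[/H2 p2 /H3 p3]].
  have k0 : 0 < `|c i| + 1 by rewrite ltr_wpDl.
  rewrite normrM; apply: (@le_lt_trans _ _ ((`|c i| + 1) * `|sweep i p|)).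
    by rewrite ler_wpM2r // lerDl.
  rewrite mulrC -ltr_pdivlMr // /sweep.
  apply: le_lt_trans (ler_normB _ _) _; apply: le_lt_trans (lerD (ler_normD _ _) (lexx _)) _.
  by move: p1 p2 p3; set E := e / K / _; lra.
have [F HF] := choice H.
exists (1 + \sum_i F i) => [|p Mp].
  by rewrite ltr_pwDl // sumr_ge0 // => i _; case: (HF i) => /ltW.
rewrite /winding; apply: le_lt_trans (ler_norm_sum _ _ _) _.
apply: (@le_lt_trans _ _ (\sum_(i : I) e / K)).
  apply: ler_sum => i _; apply/ltW; apply: (HF i).2; apply: le_trans Mp.
  rewrite (bigD1 i) //= addrCA lerDl addr_ge0 // sumr_ge0 // => j _.
  by case: (HF j) => /ltW.
rewrite sumr_const -mulr_natr mulrAC ltr_pdivrMr // ltr_pM2l // ltr_nat.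
exact: max_card.
Qed.

(** On a ray off the chain the winding is constant, and it tends to 0 at infinity. *)
Lemma winding_ray (p : R[i]) : p != 0 -> (forall t : R, 1 <= t -> off_chain (t%:C * p)) ->
  winding p = 0.
Proof.
move=> p0 offr; apply/eqP/negPn/negP => Wp.
have e0 : 0 < `|winding p| by rewrite normr_gt0.
have [M M0 HM] := winding_far e0.
have mp0 : 0 < modulus p by rewrite ltr_modulus_gt0.
pose T := 1 + M / modulus p; have T1 : 1 <= T by rewrite lerDl divr_ge0 // ltW.
pose f (t : R) : C := t%:C * p.
have cf : continuous f.
  move=> t A /nbhsP[e e00 He]; apply/nbhs_ballP; exists (e / modulus p); first by rewrite /= divr_gt0.
  move=> t'; rewrite -ball_normE /= distrC ltr_pdivlMr // => tt; apply: He.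
  by rewrite /f -mulrBl -rmorphB modulusM modulus_real.
have cA : connected (f @` `[1, T]).
  apply: connected_continuous_connected; first exact: segment_connected.
  exact: continuous_subspaceT.
have E : winding (f 1) = winding (f T).
  apply: (winding_connected cA).
  - by move=> q [t /=]; rewrite in_itv /= => /andP[t1 _] <-; exact: offr.
  - by exists 1 => //=; rewrite in_itv /= lexx.
  - by exists T => //=; rewrite in_itv /= lexx T1.
have f1 : f 1 = p by rewrite /f rmorph1 mul1r.
have := HM (f T); rewrite -E f1 ltxx => H.
suff : M <= modulus (f T) by move/H.
rewrite /f modulusM modulus_real ger0_norm ?(le_trans ler01) //.
by rewrite /T mulrDl divfK ?lt0r_neq0 // mul1r lerDr ltW.
Qed.

End Chain.

(** * No nontrivial cycle through saddles has zero winding on the boundary *)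

Section NoCycle.
Variables (R : realType) (I : finType).
Local Notation C := (cplane R).
Variables (Omega : set C) (v : C -> R).
Variables (s h : I -> R[i]) (lp lm : I -> seq R[i]) (c : I -> R).
Hypotheses (dO : domain Omega) (vcont : forall z, Omega z -> {for z, continuous v}).
Hypothesis nomin : forall z, Omega z -> forall d : R, 0 < d ->
  exists2 p : C, modulus (p - z) < d & v p < v z.
Hypotheses (sO : forall i, Omega (s i)) (h0 : forall i, h i != 0) (sinj : injective s).
Hypothesis Hlp : forall i (p : C), ~ offp (s i + h i) (lp i) p -> Omega p /\ v (s i) < v p.
Hypothesis Hlm : forall i (p : C), ~ offp (s i - h i) (lm i) p -> Omega p /\ v (s i) < v p.
Hypothesis Hedge : forall i (p : C), ~ off (s i - h i) (s i + h i) p ->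
  Omega p /\ (p = s i \/ v (s i) < v p).
Hypothesis Hdesc : forall i, exists2 t0 : R, 0 < t0 & forall t : R, 0 < t <= t0 ->
  v (s i + t%:C * ('i * h i)) < v (s i) /\ v (s i - t%:C * ('i * h i)) < v (s i).
Hypothesis cycle : forall phi : R[i] -> R,
  \sum_i c i * (phi (last (s i + h i) (lp i)) - phi (last (s i - h i) (lm i))) = 0.
Hypothesis bdry : forall y, boundary Omega y -> winding s h lp lm c y = 0.

Notation W := (winding s h lp lm c).
Notation offc := (off_chain s h lp lm c).
Notation offi := (off_path s h lp lm).

Let not_off_path i (p : C) : ~ offi i p -> Omega p /\ (p = s i \/ v (s i) < v p).
Proof.
move=> H; have [k1|k1] := pselect (offp (s i + h i) (lp i) p); last by case: (Hlp k1) => ? ?; split=> //; right.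
have [k2|/negP k2] := boolP (off (s i - h i) (s i + h i) p); last exact: Hedge.
have [k3|k3] := pselect (offp (s i - h i) (lm i) p); last by case: (Hlm k3) => ? ?; split=> //; right.
by exfalso; apply: H; split.
Qed.

Lemma off_outside (p : C) : ~ Omega p -> offc p.
Proof. by move=> nO i _; apply: contrapT => /not_off_path[]. Qed.

Lemma not_off_chain (p : C) : ~ offc p -> exists2 i, c i != 0 & Omega p /\ (p = s i \/ v (s i) < v p).
Proof.
move=> H; apply: contrapT => N; apply: H => i ci; apply: contrapT => /not_off_path Hp.
by apply: N; exists i.
Qed.

Let K := [set p : C | ~ offc p \/ W p <> 0].

Let K_near (p : C) : offc p -> W p <> 0 -> exists2 d : R, 0 < d & forall q, modulus (q - p) < d -> K q.
Proof.
move=> op Wp; have /nbhsP[d d0 Hd] := winding_local cycle op.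
by exists d => // q /Hd[oq E]; right; rewrite E.
Qed.

Let closed_K : closed K.
Proof.
rewrite -[K]setCK; apply: open_closedC; apply/openP => p Kp.
have op : offc p by apply: contrapT => N; apply: Kp; left.
have Wp : W p = 0 by apply: contrapT => N; apply: Kp; right.
have /nbhsP[d d0 Hd] := winding_local cycle op.
exists d => // q /Hd[oq E] [N|N]; first by apply: N.
by apply: N; rewrite E.
Qed.

Lemma winding_outer (p : C) : p != 0 -> (forall t : R, 1 <= t -> ~ Omega (t%:C * p)) -> W p = 0.
Proof. by move=> p0 H; apply: (winding_ray cycle p0) => t t1; apply: off_outside; exact: H. Qed.

Let bounded_K : exists M : R, forall p, K p -> modulus p <= M.
Proof.
have [_ _ _ /bounded_modulus[M M0 HM]] := dO; exists M => p Kp; rewrite leNgt; apply/negP => Mp.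
have out (t : R) : 1 <= t -> ~ Omega (t%:C * p).
  move=> t1 /subset_closure /HM; rewrite modulusM modulus_real ger0_norm ?(le_trans ler01) //.
  apply/negP; rewrite -ltNge; apply: lt_le_trans Mp _.
  by rewrite ler_peMl ?modulus_ge0.
have p0 : p != 0 by rewrite -ltr_modulus_gt0; exact: le_lt_trans Mp.
case: Kp => [N|]; last by apply; exact: winding_outer.
by apply: N; apply: off_outside; have := out 1 (lexx 1); rewrite rmorph1 mul1r.
Qed.

(** A point of [K] outside [Omega] with largest real part has a whole neighbourhood in [K]; the
    points just to its right must then lie in [Omega], so it is a boundary point, where the winding
    is 0. *)
Let K_sub : K `<=` Omega.
Proof.
have [_ oO _ _] := dO; have [M HM] := bounded_K.
move=> p Kp; apply: contrapT => nOp.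
have cK : compact (K `&` ~` Omega).
  apply: (bounded_closed_compactC (M := M)); last by move=> z [/HM].
  by apply: closedI; [exact: closed_K | exact: open_closedC].
have [||y yK ymax] := @compact_EVT_max C R (@complex.Re R) (K `&` ~` Omega) _ cK.
- by exists p.
- by apply: continuous_subspaceT; exact: Re_continuous.
rewrite inE in yK; have [Ky nOy] := yK.
have oy := off_outside nOy.
have Wy : W y <> 0 by case: Ky.
have [d d0 Hd] := K_near oy Wy.
apply: Wy; apply: bdry; apply: closure_boundary => //.
apply/closureP => e e0; pose t := Num.min d e / 2.
have m0 : 0 < Num.min d e by rewrite lt_min d0.
have t0 : 0 < t by rewrite divr_gt0.
have tm : t < Num.min d e by rewrite ltr_pdivrMr // mulrDr mulr1 ltrDl.
move: (tm); rewrite lt_min => /andP[td te].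
have yt : modulus (y + t%:C - y) = t by rewrite [y + _]addrC addrK modulus_real gtr0_norm.
exists (y + t%:C); last by rewrite yt.
apply: contrapT => nO; have := ymax (y + t%:C); rewrite inE.
have Kyt : K (y + t%:C) by apply: Hd; rewrite yt.
move=> /(_ (conj Kyt nO)); rewrite (raddfD (@complex.Re R)) /= => H.
by move: t0; lra.
Qed.

(** Continuous at [s i0], so a jump of the removed angle is a jump of the winding. *)
Let rest i0 (p : R[i]) := W p - c i0 * ang (s i0 - h i0) (s i0 + h i0) p.

Let rest_continuous i0 : (forall i, c i != 0 -> i != i0 -> offi i (s i0)) ->
  offp (s i0 + h i0) (lp i0) (s i0) -> offp (s i0 - h i0) (lm i0) (s i0) ->
  {for (s i0 : C), continuous (rest i0 : C -> R)}.
Proof.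
move=> oi op om.
have gen (T : topologicalType) (t : T) (f : I -> T -> R) (P : pred I) :
    (forall i, P i -> {for t, continuous (f i)}) -> {for t, continuous (fun x => \sum_(i | P i) f i x)}.
  by move=> cf; apply: cvg_big => [|i Pi]; [exact: add_continuous | exact: cf].
have cstc (T : topologicalType) (t : T) (x : R) : {for t, continuous (fun=> x)} by exact: cvg_cst.
have E : rest i0 = (fun p => c i0 * (theta (s i0 + h i0) (lp i0) p - theta (s i0 - h i0) (lm i0) p) +
    \sum_(i | i != i0) c i * sweep s h lp lm i p).
  by apply/funext => p; rewrite /rest /winding (bigD1 i0) //= /sweep; ring.
rewrite E; apply: (cvgD (cvgM (cstc _ _ _) (cvgB (theta_continuous op) (theta_continuous om)))).
apply: (gen C (s i0) (fun i p => c i * sweep s h lp lm i p)) => i ii0.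
have [ci|ci] := eqVneq (c i) 0.
  rewrite ci (_ : (fun p => _) = (fun=> 0)); first exact: cstc.
  by apply/funext => p; rewrite mul0r.
have [a1 a2 a3] := oi i ci ii0.
exact: (cvgM (cstc _ _ _) (cvgB (cvgD (theta_continuous a1) (ang_continuous a2)) (theta_continuous a3))).
Qed.

(* At the lowest saddle [s i0] of the cycle the winding number jumps across the
   edge, so it is nonzero at a point below the saddle. *)
Let low_point i0 : c i0 != 0 -> (forall i, c i != 0 -> v (s i0) <= v (s i)) ->
  exists2 q : C, offc q /\ W q <> 0 & v q < v (s i0).
Proof.
move=> ci0 Hmin.
(* Any other path of the cycle is strictly above its own saddle except at that saddle, hence misses
   [s i0], the lowest one. *)
have oi i : c i != 0 -> i != i0 -> offi i (s i0).
  move=> ci ii0; apply: contrapT => /not_off_path[_ [/sinj E|]].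
    by move: ii0; rewrite E eqxx.
  by apply/negP; rewrite -leNgt Hmin.
have op : offp (s i0 + h i0) (lp i0) (s i0) by apply: contrapT => /Hlp[_]; rewrite ltxx.
have om : offp (s i0 - h i0) (lm i0) (s i0) by apply: contrapT => /Hlm[_]; rewrite ltxx.
have e0 : 0 < `|c i0| / 2 by rewrite divr_gt0 // normr_gt0.
have /continuousP_eps /(_ _ e0)[d1 d10 Hd1] := rest_continuous oi op om.
have H i : \forall p \near (s i0 : C), c i != 0 -> i != i0 -> offi i p.
  have [ci|ci] := eqVneq (c i) 0; first by apply/nbhsP; exists 1 => // p _ /negP.
  have [ii|ii] := eqVneq i i0; first by apply/nbhsP; exists 1 => // p _ _ /negP.
  have /nbhsP[d d0 Hd] := sweep_local (oi i ci ii).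
  by apply/nbhsP; exists d => // p /Hd[].
have /nbhsP[d2 d20 Hd2] := @filter_forall _ I _ _ (nbhs_filter (s i0 : C)) H.
have [d3 d30 Hd3] := theta_local op; have [d4 d40 Hd4] := theta_local om.
have [t0 t00 Ht0] := Hdesc i0.
have mh : 0 < modulus (h i0) by rewrite ltr_modulus_gt0.
pose d := Num.min (Num.min d1 d2) (Num.min d3 d4).
have d0 : 0 < d by rewrite !lt_min d10 d20 d30.
pose t := Num.min (Num.min t0 1) (d / modulus (h i0) / 2).
have t1 : 0 < t by rewrite !lt_min t00 ltr01 !divr_gt0.
have [tt0 t11] : t <= t0 /\ t <= 1.
  have : t <= Num.min t0 1 by rewrite /t ge_min lexx.
  by rewrite le_min => /andP[].
have td : t * modulus (h i0) < d.
  rewrite -ltr_pdivlMr //; apply: (@le_lt_trans _ _ (d / modulus (h i0) / 2)).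
    by rewrite /t ge_min lexx orbT.
  by rewrite ltr_pdivrMr // mulrDr mulr1 ltrDl divr_gt0.
have t01 : 0 < t <= 1 by rewrite t1 t11.
have [J1 J2 J3 J4] := ang_jump (s i0) (h0 i0) t01.
have [|V1 V2] := Ht0 t; first by rewrite t1 tt0.
set w := t%:C * ('i * h i0) in J1 J2 J3 J4 V1 V2.
have mw : modulus w < d.
  rewrite /w modulusM modulus_real gtr0_norm // modulusM.
  by rewrite (_ : modulus 'i = 1) ?mul1r // /modulus /= expr1n expr0n /= add0r sqrtr1.
have near q : modulus (q - s i0) < d -> off (s i0 - h i0) (s i0 + h i0) q ->
    offc q /\ `|rest i0 q - rest i0 (s i0)| < `|c i0| / 2.
  rewrite !lt_min => /andP[/andP[q1 q2] /andP[q3 q4]] oq.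
  split; last exact: Hd1.
  move=> i ci; have [->|ii0] := eqVneq i i0; last exact: Hd2 q2 i ci ii0.
  by split=> //; [case: (Hd3 q q3) | case: (Hd4 q q4)].
have [|oq1 R1] := near (s i0 + w) _ J1; first by rewrite [s i0 + w]addrC addrK.
have [|oq2 R2] := near (s i0 - w) _ J2; first by rewrite [s i0 - w]addrC addrK modulusN.
have [W1|W1] := eqVneq (W (s i0 + w)) 0; last first.
  by exists (s i0 + w) => //; split=> //; exact/eqP.
exists (s i0 - w) => //; split=> // W2.
(* If the winding vanished on both sides, [rest] would change by at least [2 |c i0|], but continuity
   allows less than [|c i0|]. *)
have D : rest i0 (s i0 - w) - rest i0 (s i0 + w) =
    c i0 * (ang (s i0 - h i0) (s i0 + h i0) (s i0 + w) - ang (s i0 - h i0) (s i0 + h i0) (s i0 - w)).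
  by rewrite /rest W1 W2; ring.
have D2 : `|rest i0 (s i0 - w) - rest i0 (s i0 + w)| < `|c i0|.
  rewrite -(subrKA (rest i0 (s i0))); apply: le_lt_trans (ler_normD _ _) _.
  by rewrite [X in _ + X]distrC (splitr `|c i0|) ltrD.
move: D2; rewrite D normrM gtr_pMr ?normr_gt0 // ltr_norml => /andP[_].
by apply/negP; rewrite -leNgt; lra.
Qed.

Theorem no_cycle i1 : c i1 != 0 -> False.
Proof.
move=> ci1.
case: (@arg_minP _ R I i1 (fun i => c i != 0) (fun i => v (s i)) ci1) => i0 ci0 Hmin.
have [q [oq Wq] vq] := low_point ci0 Hmin.
have [M HM] := bounded_K.
have cK : compact K by apply: (bounded_closed_compactC (M := M)).
have [||p pK pmin] := @compact_EVT_min C R v K _ cK.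
- by exists q; right.
- by apply: continuous_in_subspaceT => z; rewrite inE => /K_sub; exact: vcont.
rewrite inE in pK.
have pq : v p <= v q by apply: pmin; rewrite inE; right.
(* The minimum is strictly below all values on the chain, so [p] is off the chain and interior to
   [K]. *)
have op : offc p.
  apply: contrapT => /not_off_chain[i ci [_ Hi]].
  have : v (s i) <= v p by case: Hi => [->|/ltW].
  by apply/negP; rewrite -ltNge; apply: le_lt_trans pq (lt_le_trans vq (Hmin i ci)).
have Wp : W p <> 0 by case: pK.
have [d d0 Hd] := K_near op Wp.
have [p' p'd] := nomin (K_sub pK) d0.
by apply/negP; rewrite -leNgt; apply: pmin; rewrite inE; exact: Hd.
Qed.

End NoCycle.

(** * Saddles *)

Section Saddles.
Variable R : realType.
Local Notation C := (cplane R).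
Implicit Types (z m : C).

Lemma offp_rcons (a : R[i]) l b p :
  offp a (rcons l b) p <-> offp a l p /\ off (last a l) b p.
Proof.
elim: l a => [|x l IH] a /=; first by split=> [[]|[]].
by split=> [[ax /IH[]]|[[ax xl] lb]] //; split=> //; apply/IH.
Qed.

Lemma segment_ball (z w m : R[i]) (t d : R) : 0 <= t <= 1 ->
  modulus (z - m) < d -> modulus (w - m) < d -> modulus (z + t%:C * (w - z) - m) < d.
Proof.
move=> /andP[t0 t1] zd wd.
have -> : z + t%:C * (w - z) - m = (1 - t)%:C * (z - m) + t%:C * (w - m).
  by rewrite rmorphB rmorph1; ring.
apply: le_lt_trans (modulusD _ _) _; rewrite !modulusM !modulus_real !ger0_norm ?subr_ge0 //.
have [->|tN0] := eqVneq t 0; first by rewrite subr0 mul1r mul0r addr0.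
have : t * modulus (w - m) < t * d by rewrite ltr_pM2l // lt_def tN0.
have : (1 - t) * modulus (z - m) <= (1 - t) * d by rewrite ler_wpM2l ?subr_ge0 // ltW.
by lra.
Qed.

(* [m] maximizes [v] on the closure of the set of points reachable from [a] along
   polygons inside [v > t]. *)
Lemma reach_local_max (Omega : set C) (v : C -> R) (a : C) (t : R) :
  domain Omega -> {within closure Omega, continuous v} ->
  (forall z, boundary Omega z -> v z = 0) -> (forall z, Omega z -> {for z, continuous v}) ->
  0 <= t -> Omega a -> t < v a ->
  exists l, [/\ forall p : C, ~ offp a l p -> Omega p /\ t < v p, Omega (last a l) &
    exists2 d : R, 0 < d & forall p : C, modulus (p - last a l) < d -> v p <= v (last a l)].
Proof.
move=> [_ oO _ bO] vc vb vcont t0 Oa ta.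
pose path_to z := fun l => last a l = z /\ forall p : C, ~ offp a l p -> Omega p /\ t < v p.
pose Rch := [set z : C | Omega z /\ exists l, path_to z l].
have Ra : Rch a by split=> //; exists [::]; split=> // p H; exfalso; apply: H.
have [M M0 HM] := bounded_modulus bO.
have sub : closure Rch `<=` closure Omega by apply: closureS => z [].
have cA : compact (closure Rch).
  by apply: (bounded_closed_compactC (M := M)); [exact: closed_closure | move=> z /sub/HM].
have vcA : {within closure Rch, continuous v} by exact: continuous_subspaceW vc.
have [|m mA mmax] := compact_EVT_max _ cA vcA; first by exists a; exact: subset_closure.
rewrite inE in mA.
have tm : t < v m.
  apply: lt_le_trans ta _; apply: mmax; rewrite inE; exact: subset_closure.
(* Boundary values are 0, hence at most [t], which puts the maximum inside [Omega]. *)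
have Om : Omega m.
  apply: contrapT => nO; have := vb m (closure_boundary oO (sub m mA) nO) => E.
  by move: tm; rewrite E ltNge t0.
have [d1 d10 Hd1] := (openP _).1 oO m Om.
have e0 : 0 < v m - t by rewrite subr_gt0.
have /continuousP_eps /(_ _ e0)[d2 d20 Hd2] := vcont m Om.
pose d := Num.min d1 d2; have d0 : 0 < d by rewrite lt_min d10.
have ball p : modulus (p - m) < d -> Omega p /\ t < v p.
  rewrite lt_min => /andP[/Hd1 Op /Hd2 Vp]; split=> //.
  by move: Vp; rewrite ltr_norml => /andP[+ _]; set x := v p; lra.
have [z [Oz [l [lz Hl]]] zm] := (closureP _ _).1 mA d d0.
have reach w : modulus (w - m) < d -> path_to w (rcons l w).
  move=> wm; split; first by rewrite last_rcons.
  move=> p Hp; have [pl|pl] := pselect (offp a l p); last exact: Hl.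
  have /not_off[x x01 ->] : ~ off (last a l) w p.
    by move=> pw; apply: Hp; apply/offp_rcons.
  by apply: ball; rewrite lz; exact: segment_ball.
have mm : modulus (m - m) < d by rewrite subrr modulus0.
have [lm Hlm] := reach m mm.
exists (rcons l m); rewrite lm; split=> //.
exists d => // p pm; apply: mmax; rewrite inE; apply: subset_closure.
by split; [exact: (ball p pm).1 | exists (rcons l p); exact: reach].
Qed.

Lemma unit_sqrt (b : R[i]) : b != 0 -> exists2 e : R[i], modulus e = 1 & b * e ^+ 2 = (modulus b)%:C.
Proof.
move=> b0; have mb : 0 < modulus b by rewrite ltr_modulus_gt0.
pose e := sqrtC ((modulus b)%:C / b).
have e2 : e ^+ 2 = (modulus b)%:C / b by rewrite sqrtCK.
exists e; last by rewrite e2 mulrCA divff // mulr1.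
apply/eqP; rewrite -(@eqrXn2 _ 2) ?modulus_ge0 // expr1n -modulusX e2.
by rewrite modulusM modulusV modulus_real gtr0_norm // divff // gt_eqF.
Qed.

(** Rotation by [e] diagonalizes the quadratic part: [(|b| - 1) / 2] along [e] and [- (|b| + 1) / 2]
    along ['i * e]. The tolerance is half of the smaller modulus. *)
Lemma saddle_directions (v : C -> R) (s : C) (b : C) : expansion2 v s 0 b 1 -> 1 < modulus b ->
  exists e : R[i], modulus e = 1 /\ exists2 d : R, 0 < d & forall x : R, x != 0 -> `|x| < d ->
    v s < v (s + x%:C * e) /\ v (s + x%:C * ('i * e)) < v s.
Proof.
move=> H b1; have b0 : b != 0 by rewrite -ltr_modulus_gt0; exact: lt_trans b1.
have [e e1 be] := unit_sqrt b0.
have eps0 : 0 < (modulus b - 1) / 4 by rewrite divr_gt0 // subr_gt0.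
have [d d0 Hd] := H _ eps0; exists e; split=> //; exists d => // x x0 xd.
have x2 : 0 < x ^+ 2 by rewrite exprn_even_gt0.
have mi : modulus ('i : R[i]) = 1 by rewrite /modulus /= expr1n expr0n /= add0r sqrtr1.
have ii : ('i : R[i]) ^+ 2 = -1 by rewrite sqr_i.
have m1 : modulus (x%:C * e) = `|x| by rewrite modulusM modulus_real e1 mulr1.
have m2 : modulus (x%:C * ('i * e)) = `|x| by rewrite !modulusM modulus_real mi e1 !mulr1.
have r1 : complex.Re (b * (x%:C * e) ^+ 2) = x ^+ 2 * modulus b.
  by rewrite exprMn mulrCA be -rmorphXn -rmorphM.
have r2 : complex.Re (b * (x%:C * ('i * e)) ^+ 2) = - (x ^+ 2 * modulus b).
  by rewrite !exprMn ii mulN1r !mulrN mulrCA be -rmorphXn -rmorphM.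
have n2 : `|x| ^+ 2 = x ^+ 2 by rewrite real_normK // num_real.
have b2 : x ^+ 2 < x ^+ 2 * modulus b by rewrite ltr_pMr.
have E : (modulus b - 1) / 4 * x ^+ 2 = (x ^+ 2 * modulus b - x ^+ 2) / 4 by field.
split.
  have := Hd (x%:C * e); rewrite m1 => /(_ xd); rewrite mul0r r1 n2 E mul1r subr0 ler_norml => /andP[+ _].
  by move: b2; set y := x ^+ 2 * modulus b; set V := v _; lra.
have := Hd (x%:C * ('i * e)); rewrite m2 => /(_ xd); rewrite mul0r r2 n2 E mul1r subr0 ler_norml => /andP[_ +].
by move: b2; set y := x ^+ 2 * modulus b; set V := v (s + _); lra.
Qed.

(** One of [1] and ['i] makes [Re (b w^2)] nonpositive, and a change of sign does the same for the
    linear term; then [- |w|^2 / 2] beats the tolerance 1/4. *)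
Lemma no_local_min (v : C -> R) z (a b : C) : expansion2 v z a b 1 -> forall d : R, 0 < d ->
  exists2 p : C, modulus (p - z) < d & v p < v z.
Proof.
move=> H d d0; have e0 : 0 < 1 / 4 :> R by lra.
have [d1 d10 Hd1] := H _ e0.
pose t := Num.min d d1 / 2.
have m0 : 0 < Num.min d d1 by rewrite lt_min d0.
have t0 : 0 < t by rewrite divr_gt0.
have tm : t < Num.min d d1 by rewrite ltr_pdivrMr // mulrDr mulr1 ltrDl.
move: (tm); rewrite lt_min => /andP[td td1].
have [w w1 [aw bw]] : exists2 w : R[i], modulus w = 1 & complex.Re (a * w) <= 0 /\ complex.Re (b * w ^+ 2) <= 0.
  have [u u1 bu] : exists2 u : R[i], modulus u = 1 & complex.Re (b * u ^+ 2) <= 0.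
    have [bp|bn] := leP (complex.Re b) 0.
      by exists 1; [exact: (modulus_nat R 1) | rewrite expr1n mulr1].
    exists 'i; first by rewrite /modulus /= expr1n expr0n /= add0r sqrtr1.
    by rewrite sqr_i mulrN1 raddfN /= oppr_le0 ltW.
  have [ap|an] := leP (complex.Re (a * u)) 0; first by exists u.
  exists (- u); first by rewrite modulusN.
  by rewrite mulrN raddfN /= oppr_le0 ltW //= sqrrN.
have mt : modulus (t%:C * w) = t by rewrite modulusM modulus_real w1 mulr1 gtr0_norm.
exists (z + t%:C * w); first by rewrite [z + _]addrC addrK mt.
have := Hd1 (t%:C * w); rewrite mt => /(_ td1).
have -> : complex.Re (a * (t%:C * w)) = t * complex.Re (a * w).
  by rewrite mulrCA; case: (a * w) => x y /=; rewrite mul0r subr0.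
have -> : complex.Re (b * (t%:C * w) ^+ 2) = t ^+ 2 * complex.Re (b * w ^+ 2).
  rewrite exprMn mulrCA -rmorphXn; case: (b * w ^+ 2) => x y /=.
  by rewrite mul0r subr0.
rewrite mul1r ler_norml => /andP[_].
have : t * complex.Re (a * w) <= 0 by rewrite pmulr_rle0.
have t20 : 0 < t ^+ 2 by rewrite exprn_gt0.
have : t ^+ 2 * complex.Re (b * w ^+ 2) <= 0 by rewrite pmulr_rle0.
set x1 := t * _; set x2 := _ * complex.Re _; set V := v (_ + _); lra.
Qed.

Lemma local_max_critical (v : C -> R) m (a b : C) (d : R) : expansion2 v m a b 1 -> 0 < d ->
  (forall p, modulus (p - m) < d -> v p <= v m) -> a = 0 /\ modulus b <= 1.
Proof.
move=> H d0 Hmax.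
have a0 : a = 0.
  apply/eqP/negPn/negP => a0; have ma : 0 < modulus a by rewrite ltr_modulus_gt0.
  have ma2 : 0 < modulus a / 2 by rewrite divr_gt0.
  have [d1 d10 Hd1] := expansion21 H ma2.
  pose t := Num.min d d1 / 2 / modulus a.
  have m0 : 0 < Num.min d d1 by rewrite lt_min d0.
  have t0 : 0 < t by rewrite !divr_gt0.
  have mt : modulus (t%:C * conjc a) = Num.min d d1 / 2.
    rewrite modulusM modulus_real gtr0_norm // (_ : modulus (conjc a) = modulus a).
      by rewrite divfK // gt_eqF.
    by case: (a) => x y; rewrite /modulus /= sqrrN.
  have tm : Num.min d d1 / 2 < Num.min d d1 by rewrite ltr_pdivrMr // mulrDr mulr1 ltrDl.
  move: (tm); rewrite lt_min => /andP[td td1].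
  have := Hd1 (t%:C * conjc a); rewrite mt => /(_ td1).
  have := Hmax (m + t%:C * conjc a); rewrite [m + _]addrC addrK mt [_ + m]addrC => /(_ td).
  have -> : complex.Re (a * (t%:C * conjc a)) = modulus a * (Num.min d d1 / 2).
    rewrite mulrCA -modulus_sqrE -rmorphM /= expr2 mulrA /t divfK ?gt_eqF //.
    by rewrite mulrC.
  have := mulr_gt0 ma (divr_gt0 m0 (ltr0n R 2)).
  set y := modulus a * _.
  rewrite (_ : modulus a / 2 * (Num.min d d1 / 2) = y / 2); last by rewrite /y; field.
  by rewrite ler_norml => ? ? /andP[? _]; lra.
split=> //; rewrite leNgt; apply/negP => b1; rewrite a0 in H.
have [e [e1 [d1 d10 Hd1]]] := saddle_directions H b1.
pose t := Num.min d d1 / 2.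
have m0 : 0 < Num.min d d1 by rewrite lt_min d0.
have t0 : 0 < t by rewrite divr_gt0.
have tm : t < Num.min d d1 by rewrite ltr_pdivrMr // mulrDr mulr1 ltrDl.
move: (tm); rewrite lt_min => /andP[td td1].
have [||V _] := Hd1 t; [by rewrite gt_eqF | by rewrite gtr0_norm |].
have := Hmax (m + t%:C * e); rewrite [m + _]addrC addrK modulusM modulus_real e1 mulr1 gtr0_norm //.
by move=> /(_ td); rewrite leNgt addrC V.
Qed.

Lemma expansion2_grad (v : C -> R) z (a b : C) (c : R) : expansion2 v z a b c ->
  grad_zero v z <-> a = 0.
Proof.
move=> /expansion21/expansion1_grad[Ex Ey]; rewrite /grad_zero Ex Ey; split.
  move=> [r0 /eqP]; rewrite oppr_eq0 => /eqP i0.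
  by apply/eqP; rewrite eq_complex r0 i0 !eqxx.
by move=> ->; rewrite oppr0.
Qed.

Lemma linear_dependence (n : nat) (K : finType) (A : 'I_n -> K -> R) : (#|K| < n)%N ->
  exists c : 'I_n -> R, (exists i, c i != 0) /\ forall k, \sum_i c i * A i k = 0.
Proof.
move=> sz; pose B : 'M[R]_(n, #|K|) := \matrix_(i, j) A i (enum_val j).
have : kermx B != 0.
  rewrite kermx_eq0 /row_free; apply/eqP => E.
  by have := rank_leq_col B; rewrite E leqNgt sz.
move=> /rowV0Pn[w /sub_kermxP wB w0].
exists (fun i => w 0 i); split.
  apply: contrapT => N; move/negP: w0; apply; apply/eqP/rowP => i; rewrite mxE.
  by apply/eqP/negPn/negP => wi; apply: N; exists i.
move=> k; have := congr1 (fun B : 'rV[R]__ => B 0 (enum_rank k)) wB.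
by rewrite !mxE => E; apply: etrans E; apply: eq_bigr => i _; rewrite mxE enum_rankK.
Qed.

End Saddles.

(** * Counting saddles by linear algebra *)

Section SaddleCount.
Variable R : realType.
Local Notation C := (cplane R).
Variables (Omega : set C) (v : C -> R) (a b : C -> C).
Hypotheses (dO : domain Omega) (vc : {within closure Omega, continuous v}).
Hypotheses (vb : forall z, boundary Omega z -> v z = 0) (vpos : forall z, Omega z -> 0 < v z).
Hypothesis vexp : forall z, Omega z -> expansion2 v z (a z) (b z) 1.

Let vcont z : Omega z -> {for z, continuous v}.
Proof. by move=> /vexp/expansion21/expansion1_continuous. Qed.

(** Only the necessary condition for a local maximum: degenerate critical points with [|b| = 1] are
    included, as they are in the count of [fatou_count]. *)
Definition local_max m := Omega m /\ a m = 0 /\ modulus (b m) <= 1.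

Definition ascent (s h : R[i]) (lp lm : seq R[i]) := [/\ h != 0,
  (forall p : C, ~ offp (s + h) lp p -> Omega p /\ v s < v p) /\
  (forall p : C, ~ offp (s - h) lm p -> Omega p /\ v s < v p),
  forall p : C, ~ off (s - h) (s + h) p -> Omega p /\ (p = s \/ v s < v p),
  exists2 t0 : R, 0 < t0 & forall t : R, 0 < t <= t0 ->
    v (s + t%:C * ('i * h)) < v s /\ v (s - t%:C * ('i * h)) < v s
  & local_max (last (s + h) lp) /\ local_max (last (s - h) lm)].

Let climb (p : C) t : 0 <= t -> Omega p -> t < v p -> exists l,
  (forall q : C, ~ offp p l q -> Omega q /\ t < v q) /\ local_max (last p l).
Proof.
move=> t0 Op tp; have [l [H1 H2 [d d0 H3]]] := reach_local_max dO vc vb vcont t0 Op tp.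
by exists l; split=> //; split=> //; exact: local_max_critical (vexp H2) d0 H3.
Qed.

(** A short straight edge along the uphill direction, centred at the saddle, is continued from both
    ends by [climb]; positivity of [v] makes [v s] an admissible threshold. *)
Lemma ascentP (s : C) : Omega s -> a s = 0 -> 1 < modulus (b s) -> exists h lp lm, ascent s h lp lm.
Proof.
move=> Os as0 bs; have [_ /openP oO _ _] := dO.
have := vexp Os; rewrite as0 => /saddle_directions -/(_ bs)[e [e1 [d1 d10 Hd1]]].
have [d2 d20 Hd2] := oO s Os.
have [d d0 /andP[dd1 dd2]] : exists2 d, 0 < d & (d < d1) && (d < d2).
  have m0 : 0 < Num.min d1 d2 by rewrite lt_min d10.
  exists (Num.min d1 d2 / 2); first by rewrite divr_gt0.
  by rewrite -lt_min ltr_pdivrMr // mulrDr mulr1 ltrDl.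
have e0 : e != 0 by rewrite -ltr_modulus_gt0 e1.
have up (x : R) : `|x| <= d -> Omega (s + x%:C * e) /\ (x != 0 -> v s < v (s + x%:C * e)).
  move=> xd; split; last by move=> x0; have [] := Hd1 x x0 (le_lt_trans xd dd1).
  by apply: Hd2; rewrite [s + _]addrC addrK modulusM modulus_real e1 mulr1; exact: le_lt_trans dd2.
have [Op /(_ (lt0r_neq0 d0)) vp] : Omega (s + d%:C * e) /\ (d != 0 -> v s < v (s + d%:C * e)).
  by apply: up; rewrite gtr0_norm.
have [Om vm] : Omega (s - d%:C * e) /\ v s < v (s - d%:C * e).
  have [|O1 V1] := up (- d); first by rewrite normrN gtr0_norm.
  by move: O1 V1; rewrite oppr_eq0 lt0r_neq0 // rmorphN mulNr; split=> //; exact: V1.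
have [lp [Hlp mp]] := climb (ltW (vpos Os)) Op vp.
have [lm [Hlm mm]] := climb (ltW (vpos Os)) Om vm.
exists (d%:C * e), lp, lm; split=> //.
- by rewrite mulf_neq0 // -ltr_modulus_gt0 modulus_real normr_gt0 lt0r_neq0.
- move=> p /not_off[t /andP[t0 t1] ->].
  have -> : s - d%:C * e + t%:C * (s + d%:C * e - (s - d%:C * e)) = s + ((2 * t - 1) * d)%:C * e.
    by rewrite rmorphM rmorphB rmorphM rmorph1 rmorph_nat; ring.
  have [|O1 V1] := up ((2 * t - 1) * d).
    rewrite normrM [X in _ * X]gtr0_norm // ler_piMl ?(ltW d0) // ler_norml; apply/andP; split; lra.
  split=> //; have [->|x0] := eqVneq ((2 * t - 1) * d) 0; last by right; exact: V1.
  by left; rewrite rmorph0 mul0r addr0.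
exists 1 => // t /andP[t0 t1].
have -> : t%:C * ('i * (d%:C * e)) = (t * d)%:C * ('i * e) by rewrite rmorphM; ring.
have td : `|t * d| < d1.
  by rewrite gtr0_norm ?mulr_gt0 //; apply: le_lt_trans dd1; rewrite ler_piMl // ltW.
have td0 : t * d != 0 by rewrite lt0r_neq0 // mulr_gt0.
split; first by have [] := Hd1 _ td0 td.
have := Hd1 (- (t * d)); rewrite oppr_eq0 normrN => /(_ td0 td)[_].
by rewrite rmorphN mulNr.
Qed.

Lemma farther_point (z : C) : Omega z -> exists2 w : C, Omega w & modulus z < modulus w.
Proof.
have [_ /openP oO _ _] := dO => Oz; have [d d0 Hd] := oO z Oz.
have d2 : 0 < d / 2 by rewrite divr_gt0.
have dd : d / 2 < d by rewrite ltr_pdivrMr // mulrDr mulr1 ltrDl.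
have [z0|z0] := eqVneq z 0.
  exists (d / 2)%:C; first by apply: Hd; rewrite z0 subr0 modulus_real gtr0_norm.
  by rewrite z0 modulus0 modulus_real gtr0_norm.
have mz : 0 < modulus z by rewrite ltr_modulus_gt0.
exists ((1 + d / 2 / modulus z)%:C * z).
  apply: Hd; rewrite rmorphD rmorph1 mulrDl mul1r [z + _]addrC addrK modulusM modulus_real.
  by rewrite gtr0_norm ?divr_gt0 // divfK // gt_eqF.
by rewrite modulusM modulus_real gtr0_norm ?addr_gt0 ?divr_gt0 // ltr_pMl // ltrDl divr_gt0.
Qed.

(** A point of the closure farthest from 0. The ray beyond it misses [Omega], so the winding
    vanishes there and its boundary component costs no equation. *)
Lemma outer_point : exists x : C, [/\ boundary Omega x, x != 0 &
  forall t : R, 1 <= t -> ~ Omega (t%:C * x)].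
Proof.
have [[p Op] oO _ bO] := dO; have [M M0 HM] := bounded_modulus bO.
have cA : compact (closure Omega).
  by apply: (bounded_closed_compactC (M := M)); [exact: closed_closure | exact: HM].
have [||x xA xmax] := @compact_EVT_max C R (@modulus R) (closure Omega) _ cA.
- by exists p; exact: subset_closure.
- by apply: continuous_subspaceT; exact: modulus_continuous.
rewrite inE in xA.
have xm (z : C) : Omega z -> modulus z < modulus x.
  move=> /farther_point[w Ow zw]; apply: lt_le_trans zw _.
  by apply: xmax; rewrite inE; exact: subset_closure.
have out (t : R) : 1 <= t -> ~ Omega (t%:C * x).
  move=> t1 /xm; rewrite modulusM modulus_real ger0_norm ?(le_trans ler01) //.
  by apply/negP; rewrite -leNgt ler_peMl ?modulus_ge0.
exists x; split=> //; last by rewrite -ltr_modulus_gt0; apply: le_lt_trans (xm _ Op); exact: modulus_ge0.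
by apply: closure_boundary => //; have := out 1 (lexx 1); rewrite rmorph1 mul1r.
Qed.

Lemma boundary_reps k : connectivity Omega k -> exists rep : 'I_k -> C,
  forall y, boundary Omega y -> exists j, connected_component (boundary Omega) y (rep j).
Proof.
move=> /card_set_bijP[f [fun_f inj_f surj_f]].
have H (j : 'I_k) : exists z, boundary Omega z /\ f (connected_component (boundary Omega) z) = j.
  by have [A [z bz <-] E] := surj_f j (ltn_ord j); exists z.
have [rep Hrep] := choice H; exists rep => y by_.
have yk : (f (connected_component (boundary Omega) y) < k)%N by apply: fun_f; exists y.
have [bz fz] := Hrep (Ordinal yk); exists (Ordinal yk); move: (rep _) bz fz => z bz fz.
rewrite (_ : connected_component (boundary Omega) y = connected_component (boundary Omega) z).
  exact: connected_component_refl.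
by apply: inj_f; rewrite ?fz //= inE; [exists y | exists z].
Qed.

(** Values are measured from the base point [m0], so closing a chain takes one equation per point of
    [L] and none at [m0]. *)
Lemma sum_increments (m0 : R[i]) (L : seq R[i]) (phi : R[i] -> R) x : uniq (m0 :: L) -> x \in m0 :: L ->
  phi x - phi m0 = \sum_(m <- L) (x == m)%:R * (phi m - phi m0).
Proof.
rewrite /= inE => /andP[m0L uL] /orP[/eqP->|xL].
  rewrite subrr big1_seq // => m /andP[_ mL].
  by case: eqP mL m0L => [<- ->//|_ _ _]; rewrite mul0r.
rewrite (bigD1_seq x) //= eqxx mul1r big1 ?addr0 // => m mx.
by rewrite eq_sym (negbTE mx) mul0r.
Qed.

Lemma saddle_count k (LA LB : seq R[i]) : connectivity Omega k -> uniq LA -> uniq LB ->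
  (forall z : C, z \in LB -> [/\ Omega z, a z = 0 & 1 < modulus (b z)]) ->
  (forall z, local_max z -> z \in LA) -> LB != [::] -> (size LB + 2 <= size LA + k)%N.
Proof.
move=> Hk uA uB HB HA B0; rewrite leqNgt; apply/negP => small.
pose s (i : 'I_(size LB)) : R[i] := nth 0 LB i.
have sB i : s i \in LB by exact: mem_nth.
have H i : exists x : R[i] * seq R[i] * seq R[i], ascent (s i) x.1.1 x.1.2 x.2.
  have [Os as0 bs] := HB _ (sB i); have [h [lp [lm H]]] := ascentP Os as0 bs.
  by exists (h, lp, lm).
have [f Hf] := choice H.
pose h i := (f i).1.1; pose lp i := (f i).1.2; pose lm i := (f i).2.
pose tip i := last (s i + h i) (lp i); pose tail i := last (s i - h i) (lm i).
have tipA i : tip i \in LA by apply: HA; case: (Hf i) => _ _ _ _ [].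
have tailA i : tail i \in LA by apply: HA; case: (Hf i) => _ _ _ _ [].
have [rep Hrep] := boundary_reps Hk; have [x [bx x0 outx]] := outer_point.
have [j0 Hj0] := Hrep x bx.
have B1 : (0 < size LB)%N by rewrite lt0n size_eq0.
case: LA uA HA tipA tailA small => [_ _ /(_ (Ordinal B1))//|m0 L uA HA tipA tailA small].
(* Index set of the equations: closure of the chain at the points of [L], and zero winding at a
   representative of each component other than that of [x]; in total [#LA - 1 + k - 1]. *)
pose K := ('I_(size L) + {j : 'I_k | j != j0})%type.
pose A i (q : K) : R := match q with
  | inl m => (tip i == nth 0 L m)%:R - (tail i == nth 0 L m)%:R
  | inr j => sweep s h lp lm i (rep (val j)) end.
have cK : (#|{: K}| < size LB)%N.
  rewrite card_sum card_ord card_sig.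
  have -> : #|[pred j : 'I_k | j != j0]| = k.-1 by rewrite cardC1 card_ord.
  by move: small (ltn_ord j0) => /=; lia.
have [c [[i1 ci1] Hc]] := linear_dependence A cK.
have cyc (phi : R[i] -> R) : \sum_i c i * (phi (tip i) - phi (tail i)) = 0.
  transitivity (\sum_(m < size L) (phi (nth 0 L m) - phi m0) * \sum_i c i * A i (inl m)).
    rewrite (eq_bigr _ (fun m _ => mulr_sumr _ _ _ _)) exchange_big /=; apply: eq_bigr => i _.
    have -> : phi (tip i) - phi (tail i) = (phi (tip i) - phi m0) - (phi (tail i) - phi m0) by ring.
    rewrite !(sum_increments _ uA) // -sumrB mulr_sumr (big_nth 0) big_mkord.
    by apply: eq_bigr => m _; ring.
  by rewrite big1 // => m _; rewrite Hc mulr0.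
have Hlp i (p : C) : ~ offp (s i + h i) (lp i) p -> Omega p /\ v (s i) < v p.
  by case: (Hf i) => _ [+ _] _ _ _; exact.
have Hlm i (p : C) : ~ offp (s i - h i) (lm i) p -> Omega p /\ v (s i) < v p.
  by case: (Hf i) => _ [_ +] _ _ _; exact.
have Hedge i (p : C) : ~ off (s i - h i) (s i + h i) p -> Omega p /\ (p = s i \/ v (s i) < v p).
  by case: (Hf i) => _ _ + _ _; exact.
have off_bdry y : boundary Omega y -> off_chain s h lp lm c y.
  have [_ /interior_id oO _ _] := dO; rewrite /boundary oO => -[_ nOy].
  exact: (off_outside Hlp Hlm Hedge).
have Wcomp y z : connected_component (boundary Omega) y z ->
    boundary Omega y -> winding s h lp lm c y = winding s h lp lm c z.
  move=> yz by_; apply: (winding_connected cyc (component_connected (A := boundary Omega) (x := y))) => //.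
    by move=> p /connected_component_sub/off_bdry.
  exact: connected_component_refl.
have bdry y : boundary Omega y -> winding s h lp lm c y = 0.
  move=> by_; have [j Hj] := Hrep y by_; rewrite (Wcomp _ _ Hj by_).
  have [->|jj0] := eqVneq j j0; last exact: Hc (inr (exist _ j jj0)).
  rewrite -(Wcomp _ _ Hj0 bx).
  exact: (winding_outer Hlp Hlm Hedge cyc x0 outx).
apply: (no_cycle dO vcont _ _ _ Hlp Hlm Hedge _ cyc bdry ci1).
- by move=> z Oz d d0; exact: no_local_min (vexp Oz) d d0.
- by move=> i; case: (Hf i).
- by move=> i j /eqP; rewrite nth_uniq // => /eqP/val_inj.
- by move=> i; case: (Hf i).
Qed.

End SaddleCount.

Local Close Scope complex_scope.

Theorem theorem3p2 (R : realType) (Omega D : set (cplane R))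
    (P Q : {poly R[i]}) (u v : cplane R -> R) (n k : nat)
    (HRL : RL_domain Omega D P Q u)
    (HOmega : Omega = [set z | D z /\ 0 < 2 * u z - modulus z ^+ 2])
    (Hsmooth : smooth_boundary Omega)
    (Horder : ratfun_degree P Q = n)
    (Hn : (2 <= n)%N)
    (Hconn : connectivity Omega k)
    (Hann : ~ annulus Omega)
    (Hv : landscape Omega v) :
  exists N : nat, (critical_points Omega v #= `I_N)%card /\ (N + 6 <= 4 * n + k)%N.
Proof.
have [dO [Q0 cPQ] [_ cOD QD] _ _] := HRL; have [_ _ vc vb] := Hv.
have vexp z (Oz : Omega z) := landscape_expansion HRL Hv Oz.
have vpos z : Omega z -> 0 < v z.
  move=> Oz; rewrite (landscape_eq HRL Hv Oz).
  by move: Oz; rewrite {1}HOmega /= => -[_]; set m := modulus z ^+ 2; lra.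
have nd : nondeg n (P, Q).
  by rewrite /nondeg /= cPQ; apply/eqP.
have Qz z : Omega z -> Q.[z] != 0 by move=> Oz; apply: QD; apply: cOD; exact: subset_closure.
have critE z : Omega z -> grad_zero v z <-> ratfun P Q z - conjc z = 0.
  by move=> Oz; exact: expansion2_grad (vexp z Oz).
pose crit (z : R[i]) := `[< critical_points Omega v z >].
have crit_fix z : crit z -> fixpt P Q z.
  move=> /asboolP[Oz /(critE z Oz)/eqP]; rewrite subr_eq0 => /eqP E.
  by split; [exact: Qz | rewrite -E /ratfun divfK // Qz].
(* Critical points are fixed points of the second iterate, hence among the finitely many roots of a
   nonzero polynomial; this turns them into a list. *)
have [rs Hrs] := closed_field_poly_normal (secA n P Q - 'X * secB n P Q).
pose L := undup [seq z <- rs | crit z].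
have memL z : (z \in L) = crit z.
  rewrite mem_undup mem_filter; apply/andb_idr => /crit_fix/(fixpt_root nd).
  by rewrite Hrs rootZ ?root_prod_XsubC // lead_coef_eq0; exact: sec_neqX nd Hn.
pose flat (z : R[i]) := modulus (ratf' P Q z) <= 1.
pose LA := [seq z <- L | flat z]; pose LB := [seq z <- L | ~~ flat z].
have sL : (size L = size LA + size LB)%N by rewrite !size_filter count_predC.
have uL : uniq L by exact: undup_uniq.
exists (size L); split.
  apply/card_set_bijP; exists (fun z => index (z : R[i]) L); split.
  - by move=> z zc; rewrite /= index_mem memL; apply/asboolP.
  - move=> z w; rewrite !inE => zc wc E; apply: (@index_inj _ (0 : R[i]) L z w _ _ E);
      by rewrite memL; apply/asboolP.
  - move=> j jL; exists (nth 0 L j); last by rewrite index_uniq.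
    by apply/asboolP; rewrite -/(crit _) -memL mem_nth.
have sA : (size LA <= n + n - 2)%N.
  apply: (fatou_count nd Hn); first by rewrite filter_uniq.
  by move=> z; rewrite mem_filter memL => /andP[fz /crit_fix].
(* Without saddles, [N <= 2n - 2] is enough because [n >= 2]. *)
have [B0|B0] := eqVneq LB [::]; first by rewrite sL B0 /=; lia.
have sB : (size LB + 2 <= size LA + k)%N.
  apply: (saddle_count dO vc vb vpos vexp Hconn _ _ _ _ B0).
  - by rewrite filter_uniq.
  - by rewrite filter_uniq.
  - move=> z; rewrite mem_filter memL /flat /= -ltNge => /andP[zf /asboolP[Oz /(critE z Oz)]].
    by [].
  - move=> z [Oz [az bz]]; rewrite mem_filter memL /flat bz.
    by apply/asboolP; split=> //; apply/critE.
by rewrite sL; lia.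
Qed.
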